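(* Let $(\hat\lambda,\hat\mu)$ denote the maximum likelihood estimators of $(\lambda,\mu)\in(0,\infty)\times[0,2\pi)$ based on continuous observation of the von Mises process $$d\theta_t=-\lambda\sin(\theta_t-\mu)\,dt+\sigma\,dW_t,\qquad t\in[0,T],$$ with $\sigma>0$ known. Then, as $T\to\infty$, uniformly on compact subsets of the parameter space $(0,\infty)\times[0,2\pi)$, $$\sqrt{T}(\hat\lambda-\lambda)\xrightarrow{d}N\left(0,\frac{2\sigma^2I_0(\kappa)}{I_0(\kappa)-I_2(\kappa)}\right),$$ $$\sqrt{T}(\hat\mu-\mu)\xrightarrow{d}N\left(0,\frac{2\sigma^2I_0(\kappa)}{\lambda^2\left(I_0(\kappa)+I_2(\kappa)\right)}\right),$$ where $\kappa=2\lambda/\sigma^2$ and $I_\nu$ denotes the modified Bessel function of the first kind of order $\nu$.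
   Context: $W$ is a standard Brownian motion, $\theta_0$ is an initial value independent of $W$, and the process on the circle is identified with its continuous lift to $\mathbb{R}$ in stochastic integrals with respect to $d\theta_t$. With $b(\theta;\lambda,\mu)=-\lambda\sin(\theta-\mu)$, the log-likelihood under continuous observation (up to an additive constant) is $$L_T(\lambda,\mu)=\frac{1}{\sigma^2}\int_0^T b(\theta_t;\lambda,\mu)\,d\theta_t-\frac{1}{2\sigma^2}\int_0^T b(\theta_t;\lambda,\mu)^2\,dt,$$ and the maximum likelihood estimator $(\hat\lambda,\hat\mu)$ is a measurable maximizer of $L_T$ over the parameter space $(0,\infty)\times[0,2\pi)$ whenever one exists. The parameter $\mu$ is an angle identified modulo $2\pi$, and $\hat\mu-\mu$ denotes the representative in $(-\pi,\pi]$ of the angular difference. $N(0,v)$ is the centered normal law with variance $v$. Uniform convergence in distribution on a compact set $K$ of parameters means: for every bounded continuous $g:\mathbb{R}\to\mathbb{R}$, the supremum over true parameters $(\lambda,\mu)\in K$ of the absolute difference between the expectation of $g$ of the normalized estimator under the true parameter $(\lambda,\mu)$ and the expectation of $g$ under the stated normal law tends to $0$ as $T\to\infty$. *)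

(* Defs.v *)
From HB Require Import structures.
From mathcomp Require Import all_boot all_order all_algebra.
From mathcomp Require Import all_classical all_reals all_analysis.
From mathcomp Require Import lra.

Set Implicit Arguments.
Unset Strict Implicit.
Unset Printing Implicit Defensive.

Import Order.TTheory GRing.Theory Num.Theory.
Import numFieldNormedType.Exports.

Local Open Scope classical_set_scope.
Local Open Scope ring_scope.

(* I_n of integer order n, by its power series. *)
Definition besselI (R : realType) (n : nat) (x : R) : R :=
  limn (series (fun k : nat =>
    (x / 2) ^+ (2 * k + n)%N / (k`! * (k + n)`!)%N%:R)).

(* The representative of a modulo 2 pi in ]-pi, pi]; see angleP. *)
Definition angle (R : realType) (a : R) : R :=
  a - 2 * pi * (Num.ceil ((a - pi) / (2 * pi)))%:~R.

Lemma angleP (R : realType) (a : R) :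
  - pi < angle a <= pi /\ exists k : int, angle a = a + 2 * pi * k%:~R.
Proof.
rewrite /angle; set k := Num.ceil _; split; last first.
  by exists (- k); rewrite rmorphN mulrN.
have p0 : 0 < 2 * pi :> R by rewrite mulr_gt0// pi_gt0.
have /andP[] : (k - 1)%:~R < (a - pi) / (2 * pi) <= k%:~R := ceil_itv _.
rewrite ltr_pdivlMr// ler_pdivrMr// rmorphB/= => h1 h2.
by apply/andP; split; lra.
Qed.

Section probability.
Context {R : realType} {d : measure_display} {Omega : measurableType d}.
Implicit Type P : probability Omega R.

(* Processes are indexed by R; only times t >= 0 are meaningful. *)
Definition sigma_gen (X : R -> Omega -> R) (I : set R) : set (set Omega) :=
  <<s \bigcup_(t in I) preimage_set_system setT (X t) measurable >>.

Definition indep_rv_sigma P (X : Omega -> R) (G : set (set Omega)) : Prop :=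
  forall (A : set R) (E : set Omega), measurable A -> G E ->
    P (X @^-1` A `&` E) = (P (X @^-1` A) * P E)%E.

Definition brownian_motion P (W : R -> Omega -> R) : Prop :=
  [/\ forall t, 0 <= t -> measurable_fun setT (W t),
      {ae P, forall w, W 0 w = 0},
      {ae P, forall w, {within `[0, +oo[, continuous (W ^~ w)}},
      forall s t (A : set R), 0 <= s -> s < t -> measurable A ->
        P ((W t \- W s) @^-1` A) = normal_prob 0 (Num.sqrt (t - s)) A &
      forall s t, 0 <= s -> s < t ->
        indep_rv_sigma P (W t \- W s) (sigma_gen W `[0, s])].

(* The sum of X_(t_i) (Y_(t_(i+1)) - Y_(t_i)) over the partition
   0 = t_0 < t_1 < ... < t_n = T, where s = [:: t_1; ...; t_n]. *)
Definition left_sum (X Y : R -> Omega -> R) (s : seq R) (w : Omega) : R :=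
  \sum_(i < size s) X (nth 0 (0 :: s) i) w *
    (Y (nth 0 (0 :: s) i.+1) w - Y (nth 0 (0 :: s) i) w).

(* J is (a version of) the Ito integral of X against Y over [0, T], for X and Y
   continuous and adapted and Y a semimartingale: the limit in probability of
   the left-endpoint sums as the mesh of the partition tends to 0. *)
Definition ito_integral P (X Y : R -> Omega -> R) (T : R) (J : Omega -> R) :
    Prop :=
  measurable_fun setT J /\
  forall e : R, 0 < e -> exists2 h : R, 0 < h & forall s : seq R,
    itv_partition 0 T s ->
    (forall i : nat, (i < size s)%N ->
       nth 0 (0 :: s) i.+1 - nth 0 (0 :: s) i < h) ->
    (P [set w | (e <= `|left_sum X Y s w - J w|)%R] <= e%:E)%E.

(* Uniform (for p in K) convergence in distribution of Z T p, under P p, to the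
   centered normal law of variance v p, as T tends to infinity. *)
Definition unif_cvg_normal (P : R * R -> probability Omega R) (K : set (R * R))
    (Z : R -> R * R -> Omega -> R) (v : R * R -> R) : Prop :=
  forall g : R -> R, continuous g -> bounded_fun g ->
    sup [set `| fine 'E_(P p)[g \o Z T p]
               - \int[normal_prob 0 (Num.sqrt (v p))]_x g x | | p in K]
      @[T --> +oo] --> 0.

End probability.

Section von_mises.
Context {R : realType} {d : measure_display} {Omega : measurableType d}.
Implicit Types (P : probability Omega R) (p q : R * R).

Definition param_space : set (R * R) :=
  [set p | 0 < p.1 /\ 0 <= p.2 < 2 * pi].

(* Compact subsets of the parameter space, the second coordinate being an angle
   identified modulo 2 pi: compactness is that of the cylinder
   ]0, +oo[ x circle. See compact_param_compact. *)
Definition param_compact (K : set (R * R)) : Prop :=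
  K `<=` param_space /\
  compact [set ((p.1, cos p.2), sin p.2) | p in K].

Lemma compact_param_compact (K : set (R * R)) :
  K `<=` param_space -> compact K -> param_compact K.
Proof.
move=> KT Kc; split => //; apply: continuous_compact => //.
apply: continuous_subspaceT => p.
have c2 : {for p, continuous (fun q : R * R => q.2)} by exact: cvg_snd.
have cc : {for p, continuous (fun q : R * R => cos q.2)}.
  by exact: (continuous_comp c2 (@continuous_cos R _)).
have cs : {for p, continuous (fun q : R * R => sin q.2)}.
  by exact: (continuous_comp c2 (@continuous_sin R _)).
exact: (cvg_pair (cvg_pair cvg_fst cc) cs).
Qed.

Definition drift (x : R) (p : R * R) : R := - p.1 * sin (x - p.2).

(* theta is the continuous lift to R of the process on the circle. *)
Definition von_mises_process P (sigma : R) (p : R * R)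
    (W theta : R -> Omega -> R) : Prop :=
  [/\ brownian_motion P W,
      forall t, 0 <= t -> measurable_fun setT (theta t),
      indep_rv_sigma P (theta 0) (sigma_gen W `[0, +oo[),
      {ae P, forall w, {within `[0, +oo[, continuous (theta ^~ w)}} &
      {ae P, forall w, forall t, 0 <= t -> theta t w = theta 0 w
        + \int[lebesgue_measure]_(s in `[0, t]) drift (theta s w) p
        + sigma * W t w}].

(* For each q the Ito integral is only defined almost surely; L is a version of
   the log-likelihood field with continuous paths in q, so that maximizing it
   over q is meaningful. *)
Definition log_likelihood P (sigma : R) (theta : R -> Omega -> R) (T : R)
    (L : R * R -> Omega -> R) : Prop :=
  (forall q, param_space q -> exists2 J : Omega -> R,
     ito_integral P (fun t w => drift (theta t w) q) theta T J &
     {ae P, forall w, L q w = (sigma ^+ 2)^-1 * J w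
       - (2 * sigma ^+ 2)^-1 *
         \int[lebesgue_measure]_(t in `[0, T]) (drift (theta t w) q) ^+ 2}) /\
  {ae P, forall w, {within param_space, continuous (L ^~ w)}}.

Definition maximizer (f : R * R -> R) (q : R * R) : Prop :=
  param_space q /\ forall r, param_space r -> f r <= f q.

Definition mle P (L : R * R -> Omega -> R) (est : Omega -> R * R) : Prop :=
  measurable_fun setT est /\
  {ae P, forall w, (exists q, maximizer (L ^~ w) q) ->
     maximizer (L ^~ w) (est w)}.

End von_mises.

(* Main.v *)
(* Put phi = theta - mu. Ito calculus is avoided by working with the Euler scheme Y of
   phi, a function of theta_0 and of finitely many Gaussian increments dW_i.
   - Conditioning on the past shows that E[exp (u^2 V / 2) cos (u S + b)] = cos b for a
     score S = sum_i f(Y_i) dW_i and its information V = sum_i f(Y_i)^2 dt; hence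
     S / sqrt T is nearly normal as soon as V / T is nearly deterministic.
   - The time averages of cos (k Y + b) satisfy, up to errors of order T^(-1/2), the
     three-term recurrence of the Bessel functions I_k. Summing the squared errors shows
     that the average for k = 2 tends to cos b * I_2 / I_0, uniformly in lambda.
   - Y tends to phi uniformly along almost every path, and a Taylor expansion shows that
     their left-endpoint sums have the same limit, which is the Ito integral.
   The log-likelihood at (l, m) is a quadratic polynomial in l cos (m - mu) and
   l sin (m - mu), so the estimator solves a 2 x 2 linear system whose right-hand side is
   given by the two scores. The passage from characteristic functions to bounded
   continuous functions, with uniform bounds, approximates such a function on a large
   interval by a polynomial in a sine of large period. *)

Require Import Defs.
From HB Require Import structures.
From mathcomp Require Import all_boot all_order all_algebra.
From mathcomp Require Import all_classical all_reals all_analysis.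
From mathcomp Require Import measurable_realfun ring lra.
Set Implicit Arguments.
Unset Strict Implicit.
Unset Printing Implicit Defensive.
Import Order.TTheory GRing.Theory Num.Theory.
Import numFieldNormedType.Exports.
Local Open Scope classical_set_scope.
Local Open Scope ring_scope.

(** * Bounded random variables and small exceptional sets *)

(** Uniformity shapes the proof: all errors are bounded by explicit constants involving only [sigma]
    and bounds [l0], [l1] of [lambda] on the compact set. The horizon is chosen before the
    probability space, the parameter and the law of theta_0; the Euler step is chosen last, for a
    fixed T. The recurrence expresses stationarity: the generator applied to cos (k y + b) has
    nearly zero time average, and the invariant density, proportional to exp (kappa cos y), has
    Fourier coefficients I_k / I_0, which satisfy the exact equation. A second solution of the
    recurrence is unbounded in k; only the bound 1 on every average excludes it. This is why all
    harmonics are treated together, although the information involves only the second one, through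
    sin^2 y = (1 - cos (2 y)) / 2. The phase b handles sines and cosines by one argument: 0 leads to
    the score for the length [lambda], - pi / 2 to the score for the angle. Pathwise limits exist
    only almost everywhere and may fail to be measurable, so convergence in probability is phrased
    through small measurable exceptional sets. *)

Section bounded_measurable.
Context {R : realType} {d : measure_display} {T : measurableType d}.
Implicit Types X Y : T -> R.

Definition bmf X := measurable_fun setT X /\ exists M : R, forall w, `|X w| <= M.

Lemma bmf_cst (c : R) : bmf (fun=> c).
Proof. by split; [exact: measurable_cst|exists `|c|]. Qed.

Lemma bmfD X Y : bmf X -> bmf Y -> bmf (fun w => X w + Y w).
Proof.
move=> [mX [M XM]] [mY [N YN]]; split; first exact: measurable_funD.
by exists (M + N) => w; rewrite (le_trans (ler_normD _ _))// lerD.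
Qed.

Lemma bmfM X Y : bmf X -> bmf Y -> bmf (fun w => X w * Y w).
Proof.
move=> [mX [M XM]] [mY [N YN]]; split; first exact: measurable_funM.
by exists (M * N) => w; rewrite normrM ler_pM.
Qed.

Lemma bmfN X : bmf X -> bmf (fun w => - X w).
Proof.
move=> [mX [M XM]]; split; first exact: measurableT_comp.
by exists M => w; rewrite normrN.
Qed.

Lemma bmfB X Y : bmf X -> bmf Y -> bmf (fun w => X w - Y w).
Proof. by move=> bX bY; apply: (bmfD bX); exact: bmfN. Qed.

Lemma bmfZ (c : R) X : bmf X -> bmf (fun w => c * X w).
Proof. by move=> bX; apply: bmfM => //; exact: bmf_cst. Qed.

Lemma bmf_norm X : bmf X -> bmf (fun w => `|X w|).
Proof.
move=> [mX [M XM]]; split; first exact: measurableT_comp.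
by exists M => w; rewrite normr_id.
Qed.

Lemma bmfX X n : bmf X -> bmf (fun w => X w ^+ n).
Proof.
move=> [mX [M XM]]; split; first exact: measurable_funX.
by exists (M ^+ n) => w; rewrite normrX lerXn2r ?nnegrE// (le_trans _ (XM w)).
Qed.

Lemma bmf_sum (n : nat) (X : nat -> T -> R) : (forall i, (i < n)%N -> bmf (X i)) ->
  bmf (fun w => \sum_(i < n) X i w).
Proof.
elim: n => [_|n IH h].
  by under eq_fun do rewrite big_ord0; exact: bmf_cst.
under eq_fun do rewrite big_ord_recr/=.
by apply: bmfD; [apply: IH => i /ltnW; exact: h|exact: h].
Qed.

Lemma bmf_cos X : measurable_fun setT X -> bmf (fun w => cos (X w)).
Proof.
move=> mX; split; last by exists 1 => w; exact: cos_max.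
by apply: (measurableT_comp (f := @cos R)) => //; apply: continuous_measurable_fun; exact: continuous_cos.
Qed.

Lemma bmf_sin X : measurable_fun setT X -> bmf (fun w => sin (X w)).
Proof.
move=> mX; split; last by exists 1 => w; exact: sin_max.
by apply: (measurableT_comp (f := @sin R)) => //; apply: continuous_measurable_fun; exact: continuous_sin.
Qed.

Lemma bmf_expR X : bmf X -> bmf (fun w => expR (X w)).
Proof.
move=> [mX [M XM]]; split; first exact: measurableT_comp.
exists (expR M) => w; rewrite ger0_norm ?expR_ge0// ler_expR.
exact: le_trans (ler_norm _) (XM w).
Qed.

Lemma bmf_indic (A : set T) : measurable A -> bmf (\1_A : T -> R).
Proof.
move=> mA; split; first exact: measurable_indic.
by exists 1 => w; rewrite indicE; case: (_ \in _); rewrite ?normr1 ?normr0.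
Qed.

End bounded_measurable.

Section expectation.
Context {R : realType} {d : measure_display} {T : measurableType d}.
Variable P : probability T R.
Implicit Types X Y : T -> R.

Lemma bmf_integrable X : bmf X -> P.-integrable setT (EFin \o X).
Proof.
move=> [mX [M XM]]; apply: (le_integrable _ (g := EFin \o cst M)) => //.
- exact/measurable_EFinP.
- by move=> w _; rewrite /= lee_fin (le_trans (XM w))// ler_norm.
- exact: finite_measure_integrable_cst.
Qed.

Lemma Ex_cst (c : R) : \int[P]_w c = c.
Proof. by rewrite Rintegral_cst//= [P _]probability_setT/= mulr1. Qed.

Lemma ExD X Y : bmf X -> bmf Y ->
  \int[P]_w (X w + Y w) = \int[P]_w X w + \int[P]_w Y w.
Proof. by move=> bX bY; rewrite RintegralD//; exact: bmf_integrable. Qed.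

Lemma ExB X Y : bmf X -> bmf Y ->
  \int[P]_w (X w - Y w) = \int[P]_w X w - \int[P]_w Y w.
Proof. by move=> bX bY; rewrite RintegralB//; exact: bmf_integrable. Qed.

Lemma ExZ c X : bmf X -> \int[P]_w (c * X w) = c * \int[P]_w X w.
Proof. by move=> bX; rewrite RintegralZl//; exact: bmf_integrable. Qed.

Lemma Ex_sum (n : nat) (X : nat -> T -> R) : (forall i, (i < n)%N -> bmf (X i)) ->
  \int[P]_w (\sum_(i < n) X i w) = \sum_(i < n) \int[P]_w X i w.
Proof.
elim: n => [_|n IH h].
  by rewrite big_ord0; under eq_Rintegral do rewrite big_ord0; rewrite Ex_cst.
under eq_Rintegral do rewrite big_ord_recr/=.
have h' i : (i < n)%N -> bmf (X i) by move/ltnW; exact: h.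
by rewrite ExD ?big_ord_recr/= ?IH//; [exact: bmf_sum|exact: h].
Qed.

Lemma Ex_le X Y : bmf X -> bmf Y -> (forall w, X w <= Y w) ->
  \int[P]_w X w <= \int[P]_w Y w.
Proof.
by move=> bX bY XY; apply: le_Rintegral => //; exact: bmf_integrable.
Qed.

Lemma Ex_le_cst X c : bmf X -> (forall w, X w <= c) -> \int[P]_w X w <= c.
Proof.
by move=> bX Xc; rewrite -[leRHS]Ex_cst; apply: Ex_le => //; exact: bmf_cst.
Qed.

Lemma Ex_abs X : bmf X -> `|\int[P]_w X w| <= \int[P]_w `|X w|.
Proof. by move=> bX; apply: le_normr_Rintegral => //; exact: bmf_integrable. Qed.

Lemma Ex_indic (A : set T) : measurable A -> \int[P]_w \1_A w = fine (P A).
Proof. by move=> mA; rewrite /Rintegral integral_indic// setIT. Qed.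

Lemma prob_fineK (A : set T) : measurable A -> (fine (P A))%:E = P A.
Proof. by move=> mA; rewrite fineK// fin_num_measure. Qed.

(* The exceptional set is required to be measurable, so that [Q] need not be. *)
Definition mostly (e : R) (Q : T -> Prop) :=
  exists E : set T, [/\ measurable E, (P E <= e%:E)%E & forall w, ~ E w -> Q w].

Lemma mostly_mono (e e' : R) (Q Q' : T -> Prop) : e <= e' -> (forall w, Q w -> Q' w) ->
  mostly e Q -> mostly e' Q'.
Proof.
move=> ee QQ [E [mE PE EQ]]; exists E; split => //.
- by rewrite (le_trans PE)// lee_fin.
- by move=> w /EQ /QQ.
Qed.

Lemma mostlyI (e1 e2 : R) (Q1 Q2 : T -> Prop) : mostly e1 Q1 -> mostly e2 Q2 ->
  mostly (e1 + e2) (fun w => Q1 w /\ Q2 w).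
Proof.
move=> [E [mE PE EQ]] [F [mF PF FQ]]; exists (E `|` F); split.
- exact: measurableU.
- by rewrite (le_trans (measureU2 _ mE mF))// EFinD leeD.
- by move=> w /not_orP[/EQ ? /FQ].
Qed.

Lemma mostly_ae (e : R) (Q : T -> Prop) : 0 <= e -> {ae P, forall w, Q w} -> mostly e Q.
Proof.
move=> e0 [N [mN PN NQ]]; exists N; split => //; first by rewrite PN lee_fin.
by move=> w Nw; apply: contrapT => Qw; apply: Nw; apply: NQ.
Qed.

Lemma mostly_set e (A : set T) (Q : T -> Prop) : measurable A ->
  (P A <= e%:E)%E -> (forall w, ~ A w -> Q w) -> mostly e Q.
Proof. by move=> mA PA AQ; exists A. Qed.

Lemma markov_le X (c : R) : bmf X -> (forall w, 0 <= X w) -> 0 < c ->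
  (P [set w | (c <= X w)%R] <= (c^-1 * \int[P]_w X w)%R%:E)%E.
Proof.
move=> bX X0 c0.
have mA : measurable [set w | c <= X w].
  rewrite -[X in measurable X]setTI.
  rewrite (_ : [set w | c <= X w] = X @^-1` `[c, +oo[); last first.
    by apply/seteqP; split => w /=; rewrite in_itv/= andbT.
  by apply: bX.1.
rewrite -prob_fineK// lee_fin -Ex_indic// -ExZ//.
apply: Ex_le; [exact: bmf_indic|exact: bmfZ|move=> w].
rewrite indicE; case: (asboolP (c <= X w)) => [cX|cX].
  by rewrite mem_set//= ler_pdivlMl// mulr1.
by rewrite memNset//= mulr_ge0// invr_ge0 ltW.
Qed.

Lemma measurable_set_le X Y : measurable_fun setT X -> measurable_fun setT Y ->
  measurable [set w | X w <= Y w].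
Proof.
by move=> mX mY; rewrite -[X in measurable X]setTI; exact: measurable_fun_le.
Qed.

Lemma measurable_set_lt X Y : measurable_fun setT X -> measurable_fun setT Y ->
  measurable [set w | X w < Y w].
Proof.
move=> mX mY; rewrite (_ : mkset _ = ~` [set w | Y w <= X w]).
  by apply: measurableC; exact: measurable_set_le.
by apply/seteqP; split => w /=; rewrite ltNge => /negP.
Qed.

Lemma mostly_markov X (c e : R) : bmf X -> 0 < c -> \int[P]_w `|X w| <= c * e ->
  mostly e (fun w => `|X w| < c).
Proof.
move=> bX c0 Xe; exists [set w | c <= `|X w|]; split.
- by apply: measurable_set_le => //; exact: (bmf_norm bX).1.
- rewrite (le_trans (markov_le (bmf_norm bX) _ c0))// lee_fin.
  by rewrite ler_pdivrMl.
- by move=> w /= /negP; rewrite -ltNge.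
Qed.

Lemma mostly_Ex X (M c e : R) : bmf X -> (forall w, `|X w| <= M) -> 0 <= c ->
  mostly e (fun w => `|X w| <= c) -> \int[P]_w `|X w| <= c + M * e.
Proof.
move=> bX XM c0 [E [mE PE EQ]].
have M0 : 0 <= M by rewrite (le_trans _ (XM point)).
apply: (@le_trans _ _ (\int[P]_w (c + M * \1_E w))).
  apply: Ex_le; first exact: bmf_norm.
    by apply: bmfD; [exact: bmf_cst|apply: bmfZ; exact: bmf_indic].
  move=> w; rewrite indicE; case: (asboolP (E w)) => Ew.
    by rewrite mem_set// mulr1 (le_trans (XM w))// lerDr.
  by rewrite memNset// mulr0 addr0 EQ.
rewrite ExD ?Ex_cst ?ExZ; first last.
- by apply: bmfZ; exact: bmf_indic.
- exact: bmf_cst.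
- exact: bmf_indic.
by rewrite lerD2l ler_wpM2l// Ex_indic// -lee_fin prob_fineK.
Qed.

(** The sets where some [G n] with [n >= k] fails decrease in [k], and up to the null set [N] their
    intersection is empty. Continuity of [P] from above makes them small. This turns almost sure
    pathwise statements into bounds at one fixed [n]. *)
Lemma ev_mostly (G : nat -> set T) e : 0 < e -> (forall n, measurable (G n)) ->
  {ae P, forall w, \forall n \near \oo, G n w} ->
  \forall n \near \oo, mostly e (G n).
Proof.
move=> e0 mG [N [mN PN NG]].
pose B k := N `|` \bigcup_(n in [set n | (k <= n)%N]) ~` G n.
have mU k : measurable (\bigcup_(n in [set n | (k <= n)%N]) ~` G n).
  by apply: bigcup_measurable => n _; exact: measurableC.
have mB k : measurable (B k) by exact: measurableU.
have B0 : \bigcap_k B k `<=` N.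
  move=> w Bw; apply: contrapT => Nw.
  have [k _ kG] : \forall n \near \oo, G n w.
    by apply: contrapT => h; apply: Nw; exact: NG.
  by have [//|[n /= kn]] := Bw k Logic.I; apply; exact: kG.
have PB : (P \o B) x @[x --> \oo] --> P (\bigcap_k B k).
  apply: nonincreasing_cvg_mu => //.
  - by rewrite ltey_eq fin_num_measure.
  - exact: bigcapT_measurable.
  - move=> m n mn; apply/subsetPset => w [Nw|[k /= nk Gk]]; first by left.
    by right; exists k => //=; exact: leq_trans nk.
have {}PB : (P \o B) x @[x --> \oo] --> 0%E.
  suff -> : 0%E = P (\bigcap_k B k) by [].
  by apply/esym/(subset_measure0 _ mN B0 PN); exact: bigcapT_measurable.
have /fine_cvgP[_ /cvgrPdist_lt /(_ _ e0) [k _ kB]] := PB.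
exists k => // n /= kn; exists (B n); split => //; last first.
  move=> w /not_orP[_ h]; apply: contrapT => Gn; apply: h.
  by exists n => /=.
have := kB n kn; rewrite /= sub0r normrN => /ltW.
rewrite ger0_norm ?fine_ge0// -lee_fin fineK//.
exact: fin_num_measure.
Qed.

Lemma mostly_eq X Y : measurable_fun setT X -> measurable_fun setT Y ->
  (forall c e, 0 < c -> 0 < e -> mostly e (fun w => `|X w - Y w| <= c)) ->
  {ae P, forall w, X w = Y w}.
Proof.
move=> mX mY XY.
have H n : {ae P, forall w, `|X w - Y w| <= n.+1%:R^-1}.
  pose A := [set w | n.+1%:R^-1 < `|X w - Y w|].
  have mA : measurable A.
    apply: measurable_set_lt => //; apply: measurableT_comp => //.
    exact: measurable_funB.
  exists A; split => //; last by move=> w /= /negP; rewrite -ltNge.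
  apply/eqP; rewrite eq_le measure_ge0 andbT; apply/lee_addgt0Pr => e e0.
  have [||E [mE PE EQ]] := XY n.+1%:R^-1 e => //.
  rewrite add0e (le_trans _ PE)// le_measure ?inE// => w; rewrite /A/= => h.
  by apply: contrapT => /EQ; rewrite leNgt h.
have : {ae P, forall w, forall n, `|X w - Y w| <= n.+1%:R^-1}.
  by apply/ae_foralln.
apply: filterS => w h; apply/eqP; rewrite -subr_eq0 -normr_le0.
apply/ler_addgt0Pr => e e0; rewrite add0r.
have [n ne] : exists n : nat, n.+1%:R^-1 < e.
  exists (Num.truncn e^-1); rewrite invf_plt ?posrE//.
  by rewrite truncnS_gt.
exact: le_trans (h n) (ltW ne).
Qed.

End expectation.

(** * Characteristic function of the normal law *)

Lemma Rintegral_cvg {R : realType} {d} {T : measurableType d}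
    (mu : {measure set T -> \bar R}) (f_ : nat -> T -> R) (f g : T -> R) :
  (forall n, measurable_fun setT (f_ n)) -> measurable_fun setT f ->
  mu.-integrable setT (EFin \o g) -> (forall n x, `|f_ n x| <= g x) ->
  (forall x, f_ n x @[n --> \oo] --> f x) ->
  \int[mu]_x f_ n x @[n --> \oo] --> \int[mu]_x f x.
Proof.
move=> mf_ mf ig fg ff.
have [||||fi _ h] := @dominated_convergence _ _ _ mu setT measurableT
    (fun n => EFin \o f_ n) (EFin \o f) (EFin \o g) _ _ _ ig.
- by move=> n; exact/measurable_EFinP.
- exact/measurable_EFinP.
- by apply: aeW => x _; apply: cvg_EFin; [exact: nearW|exact: ff].
- by apply: aeW => x n _; rewrite lee_fin.
by apply: fine_cvg; rewrite fineK//; exact: integrable_fin_num.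
Qed.

Section normal_char.
Context {R : realType}.
Local Notation mu := (@lebesgue_measure R).

(** The change of variables produces the Radon-Nikodym derivative, which agrees almost everywhere
    with [normal_pdf] because both have the same integral over every measurable set. *)
Lemma Rintegral_normal_prob (m s : R) (f : R -> R) : bmf f ->
  \int[normal_prob m s]_x f x = \int[mu]_x (f x * normal_pdf m s x).
Proof.
move=> bf; congr fine.
rewrite -(Radon_Nikodym_change_of_variables (normal_prob_dominates m s))//=; last first.
  exact: bmf_integrable.
apply: ae_eq_integral => //.
- apply: emeasurable_funM; first by apply/measurable_EFinP; exact: bf.1.
  apply: (measurable_int mu).
  by apply: Radon_Nikodym_integrable; exact: normal_prob_dominates.
- apply/measurable_EFinP/measurable_funM; first exact: bf.1.
  exact: measurable_normal_pdf.
- rewrite (_ : (fun x => (f x * normal_pdf m s x)%:E) =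
      (fun x => (f x)%:E * (normal_pdf m s x)%:E)%E)//.
  apply: ae_eqe_mul2l.
  apply: integral_ae_eq => //.
  + by apply: Radon_Nikodym_integrable; exact: normal_prob_dominates.
  + by apply/measurable_EFinP; exact: measurable_normal_pdf.
  + by move=> A AT mA; rewrite -Radon_Nikodym_integral//; exact: normal_prob_dominates.
Qed.

Variable s : R.
Hypothesis s0 : s != 0.
Let q := normal_pdf 0 s.

Let q0 x : 0 <= q x. Proof. exact: normal_pdf_ge0. Qed.

Let mq : measurable_fun setT q. Proof. exact: measurable_normal_pdf. Qed.

Let qE x : q x = normal_peak s * expR (- x ^+ 2 / (s ^+ 2 *+ 2)).
Proof. by rewrite /q normal_pdfE// /normal_fun subr0. Qed.

Let s2 : 0 < s ^+ 2. Proof. by rewrite exprn_even_gt0. Qed.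

Let q_integrable (f : R -> R) : bmf f ->
  mu.-integrable setT (fun x => (f x * q x)%:E).
Proof.
move=> [mf [M fM]].
apply: (@le_integrable _ _ _ mu setT _ _ (fun x => M%:E * (q x)%:E)%E) => //.
- by apply/measurable_EFinP/measurable_funM.
- move=> x _; rewrite -EFinM lee_fin !normrM ler_wpM2r//.
  by rewrite (le_trans (fM x))// ler_norm.
- by apply: integrableZl => //; exact: integrable_normal_pdf.
Qed.

Let xq_integrable (f : R -> R) : bmf f ->
  mu.-integrable setT (fun x => (x * f x * q x)%:E).
Proof.
move=> [mf [M fM]].
(* Doubling the variance leaves a factor exp (- t) with t = x^2 / (4 s^2). It absorbs |x|, since |x|
   <= 1 + x^2 <= (1 + 4 s^2) (1 + t) and 1 + t <= exp t. *)
pose s' := Num.sqrt 2 * s.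
have s's : s' ^+ 2 = s ^+ 2 *+ 2 by rewrite /s' exprMn sqr_sqrtr// mulr_natl.
have s'0 : s' != 0 by rewrite mulf_neq0// gt_eqF// sqrtr_gt0.
pose C := (1 + s ^+ 2 *+ 4) * M * (normal_peak s / normal_peak s').
have M0 : 0 <= M by rewrite (le_trans _ (fM 0)).
apply: (@le_integrable _ _ _ mu setT _ _ (fun x => C%:E * (normal_pdf 0 s' x)%:E)%E) => //.
- apply/measurable_EFinP/measurable_funM => //.
  by apply: measurable_funM.
- move=> x _; rewrite -EFinM lee_fin.
  rewrite [leRHS]ger0_norm; last first.
    rewrite mulr_ge0 ?normal_pdf_ge0// /C !mulr_ge0//.
    - by rewrite addr_ge0// mulrn_wge0// ltW.
    - exact: normal_peak_ge0.
    - by rewrite invr_ge0 normal_peak_ge0.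
  rewrite !normrM (ger0_norm (q0 x)) qE normal_pdfE// /normal_fun subr0 s's.
  rewrite /C !mulrA.
  have p0 : normal_peak s' != 0 by rewrite gt_eqF// normal_peak_gt0.
  rewrite [leRHS](_ : _ = ((1 + s ^+ 2 *+ 4) * expR (- x ^+ 2 / (s ^+ 2 *+ 2 *+ 2))) * M * normal_peak s); last by field.
  rewrite [leLHS](_ : _ = `|x| * expR (- x ^+ 2 / (s ^+ 2 *+ 2)) * `|f x| * normal_peak s); last by ring.
  apply: ler_wpM2r; first exact: normal_peak_ge0.
  apply: ler_pM => //.
  set t := x ^+ 2 / (s ^+ 2 *+ 2 *+ 2).
  have -> : - x ^+ 2 / (s ^+ 2 *+ 2) = - t - t.
    by rewrite /t; field.
  have -> : - x ^+ 2 / (s ^+ 2 *+ 2 *+ 2) = - t by rewrite /t mulNr.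
  rewrite expRD mulrA ler_wpM2r ?expR_ge0//.
  have t0 : 0 <= t by rewrite /t divr_ge0 ?sqr_ge0// !mulrn_wge0// ltW.
  rewrite -ler_pdivlMr ?expR_gt0// -expRN opprK.
  apply: (@le_trans _ _ ((1 + s ^+ 2 *+ 4) * (1 + t))); last first.
    by rewrite ler_wpM2l ?expR_ge1Dx// addr_ge0// mulrn_wge0// ltW.
  have -> : (1 + s ^+ 2 *+ 4) * (1 + t) = 1 + t + s ^+ 2 *+ 4 + x ^+ 2.
    by rewrite /t; field.
  have : `|x| <= 1 + x ^+ 2.
    rewrite -(real_normK (num_real x)); have := normr_ge0 x.
    by set y := `|x|; nra.
  by move: s2; rewrite -mulr_natl; lra.
- by apply: integrableZl => //; exact: integrable_normal_pdf.
Qed.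

Variable a : R.
Let g (u : R) := \int[mu]_x (cos (u * x + a) * q x).

Let bcos u : bmf (fun x : R => cos (u * x + a)).
Proof.
by apply: bmf_cos; apply: measurable_funD => //; exact: measurable_funM.
Qed.

Let bsin u : bmf (fun x : R => sin (u * x + a)).
Proof.
by apply: bmf_sin; apply: measurable_funD => //; exact: measurable_funM.
Qed.

Let derf (u x : R) : is_derive (u : R) 1 (fun u : R => cos (u * x + a) * q x) (- (x * sin (u * x + a) * q x)).
Proof.
apply: is_derive_eq.
rewrite /GRing.scale /=.
ring.
Qed.

Let derg (u : R) : is_derive u 1 g (\int[mu]_x (- (x * sin (u * x + a) * q x))).
Proof.
have d1 u' x : partial1of2 (fun u x => cos (u * x + a) * q x) u' x =
    - (x * sin (u' * x + a) * q x).
  by rewrite partial1of2E; exact: (derive_val (is_derive := derf u' x)).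
have h : u \in `](u - 1), (u + 1)[ by rewrite in_itv/= ltrBlDr ltrDl ltr01.
have H1 : forall x, `](u - 1), (u + 1)[%classic x ->
    mu.-integrable setT (EFin \o (fun y => cos (x * y + a) * q y)).
  by move=> x _; exact: q_integrable.
have H2 : forall x y, `](u - 1), (u + 1)[%classic x -> [set: R] y ->
    derivable (fun x : R => cos (x * y + a) * q y) (x : R) 1.
  by move=> x y _ _; exact: (ex_derive (is_derive := derf x y)).
have bid : bmf (fun _ : R => 1 : R) by exact: bmf_cst.
have H3 : forall y : R, 0 <= `|y| * q y by move=> y; rewrite mulr_ge0.
have H4 : mu.-integrable setT (EFin \o (fun y => `|y| * q y)).
  have := integrable_abse (xq_integrable bid).
  apply: eq_integrable => // x _ /=.
  by rewrite mulr1 normrM (ger0_norm (q0 x)).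
have H5 : forall x y, `](u - 1), (u + 1)[%classic x -> [set: R] y ->
    `|partial1of2 (fun u x => cos (u * x + a) * q x) x y| <= `|y| * q y.
  move=> x y _ _; rewrite d1 normrN !normrM (ger0_norm (q0 y)) ler_wpM2r//.
  by rewrite ler_piMr// sin_max.
apply: DeriveDef.
  exact: (derivable_under_integral measurableT h H1 H2 H3 H4 H5).
rewrite -derive1E (differentiation_under_integral measurableT h H1 H2 H3 H4 H5).
by apply: eq_Rintegral => x _; rewrite d1.
Qed.

Let dern (u x : R) : is_derive (x : R) 1 (fun x : R => sin (u * x + a) * q x)
  (u * (cos (u * x + a) * q x) - (s ^+ 2)^-1 * (x * sin (u * x + a) * q x)).
Proof.
under eq_fun do rewrite qE.
apply: is_derive_eq.
rewrite /GRing.scale /= qE.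
by field.
Qed.

(** Integration by parts: the difference of the two integrands is the derivative of sin (u x + a) q
    (x), whose integral over [- (n + 1), n + 1] reduces to boundary terms that vanish in the
    limit. *)
Let ibp u : u * \int[mu]_x (cos (u * x + a) * q x) =
  (s ^+ 2)^-1 * \int[mu]_x (x * sin (u * x + a) * q x).
Proof.
pose h x := u * (cos (u * x + a) * q x) - (s ^+ 2)^-1 * (x * sin (u * x + a) * q x).
have ih : mu.-integrable setT (EFin \o h).
  have := integrableB measurableT (integrableZl measurableT u (q_integrable (bcos u)))
    (integrableZl measurableT (s ^+ 2)^-1 (xq_integrable (bsin u))).
  by apply: eq_integrable => // x _ /=; rewrite -!EFinM -EFinB.
suff : \int[mu]_x h x = 0.
  rewrite /h RintegralB//=; first last.
  - have := integrableZl measurableT (s ^+ 2)^-1 (xq_integrable (bsin u)).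
    by apply: eq_integrable => // x _ /=.
  - have := integrableZl measurableT u (q_integrable (bcos u)).
    by apply: eq_integrable => // x _ /=.
  rewrite RintegralZl//; last exact: q_integrable.
  rewrite RintegralZl//; last exact: xq_integrable.
  by move/eqP; rewrite subr_eq0 => /eqP.
pose F x := sin (u * x + a) * q x.
have ch : continuous h.
  move=> x; rewrite /h; apply: differentiable_continuous.
  apply/derivable1_diffP; under eq_fun do rewrite qE; exact: ex_derive.
have cF : continuous F.
  move=> x; apply: differentiable_continuous; apply/derivable1_diffP.
  exact: (ex_derive (is_derive := dern u x)).
have Fn (n : nat) : \int[mu]_(x in `[- n.+1%:R, n.+1%:R]) h x = F n.+1%:R - F (- n.+1%:R).
  rewrite /Rintegral (@continuous_FTC2 _ h F)//.
  - by rewrite ltrNl -subr_gt0 opprK addr_gt0.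
  - exact: continuous_subspaceT.
  - split.
    + by move=> x _; exact: (ex_derive (is_derive := dern u x)).
    + by apply: cvg_at_right_filter; exact: cF.
    + by apply: cvg_at_left_filter; exact: cF.
  - by move=> x _; rewrite derive1E; exact: (derive_val (is_derive := dern u x)).
have : \int[mu]_(x in `[- n.+1%:R, n.+1%:R]) h x @[n --> \oo] --> \int[mu]_x h x.
  under eq_fun do rewrite Rintegral_mkcond.
  have mh : measurable_fun setT h by exact: continuous_measurable_fun.
  apply: (@Rintegral_cvg _ _ _ mu (fun n => h \_ `[- n.+1%:R, n.+1%:R]) h (fun x => `|h x|)) => //.
  - by move=> n; apply/(measurable_restrict _ _ _) => //; exact: measurable_funTS.
  - exact: integrable_abse ih.
  - by move=> n x; rewrite patchE; case: ifP => // _; rewrite normr0.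
  - move=> x; apply: cvg_near_cst; exists (Num.truncn `|x|) => // n /= xn.
    rewrite patchE mem_set//= in_itv/= -ler_norml.
    by rewrite ltW// (lt_le_trans (truncnS_gt _))// ler_nat ltnS.
under eq_fun do rewrite Fn.
move=> /cvg_lim <-//.
apply: cvg_lim => //.
(* A decay of order 1 / n at the boundary is enough, and exp z >= 1 + z already provides it. *)
have qn (n : nat) (x : R) : x ^+ 2 = n.+1%:R ^+ 2 -> q x <= normal_peak s * (s ^+ 2 *+ 2) * n.+1%:R^-1.
  move=> xn; rewrite qE xn -mulrA ler_wpM2l ?normal_peak_ge0//.
  rewrite mulNr expRN -[leRHS]invrK lef_pV2 ?posrE ?expR_gt0//; last first.
    by rewrite invr_gt0 mulr_gt0// pmulrn_lgt0.
  apply: le_trans (expR_ge1Dx _).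
  rewrite invfM invrK mulrC (@le_trans _ _ (n.+1%:R ^+ 2 / (s ^+ 2 *+ 2)))//; last first.
    by rewrite lerDr.
  rewrite ler_wpM2r ?invr_ge0 ?mulrn_wge0 ?(ltW s2)//.
  by rewrite ler_eXnr// ler1n.
have FN (n : nat) : `|F n.+1%:R - F (- n.+1%:R)| <= normal_peak s * (s ^+ 2 *+ 2) * n.+1%:R^-1 *+ 2.
  rewrite (le_trans (ler_normB _ _))// mulr2n lerD// /F normrM (ger0_norm (q0 _)).
    by rewrite (le_trans (ler_piMl _ (sin_max _)))// qn.
  by rewrite (le_trans (ler_piMl _ (sin_max _)))// qn// sqrrN.
apply/norm_cvg0P.
apply: (@squeeze_cvgr _ _ _ _ (fun=> 0) (fun n => normal_peak s * (s ^+ 2 *+ 2) * n.+1%:R^-1 *+ 2)).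
- by apply: nearW => n; rewrite normr_ge0 FN.
- exact: cvg_cst.
- under eq_fun do rewrite -mulr_natr -mulrA [_^-1 * _]mulrC mulrA.
  have := @cvgMl_tmp _ _ _ _ _ (normal_peak s * (s ^+ 2 *+ 2) * 2%:R) _ (@cvg_harmonic R).
  by rewrite mulr0; apply.
Qed.

Let derg' (u : R) : is_derive u 1 g (- (s ^+ 2 * u * g u)).
Proof.
apply: (is_derive_eq (derg u)).
have -> : s ^+ 2 * u * g u = \int[mu]_x (x * sin (u * x + a) * q x).
  by rewrite -mulrA ibp mulrA mulfV ?mul1r// gt_eqF.
under eq_Rintegral do rewrite -mulN1r.
by rewrite RintegralZl ?mulN1r//; exact: xq_integrable.
Qed.

(** Differentiation under the integral and [ibp] give the equation g' (u) = - s^2 u g (u), so g (u)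
    exp (s^2 u^2 / 2) is constant and equals its value cos a at 0. The phase [a] makes real
    integrals sufficient. *)
Lemma normal_char u :
  \int[normal_prob 0 s]_x cos (u * x + a) = cos a * expR (- (s ^+ 2 * u ^+ 2 / 2)).
Proof.
rewrite Rintegral_normal_prob// -/(g u).
pose h u := g u * expR (s ^+ 2 * u ^+ 2 / 2).
have dh v : is_derive (v : R) 1 h 0.
  by have dg := derg' v; rewrite /h; apply: is_derive_eq; rewrite /GRing.scale/=; field.
have := is_derive_0_is_cst u 0 dh.
rewrite /h expr0n/= mulr0 mul0r expR0 mulr1.
have -> : g 0 = cos a.
  rewrite /g; under eq_Rintegral do rewrite mul0r add0r.
  rewrite RintegralZl//; last exact: integrable_normal_pdf.
  by rewrite /Rintegral integral_normal_pdf mulr1.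
by move=> <-; rewrite expRN mulfK// gt_eqF ?expR_gt0.
Qed.

End normal_char.

(** * Conditioning on the past of the Brownian motion *)

Section adapted.
Context {R : realType} {d : measure_display} {T : measurableType d}.
Implicit Types (G : set (set T)) (X Y : T -> R).

(** Measurability is taken on the type carrying the sigma-algebra generated by [G], so that the
    general lemmas on sums, products and compositions of measurable functions apply to adapted
    variables as they stand. *)
Definition adapted G X := measurable_fun setT (X : g_sigma_algebraType G -> R).

Lemma adapted_preimage G X (B : set R) : adapted G X -> measurable B ->
  <<s G >> (X @^-1` B).
Proof. by move=> aX mB; have := aX measurableT _ mB; rewrite setTI. Qed.

Lemma adapted_sub G H X : <<s G >> `<=` <<s H >> -> adapted G X -> adapted H X.
Proof. by move=> GH aX _ B mB; apply: GH; exact: aX. Qed.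

Lemma adapted_measurable G X : <<s G >> `<=` measurable -> adapted G X ->
  measurable_fun setT X.
Proof. by move=> GT aX _ B mB; apply: GT; exact: aX. Qed.

Lemma adapted_pair G X Y (C : set (R * R)) : adapted G X -> adapted G Y ->
  measurable C -> <<s G >> ((fun w => (X w, Y w)) @^-1` C).
Proof.
move=> aX aY mC.
have : measurable_fun setT ((fun w => (X w, Y w)) : g_sigma_algebraType G -> R * R).
  exact: measurable_fun_pair.
by move=> /(_ measurableT _ mC); rewrite setTI.
Qed.

End adapted.

Section freezing.
Context {R : realType} {d : measure_display} {T : measurableType d}.
Variables (P : probability T R) (G : set (set T)).
Hypothesis GT : <<s G >> `<=` measurable.
Context {d' : measure_display} {S : measurableType d'}.
Variables (D : T -> S) (nu : probability S R).
Hypothesis mD : measurable_fun setT D.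
Hypothesis indep : forall (C : set S) (E : set T), measurable C -> <<s G >> E ->
  P (D @^-1` C `&` E) = (nu C * P E)%E.

(** This replaces conditional expectation given [G]: variables known from the past are held fixed
    while the independent [D] is integrated out. By independence the law of the pair is a product
    measure, and Fubini's theorem concludes. *)
Lemma freezing (X Y : T -> R) (f : (R * R) * S -> R) :
  adapted G X -> adapted G Y -> bmf f ->
  \int[P]_w f ((X w, Y w), D w) = \int[P]_w \int[nu]_y f ((X w, Y w), y).
Proof.
move=> aX aY bf.
have mX := adapted_measurable GT aX.
have mY := adapted_measurable GT aY.
pose U w := (X w, Y w).
have mU : measurable_fun setT U by exact: measurable_fun_pair.
pose Z w := (U w, D w).
have mZ : measurable_fun setT Z by exact: measurable_fun_pair.
pose m1 : probability (R * R)%type R := distribution P (mfun_Sub (mem_set mU)).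
pose m' : probability _ R := distribution P (mfun_Sub (mem_set mZ)).
(* The two measures agree on rectangles by [indep], hence everywhere by uniqueness of the product
   measure. *)
have prodE A : measurable A -> (m1 \x nu)%E A = m' A.
  apply: product_measure_unique => {}A B mA mB.
  rewrite -[LHS]/(P (Z @^-1` (A `*` B))) -[X in (X * _)%E]/(P (U @^-1` A)).
  rewrite muleC -indep//; last exact: adapted_pair.
  by congr (P _); apply/seteqP; split => w [].
have if_ : (m1 \x nu)%E.-integrable setT (EFin \o f).
  have /integrableP[mf fy] := bmf_integrable m' bf.
  apply/integrableP; split => //.
  by rewrite (eq_measure_integral m')// => A mA _; exact: prodE.
congr fine.
have -> : (\int[P]_w (f ((X w, Y w), D w))%:E = \int[m']_z (f z)%:E)%E.
  rewrite [RHS]integral_pushforward//=.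
  - by apply/measurable_EFinP; exact: bf.1.
  - apply: bmf_integrable; case: bf => mf [M fM]; split; last by exists M => w; exact: fM.
    exact: measurableT_comp.
transitivity (\int[m1 \x nu]_z (f z)%:E)%E.
  by apply: eq_measure_integral => A mA _; apply/esym/prodE.
have bfx x : bmf (fun y => f (x, y)).
  case: bf => mf [M fM]; split; last by exists M => y; exact: fM.
  by apply: measurableT_comp => //; exact: measurable_pair1.
pose F x := \int[nu]_y f (x, y).
have FE : fubini_F nu (EFin \o f) = EFin \o F.
  by apply/funext => x; rewrite /fubini_F/= /F fineK//; apply: integrable_fin_num => //; exact: bmf_integrable.
have bF : bmf F.
  split.
    by apply/measurable_EFinP; rewrite -FE; apply: (measurable_int m1); exact: integrable_fubini_F.
  case: bf => mf [M fM]; exists M => x; rewrite (le_trans (Ex_abs _ _))//.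
  by apply: Ex_le_cst => //; exact: bmf_norm.
rewrite -integral12_prod_meas1// FE [LHS]integral_pushforward//=.
- by apply/measurable_EFinP; exact: bF.1.
- apply: bmf_integrable; case: bF => mF [M FM]; split; last by exists M => w; exact: FM.
  exact: measurableT_comp.
Qed.

End freezing.

Section gaussian_freezing.
Context {R : realType} {d : measure_display} {T : measurableType d}.
Variables (P : probability T R) (G : set (set T)).
Hypothesis GT : <<s G >> `<=` measurable.
Variables (D : T -> R) (s : R).
Hypothesis s0 : 0 < s.
Hypothesis mD : measurable_fun setT D.
Hypothesis indep : forall (C : set R) (E : set T), measurable C -> <<s G >> E ->
  P (D @^-1` C `&` E) = (normal_prob 0 (Num.sqrt s) C * P E)%E.

(* [freezing] needs a bounded function, hence the truncation of [B]. *)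
Lemma gaussian_freezing (B H : T -> R) (a : R) :
  adapted G B -> adapted G H -> (exists M : R, forall w, `|B w| <= M) ->
  \int[P]_w (B w * cos (H w * D w + a)) =
  cos a * \int[P]_w (B w * expR (- (s * H w ^+ 2 / 2))).
Proof.
move=> aB aH [M BM].
have sq0 : Num.sqrt s != 0 by rewrite gt_eqF// sqrtr_gt0.
pose t (b : R) := Num.max (- M) (Num.min M b).
have tB w : t (B w) = B w.
  have := BM w; rewrite ler_norml /t => /andP[BN BP].
  by rewrite min_r// max_r.
have M0 : 0 <= M by rewrite (le_trans _ (BM point)).
have tM b : `|t b| <= M.
  by rewrite ler_norml /t le_max lexx/= ge_max ge_min lexx/= andbT lerNl (le_trans _ M0)// oppr_le0.
pose f (z : (R * R) * R) := t z.1.1 * cos (z.1.2 * z.2 + a).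
have bf : bmf f.
  apply: bmfM.
    split; last by exists M => z; exact: tM.
    apply: measurable_maxr => //; apply: measurable_minr => //.
    by apply: measurableT_comp => //.
  apply: bmf_cos; apply: measurable_funD => //; apply: measurable_funM => //.
  by apply: measurableT_comp => //.
have fE w y : f ((B w, H w), y) = B w * cos (H w * y + a) by rewrite /f/= tB.
move: f bf fE => f bf fE.
pose nu : probability (measurableTypeR R) R := normal_prob 0 (Num.sqrt s).
have := @freezing R d T P G GT _ (measurableTypeR R) D nu mD indep B H f aB aH bf.
under eq_Rintegral do rewrite fE.
move=> ->.
have bB : bmf B by split; [exact: adapted_measurable aB|exists M].
rewrite -ExZ; last first.
  apply: bmfM => //; split.
    apply: measurableT_comp => //; apply: measurableT_comp => //.
    apply: measurable_funM => //; apply: measurable_funM => //.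
    by apply: measurable_funX; exact: adapted_measurable aH.
  exists 1 => w; rewrite ger0_norm ?expR_ge0// -expR0 ler_expR oppr_le0.
  by rewrite divr_ge0// mulr_ge0 ?sqr_ge0// ltW.
apply: eq_Rintegral => w _; under eq_Rintegral do rewrite fE.
rewrite ExZ; last first.
  by apply: bmf_cos; apply: measurable_funD => //; exact: measurable_funM.
by rewrite normal_char// sqr_sqrtr ?ltW// mulrCA.
Qed.

End gaussian_freezing.

Section product_rule.
Context {R : realType} {d : measure_display} {T : measurableType d}.
Variable P : probability T R.

(** Dynkin's argument: the measurable sets independent of [A] form a lambda-system, and [G] is
    closed under intersections. *)
Lemma product_rule_sigma (A : set T) (G : set (set T)) :
  measurable A -> G `<=` measurable -> setI_closed G ->
  (forall B, G B -> P (A `&` B) = (P A * P B)%E) ->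
  forall B, <<s G >> B -> measurable B /\ P (A `&` B) = (P A * P B)%E.
Proof.
move=> mA GT GI AG.
pose H := [set B | measurable B /\ P (A `&` B) = (P A * P B)%E].
suff : <<s G >> `<=` H by move=> + B GB => /(_ B GB).
apply: lambda_system_subset => //; last first.
  by move=> B GB; split; [exact: GT|exact: AG].
split=> //.
- by split; rewrite ?setIT ?[P setT]probability_setT ?mule1.
- move=> B C CB [mB AB] [mC AC]; split; first exact: measurableD.
  have -> : A `&` (B `\` C) = (A `&` B) `\` (A `&` C).
    by apply/seteqP; split => [x [Ax [Bx Cx]]|x [[Ax Bx] Cx]]; split => //;
      [case|split => // Cx'; exact: Cx].
  rewrite measureD//; [|exact: measurableI..|by rewrite ltey_eq fin_num_measure//; exact: measurableI].
  rewrite measureD//; last by rewrite ltey_eq fin_num_measure.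
  rewrite -setIIr !(setIidr CB) [X in (X - _)%E]AB [X in (_ - X)%E]AC.
  rewrite [RHS]muleBr ?fin_num_measure//.
  by apply: fin_num_adde_defr; rewrite fin_num_measure.
- move=> F ndF HF.
  have mF n : measurable (F n) by have [] := HF n.
  have mU : measurable (\bigcup_n F n) by exact: bigcup_measurable.
  split => //; rewrite setI_bigcupr.
  have h1 : (P \o (fun n => A `&` F n)) x @[x --> \oo] --> P (\bigcup_n (A `&` F n)).
    apply: nondecreasing_cvg_mu => //; first by move=> n; exact: measurableI.
      by apply: bigcup_measurable => n _; exact: measurableI.
    by move=> m n mn; have /subsetPset h := ndF _ _ mn; apply/subsetPset; exact: setIS.
  have h2 : (P \o F) x @[x --> \oo] --> P (\bigcup_n F n).
    by apply: nondecreasing_cvg_mu.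
  have h3 : (P \o (fun n => A `&` F n)) x @[x --> \oo] --> (P A * P (\bigcup_n F n))%E.
    rewrite (_ : P \o _ = fun n => P A * P (F n))%E.
      by apply: cvgeZl => //; rewrite fin_num_measure.
    by apply/funext => n /=; have [_ ->] := HF n.
  exact: (cvg_unique _ h1 h3).
Qed.

End product_rule.

Section history.
Context {R : realType} {d : measure_display} {T : measurableType d}.
Variables (P : probability T R) (W : R -> T -> R) (X0 : T -> R).
Hypothesis bmW : brownian_motion P W.
Hypothesis mX0 : measurable_fun setT X0.
Hypothesis iX0 : indep_rv_sigma P X0 (sigma_gen W `[0, +oo[).

Let GX := preimage_set_system setT X0 measurable.
Let GW s := \bigcup_(t in `[0, s]) preimage_set_system setT (W t) measurable.

Definition history (s : R) : set (set T) := GX `|` GW s.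

Let mW t : 0 <= t -> measurable_fun setT (W t).
Proof. by case: bmW => + _ _ _ _; apply. Qed.

Lemma history_measurable s : <<s history s >> `<=` measurable.
Proof.
apply: smallest_sub; first exact: sigma_algebra_measurable.
move=> A [[B mB <-]|[t /=]]; first exact: mX0.
by rewrite in_itv/= => /andP[t0 _] [B mB <-]; exact: mW.
Qed.

Lemma history_mono s t : s <= t -> <<s history s >> `<=` <<s history t >>.
Proof.
move=> st; apply: sub_sigma_algebra2 => A [GA|[u /=]]; first by left.
rewrite in_itv/= => /andP[u0 us] WA; right; exists u => //=.
by rewrite in_itv/= u0 (le_trans us st).
Qed.

Lemma adapted_init s : adapted (history s) X0.
Proof. by move=> _ B mB; apply: sub_sigma_algebra; left; exists B. Qed.

Lemma adapted_brownian s t : 0 <= t <= s -> adapted (history s) (W t).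
Proof.
move=> ts _ B mB; apply: sub_sigma_algebra; right; exists t => //.
by exists B.
Qed.

(** The model gives two separate facts: theta_0 is independent of all of [W], and an increment is
    independent of the past of [W]. Together they make the increment independent of the joint past,
    first on intersections of an event of [X0] with an event of the past of [W], then by
    [product_rule_sigma]. *)
Lemma history_indep s t (C : set R) (E : set T) : 0 <= s -> s < t ->
  measurable C -> <<s history s >> E ->
  P ((W t \- W s) @^-1` C `&` E) = (normal_prob 0 (Num.sqrt (t - s)) C * P E)%E.
Proof.
move=> s0 st mC HE.
have t0 : 0 <= t by rewrite (le_trans s0)// ltW.
case: bmW => _ _ _ Wn Wi.
set A := _ @^-1` C.
have mA : measurable A.
  by rewrite -[A]setTI; apply: measurable_funB => //; exact: mW.
have gGW : <<s GW s >> `<=` measurable.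
  move=> B GB; apply: (@history_measurable s); apply: sub_sigma_algebra2 GB.
  by move=> D; right.
pose G := [set D | exists B, exists2 E, GX B /\ <<s GW s >> E & D = B `&` E].
have GXT : GX `<=` measurable by move=> _ [B mB <-]; exact: mX0.
have AS E' : <<s GW s >> E' -> sigma_gen W `[0, +oo[ (A `&` E').
  move=> GE'.
  pose GG := \bigcup_(t in `[0, +oo[) preimage_set_system setT (W t) (@measurable _ R).
  have ad u : 0 <= u -> adapted GG (W u).
    move=> u0 _ B mB; apply: sub_sigma_algebra; exists u; last by exists B.
    by rewrite /= in_itv/= u0.
  apply: (@measurableI _ (g_sigma_algebraType GG)).
    apply: adapted_preimage => //.
    by apply: measurable_funB; exact: ad.
  apply: sub_sigma_algebra2 GE' => B [u /= us WB]; exists u => //=.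
  by move: us; rewrite !in_itv/= => /andP[-> _].
(* The event of [X0] is split off from [A] and [E'] together, then [A] from [E'], and finally the
   event of [X0] is joined to [E'] again. *)
have key B E' : GX B -> <<s GW s >> E' -> P (A `&` (B `&` E')) = (P A * P (B `&` E'))%E.
  move=> GB GE'; have mE' := gGW _ GE'; case: (GB) => B' mB'; rewrite setTI => BB'.
  rewrite setICA -BB' iX0//; last exact: AS.
  rewrite (Wi _ _ s0 st)// iX0//; last first.
    apply: sub_sigma_algebra2 GE' => D [u /= us WB]; exists u => //=.
    by move: us; rewrite !in_itv/= => /andP[-> _].
  by rewrite muleCA.
have sT0 : <<s GW s >> setT by exact: (@measurableT _ (g_sigma_algebraType (GW s))).
have GXT' : GX setT by exists setT => //; rewrite setTI.
have [||||_ ->] := @product_rule_sigma _ _ _ P A G mA _ _ _ E.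
- by move=> _ [B [E' [GB GE'] ->]]; apply: measurableI; [exact: GXT|exact: gGW].
- move=> _ _ [B1 [E1 [GB1 GE1] ->]] [B2 [E2 [GB2 GE2] ->]].
  exists (B1 `&` B2); exists (E1 `&` E2); last by rewrite setIACA.
  split; last exact: (@measurableI _ (g_sigma_algebraType (GW s))).
  case: GB1 => C1 mC1 <-; case: GB2 => C2 mC2 <-; exists (C1 `&` C2).
    exact: measurableI.
  by rewrite !setTI preimage_setI.
- by move=> _ [B [E' [GB GE'] ->]]; exact: key.
- apply: sub_sigma_algebra2 HE => B [GB|GB].
    by exists B; exists setT => //; rewrite setIT.
  exists setT; exists B; last by rewrite setTI.
  by split => //; exact: sub_sigma_algebra.
by rewrite /A Wn.
Qed.

Lemma brownian_freezing s t (B H : T -> R) (a : R) : 0 <= s -> s < t ->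
  adapted (history s) B -> adapted (history s) H ->
  (exists M : R, forall w, `|B w| <= M) ->
  \int[P]_w (B w * cos (H w * (W t w - W s w) + a)) =
  cos a * \int[P]_w (B w * expR (- ((t - s) * H w ^+ 2 / 2))).
Proof.
move=> s0 st aB aH BM.
apply: (@gaussian_freezing _ _ _ _ (history s)) => //.
- exact: history_measurable.
- by rewrite subr_gt0.
- by apply: measurable_funB; apply: mW; rewrite ?(le_trans s0)// ltW.
- by move=> C E mC HE; exact: history_indep.
Qed.

Lemma brownian_freezing_sin s t (B H : T -> R) : 0 <= s -> s < t ->
  adapted (history s) B -> adapted (history s) H ->
  (exists M : R, forall w, `|B w| <= M) ->
  \int[P]_w (B w * sin (H w * (W t w - W s w))) = 0.
Proof.
move=> s0 st aB aH BM.
(* A quarter period turns the cosine into a sine, and the factor cos (- pi / 2) kills the right-hand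
   side. *)
have := brownian_freezing (- (pi / 2)) s0 st aB aH BM.
rewrite cosN cos_pihalf mul0r => <-.
by apply: eq_Rintegral => w _; rewrite cosB sin_pihalf cos_pihalf mulr0 add0r mulr1.
Qed.

End history.

Section trig_bounds.
Context {R : realType}.
Implicit Types x y : R.

(** The derivative is bounded only at points no farther from [x] than [y] is. Applied repeatedly to
    Taylor remainders, this raises the order by one each time, with cruder constants than Taylor's
    formula. *)
Lemma mean_value_le (f f' : R -> R) (x y M : R) :
  (forall z : R, is_derive (z : R) 1 f (f' z)) ->
  (forall z, `|z - x| <= `|y - x| -> `|f' z| <= M) ->
  `|f y - f x| <= M * `|y - x|.
Proof.
move=> df fM.
have cf : continuous f.
  by move=> z; apply: differentiable_continuous; apply/derivable1_diffP; apply: ex_derive.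
have [xy|yx|->] := ltgtP x y; last by rewrite !subrr normr0 mulr0.
- have [z zxy ->] := MVT xy (fun z _ => df z) (continuous_subspaceT cf).
  rewrite normrM ler_wpM2r// fM//; move: zxy; rewrite in_itv/= => /andP[xz zy].
  by rewrite !ger0_norm ?subr_ge0 ?ltW// ltrD2r.
- have [z zxy h] := MVT yx (fun z _ => df z) (continuous_subspaceT cf).
  rewrite distrC h normrM [X in _ <= _ * X]distrC ler_wpM2r// fM//.
  move: zxy; rewrite in_itv/= => /andP[xz zy].
  by rewrite !ler0_norm ?subr_le0 ?ltW// !opprB ltrD2l ltrN2.
Qed.

Lemma cos_lip x y : `|cos y - cos x| <= `|y - x|.
Proof.
rewrite -[leRHS]mul1r; apply: (@mean_value_le cos (fun z => - sin z)) => z _.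
by rewrite normrN sin_max.
Qed.

Lemma sin_lip x y : `|sin y - sin x| <= `|y - x|.
Proof.
rewrite -[leRHS]mul1r; apply: (@mean_value_le sin cos) => z _.
by rewrite cos_max.
Qed.

Lemma cos_taylor1 x h : `|cos (x + h) - cos x + h * sin x| <= h ^+ 2.
Proof.
have := @mean_value_le (fun t => cos (x + t) + t * sin x) (fun t => - sin (x + t) + sin x) 0 h `|h|.
rewrite !subr0 addr0 mul0r addr0 -expr2 real_normK ?num_real//.
rewrite addrAC; apply => z.
  by apply: is_derive_eq; rewrite /GRing.scale/=; ring.
rewrite subr0 => zh; rewrite addrC (le_trans (sin_lip _ _))//.
by rewrite opprD addNKr normrN.
Qed.

Lemma sin_taylor1 x h : `|sin (x + h) - sin x - h * cos x| <= h ^+ 2.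
Proof.
have := @mean_value_le (fun t => sin (x + t) - t * cos x) (fun t => cos (x + t) - cos x) 0 h `|h|.
rewrite !subr0 addr0 mul0r subr0 -expr2 real_normK ?num_real//.
rewrite addrAC; apply => z.
  by apply: is_derive_eq; rewrite /GRing.scale/=; ring.
rewrite subr0 => zh; rewrite (le_trans (cos_lip _ _))//.
by rewrite addrAC subrr add0r.
Qed.

Lemma cos_taylor2 x h :
  `|cos (x + h) - cos x + h * sin x + h ^+ 2 / 2 * cos x| <= `|h| ^+ 3.
Proof.
have := @mean_value_le (fun t => cos (x + t) + t * sin x + t ^+ 2 / 2 * cos x)
  (fun t => - (sin (x + t) - sin x - t * cos x)) 0 h (`|h| ^+ 2).
rewrite !subr0 addr0 expr0n/= !mul0r !addr0 -exprSr.
rewrite (_ : cos (x + h) + _ + _ - _ = cos (x + h) - cos x + h * sin x + h ^+ 2 / 2 * cos x); last by ring.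
apply => z; first by apply: is_derive_eq; rewrite /GRing.scale/=; field.
rewrite subr0 normrN => zh; rewrite (le_trans (sin_taylor1 _ _))//.
by rewrite -(real_normK (num_real z)) lerXn2r ?nnegrE.
Qed.

(** By [cos_taylor2], 1 - cos x >= x^2 / 2 - |x|^3 >= x^2 / 4 in this range. It lets the bounded
    variable 1 - cos stand in for a square, for increments, for tails and for small angles. *)
Lemma sqr_le_cos x : `|x| <= 1 / 4 -> x ^+ 2 <= 4 * (1 - cos x).
Proof.
move=> x4; have := cos_taylor2 0 x.
rewrite add0r cos0 sin0 mulr0 addr0 mulr1 ler_norml => /andP[_].
rewrite -(real_normK (num_real x)); move: (normr_ge0 x) x4; set y := `|x|.
by rewrite exprS; nra.
Qed.

Lemma expRB1_le x : `|expR x - 1| <= `|x| * expR `|x|.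
Proof.
have := @mean_value_le expR expR 0 x (expR `|x|).
rewrite !subr0 expR0 [leRHS]mulrC; apply => z; rewrite subr0 => zx.
by rewrite ger0_norm ?expR_ge0// ler_expR (le_trans (ler_norm _)).
Qed.

Lemma expRN_taylor1 x : 0 <= x -> `|expR (- x) - 1 + x| <= x ^+ 2.
Proof.
move=> x0; have h1 := expR_ge1Dx (- x); have h2 := expR_ge1Dx x.
have h3 : expR (- x) * expR x = 1 by rewrite -expRD addNr expR0.
have h4 := expR_ge0 (- x).
rewrite ger0_norm; last by lra.
by nra.
Qed.

End trig_bounds.

(** * The Euler scheme *)

Section euler.
Context {R : realType} {d : measure_display} {T : measurableType d}.
Variables (lam sg : R) (W : R -> T -> R) (X0 : T -> R) (dt : R).

Definition step_incr (i : nat) (w : T) : R := W (i.+1%:R * dt) w - W (i%:R * dt) w.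

Fixpoint euler (i : nat) (w : T) : R :=
  if i is j.+1 then
    euler j w - lam * sin (euler j w) * dt + sg * step_incr j w
  else X0 w.

Variable P : probability T R.
Hypothesis bmW : brownian_motion P W.
Hypothesis mX0 : measurable_fun setT X0.
Hypothesis iX0 : indep_rv_sigma P X0 (sigma_gen W `[0, +oo[).
Hypothesis dt0 : 0 < dt.

Let Hst i := history W X0 (i%:R * dt).

Let t0 i : 0 <= i%:R * dt. Proof. by rewrite mulr_ge0// ltW. Qed.

Let tS i : i%:R * dt < i.+1%:R * dt.
Proof. by rewrite ltr_pM2r// ltr_nat. Qed.

Let tSB i : i.+1%:R * dt - i%:R * dt = dt.
Proof. by rewrite -mulrBl -natrB// subSnn mul1r. Qed.

Lemma adapted_mono i j (X : T -> R) : (i <= j)%N -> adapted (Hst i) X -> adapted (Hst j) X.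
Proof.
move=> ij; apply: adapted_sub; apply: history_mono.
by rewrite ler_wpM2r ?(ltW dt0)// ler_nat.
Qed.

Let HstM i : <<s Hst i >> `<=` measurable.
Proof. exact: (history_measurable bmW mX0). Qed.

Lemma adapted_bmf i (X : T -> R) : adapted (Hst i) X -> (exists M : R, forall w, `|X w| <= M) -> bmf X.
Proof.
by move=> aX XM; split => //; apply: adapted_measurable aX; exact: HstM.
Qed.

Lemma adapted_step i j : (i < j)%N -> adapted (Hst j) (step_incr i).
Proof.
move=> ij; apply: measurable_funB; apply: adapted_brownian.
  by rewrite t0/= ler_wpM2r ?(ltW dt0)// ler_nat.
by rewrite t0/= ler_wpM2r ?(ltW dt0)// ler_nat ltnW.
Qed.

Lemma measurable_step i : measurable_fun setT (step_incr i).
Proof.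
apply: (@adapted_measurable _ _ _ (Hst i.+1)); last exact: adapted_step.
exact: HstM.
Qed.

Lemma adapted_sin G (X : T -> R) : adapted G X -> adapted G (fun w => sin (X w)).
Proof.
move=> aX; apply: (measurableT_comp (f := @sin R)) => //.
by apply: continuous_measurable_fun; exact: continuous_sin.
Qed.

Lemma adapted_cos G (X : T -> R) : adapted G X -> adapted G (fun w => cos (X w)).
Proof.
move=> aX; apply: (measurableT_comp (f := @cos R)) => //.
by apply: continuous_measurable_fun; exact: continuous_cos.
Qed.

Lemma adapted_expR G (X : T -> R) : adapted G X -> adapted G (fun w => expR (X w)).
Proof. by move=> aX; apply: (measurableT_comp (f := @expR R)). Qed.

Lemma adapted_cst G (c : R) : adapted G (fun _ : T => c).
Proof. exact: measurable_cst. Qed.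

Lemma adaptedD G (X Y : T -> R) : adapted G X -> adapted G Y ->
  adapted G (fun w => X w + Y w).
Proof. exact: measurable_funD. Qed.

Lemma adaptedB G (X Y : T -> R) : adapted G X -> adapted G Y ->
  adapted G (fun w => X w - Y w).
Proof. exact: measurable_funB. Qed.

Lemma adaptedM G (X Y : T -> R) : adapted G X -> adapted G Y ->
  adapted G (fun w => X w * Y w).
Proof. exact: measurable_funM. Qed.

Lemma adaptedX G (X : T -> R) n : adapted G X -> adapted G (fun w => X w ^+ n).
Proof. exact: measurable_funX. Qed.

Lemma adaptedN G (X : T -> R) : adapted G X -> adapted G (fun w => - X w).
Proof. by move=> aX; apply: measurableT_comp. Qed.

Lemma adaptedDc G (X : T -> R) c : adapted G X -> adapted G (fun w => X w + c).
Proof. by move=> aX; apply: adaptedD => //; exact: adapted_cst. Qed.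

Lemma adaptedcM G (X : T -> R) c : adapted G X -> adapted G (fun w => c * X w).
Proof. by move=> aX; apply: adaptedM => //; exact: adapted_cst. Qed.

Lemma adapted_sum G (n : nat) (X : nat -> T -> R) :
  (forall i, (i < n)%N -> adapted G (X i)) -> adapted G (fun w => \sum_(i < n) X i w).
Proof.
elim: n => [_|n IH h].
  by under eq_fun do rewrite big_ord0; exact: adapted_cst.
under eq_fun do rewrite big_ord_recr/=.
by apply: adaptedD; [apply: IH => i /ltnW; exact: h|exact: h].
Qed.

Lemma adapted_euler i : adapted (Hst i) (euler i).
Proof.
elim: i => [|i IH] /=; first exact: adapted_init.
have ae : adapted (Hst i.+1) (euler i) by exact: adapted_mono IH.
apply: adaptedD; last by apply: adaptedM; [exact: adapted_cst|exact: adapted_step].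
apply: adaptedB => //; apply: adaptedM; last exact: adapted_cst.
by apply: adaptedM; [exact: adapted_cst|exact: adapted_sin].
Qed.

Lemma measurable_euler i : measurable_fun setT (euler i).
Proof.
exact: (adapted_measurable (@HstM i) (@adapted_euler i)).
Qed.

Lemma step_freezing i (B H : T -> R) : adapted (Hst i) B -> adapted (Hst i) H ->
  (exists M : R, forall w, `|B w| <= M) ->
  \int[P]_w (B w * cos (H w * step_incr i w)) =
    \int[P]_w (B w * expR (- (dt * H w ^+ 2 / 2))) /\
  \int[P]_w (B w * sin (H w * step_incr i w)) = 0.
Proof.
move=> aB aH BM; split.
  have := brownian_freezing bmW mX0 iX0 0 (t0 i) (tS i) aB aH BM.
  rewrite cos0 mul1r tSB => <-.
  by apply: eq_Rintegral => w _; rewrite addr0.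
exact: (brownian_freezing_sin bmW mX0 iX0 (t0 i) (tS i) aB aH BM).
Qed.

Section clt.
Variables (u a : R).

(** The phase selects the direction of differentiation of the drift: - sin for [a = 0], and cos for
    [a = - (pi / 2)]. *)
Definition score (j : nat) (w : T) : R := \sum_(i < j) - sin (euler i w + a) * step_incr i w.
Definition info (j : nat) (w : T) : R := \sum_(i < j) sin (euler i w + a) ^+ 2 * dt.

Lemma info_ge0 j w : 0 <= info j w.
Proof. by apply: sumr_ge0 => i _; rewrite mulr_ge0 ?sqr_ge0// ltW. Qed.

Lemma sqr_sin_le1 (x : R) : sin x ^+ 2 <= 1.
Proof. by rewrite -(real_normK (num_real _)) expr_le1 ?sin_max. Qed.

Lemma info_le j w : info j w <= j%:R * dt.
Proof.
rewrite mulr_natl -[X in _ *+ X]card_ord -sumr_const; apply: ler_sum => i _.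
by rewrite ler_piMl ?sqr_sin_le1// (ltW dt0).
Qed.

(** The shift by one matters: the last term of [info j.+1] is a function of [euler j], so it is
    known before the increment [step_incr j] is drawn. *)
Lemma adapted_info j k : (j <= k.+1)%N -> adapted (Hst k) (info j).
Proof.
move=> jk; apply: (@adapted_sum _ _ (fun i w => sin (euler i w + a) ^+ 2 * dt)) => i ij; apply: adaptedM; last exact: adapted_cst.
apply: adaptedX; apply: adapted_sin; apply: adaptedDc.
by apply: adapted_mono (@adapted_euler i); rewrite -ltnS (leq_trans ij).
Qed.

Lemma adapted_score j : adapted (Hst j) (score j).
Proof.
apply: (@adapted_sum _ _ (fun i w => - sin (euler i w + a) * step_incr i w)) => i ij; apply: adaptedM; last exact: adapted_step.
apply: adaptedN; apply: adapted_sin; apply: adaptedDc.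
by apply: adapted_mono (@adapted_euler i); exact: ltnW.
Qed.

Lemma bmf_info j : bmf (info j).
Proof.
apply: (@adapted_bmf j); first by apply: adapted_info.
exists (j%:R * dt) => w; rewrite ger0_norm ?info_le// info_ge0//.
Qed.

Lemma bmf_exp_info j c : bmf (fun w => expR (c * info j w)).
Proof. by apply/bmf_expR/bmfZ/bmf_info. Qed.

Lemma measurable_score j : measurable_fun setT (score j).
Proof. exact: (adapted_measurable (@HstM j) (@adapted_score j)). Qed.

(** Given the past, the cosine of the last Gaussian term has mean exp (- u^2 sin^2 dt / 2), which
    cancels the last factor of the exponential of the information, and its sine has mean 0. *)
Lemma exp_martingale j b :
  \int[P]_w (expR (u ^+ 2 / 2 * info j w) * cos (u * score j w + b)) = cos b.
Proof.
elim: j => [|j IH].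
  rewrite -[RHS](Ex_cst P); apply: eq_Rintegral => w _.
  by rewrite /info /score !big_ord0 mulr0 expR0 mul1r mulr0 add0r.
pose H w := - u * sin (euler j w + a).
have aH : adapted (Hst j) H.
  apply: adaptedcM; apply: adapted_sin; apply: adaptedDc.
  exact: adapted_euler.
pose B1 w := expR (u ^+ 2 / 2 * info j.+1 w) * cos (u * score j w + b).
pose B2 w := expR (u ^+ 2 / 2 * info j.+1 w) * sin (u * score j w + b).
have aE : adapted (Hst j) (fun w => expR (u ^+ 2 / 2 * info j.+1 w)).
  by apply: adapted_expR; apply: adaptedcM; exact: adapted_info.
have aS : adapted (Hst j) (fun w => u * score j w + b).
  by apply: adaptedDc; apply: adaptedcM; exact: adapted_score.
have [mE [M EM]] := bmf_exp_info j.+1 (u ^+ 2 / 2).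
have aB1 : adapted (Hst j) B1 by apply: adaptedM => //; exact: adapted_cos.
have aB2 : adapted (Hst j) B2 by apply: adaptedM => //; exact: adapted_sin.
have B1M : exists M : R, forall w, `|B1 w| <= M.
  by exists (M * 1) => w; rewrite normrM ler_pM// cos_max.
have B2M : exists M : R, forall w, `|B2 w| <= M.
  by exists (M * 1) => w; rewrite normrM ler_pM// sin_max.
have bB1 := adapted_bmf aB1 B1M. have bB2 := adapted_bmf aB2 B2M.
have [h1 _] := step_freezing aB1 aH B1M.
have [_ h2] := step_freezing aB2 aH B2M.
have mHD : measurable_fun setT (fun w => H w * step_incr j w).
  by apply: measurable_funM; [exact: (adapted_measurable (@HstM j) aH)|exact: measurable_step].
transitivity (\int[P]_w (B1 w * cos (H w * step_incr j w) - B2 w * sin (H w * step_incr j w))).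
  apply: eq_Rintegral => w _; rewrite /B1 /B2 -!mulrA -mulrBr; congr (_ * _).
  rewrite -cosD; congr cos.
  by rewrite [in LHS]/score big_ord_recr/= -/(score j w) /H; ring.
rewrite ExB; first last.
- by apply: bmfM => //; exact: bmf_sin.
- by apply: bmfM => //; exact: bmf_cos.
rewrite h1 h2 subr0 -IH; apply: eq_Rintegral => w _.
rewrite /B1 mulrAC -expRD; congr (expR _ * _).
by rewrite /info big_ord_recr/= /H; field.
Qed.

(** In [exp_martingale] the random factor is replaced by its value at the deterministic [v]. Both
    [info n] and [v] lie between 0 and n dt, so the relative error is linear in |info - v| with a
    bounded exponential factor. *)
Lemma clt_bound n v b : 0 <= v <= n%:R * dt ->
  `|\int[P]_w cos (u * score n w + b) - cos b * expR (- (u ^+ 2 / 2 * v))| <=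
  u ^+ 2 / 2 * expR (u ^+ 2 / 2 * (n%:R * dt)) * \int[P]_w `|info n w - v|.
Proof.
move=> /andP[v0 vT].
set c := u ^+ 2 / 2; have c0 : 0 <= c by rewrite divr_ge0 ?sqr_ge0.
have mcos : bmf (fun w => cos (u * score n w + b)).
  by apply/bmf_cos/measurable_funD => //; apply: measurable_funM => //; exact: measurable_score.
have bE := bmf_exp_info n c.
rewrite -(exp_martingale n b) -/c [X in _ - X]mulrC -[X in _ - X]ExZ; last exact: (bmfM bE mcos).
rewrite -ExB//; last by apply/bmfZ/bmfM.
have bd : bmf (fun w => `|info n w - v|).
  by apply/bmf_norm/bmfB; [exact: bmf_info|exact: bmf_cst].
rewrite -ExZ//; apply: le_trans (Ex_abs _ _) _.
  by apply: bmfB => //; apply/bmfZ/bmfM.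
apply: Ex_le; [|exact: bmfZ|].
  by apply/bmf_norm/bmfB => //; apply/bmfZ/bmfM.
move=> w; rewrite mulrA -expRD -{1}[cos _]mul1r -mulrBl normrM.
rewrite -[leRHS]mulr1 ler_pM ?cos_max// distrC.
apply: le_trans (expRB1_le _) _.
have -> : - (c * v) + c * info n w = c * (info n w - v) by ring.
rewrite normrM (ger0_norm c0) [leRHS]mulrAC.
apply: ler_wpM2l; first exact: mulr_ge0.
rewrite ler_expR ler_wpM2l// ler_norml.
by have := info_ge0 n w; have := info_le n w; lra.
Qed.

End clt.

(** * The generator along the Euler scheme: martingale part and remainder *)

Section ergodic.
Variables (k b : R).
Hypothesis k0 : 0 <= k.
Hypothesis sg0 : 0 < sg.
Hypothesis lam0 : 0 < lam.
Let c := (k * sg) ^+ 2 / 2.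
Let alpha := expR (- (dt * c)).
Let c0 : 0 <= c. Proof. by rewrite divr_ge0 ?sqr_ge0. Qed.
Let cdt0 : 0 <= dt * c. Proof. by rewrite mulr_ge0 ?(ltW dt0). Qed.

Let C i w := cos (k * euler i w + b).
Let S i w := sin (k * euler i w + b).
Let cD i w := cos (k * sg * step_incr i w).
Let sD i w := sin (k * sg * step_incr i w).
(** The martingale part of the increment of cos (k Y + b): the noise changes the cosine to C cD - S
    sD, whose mean given the past is alpha C. *)
Let m i w := C i w * (cD i w - alpha) - S i w * sD i w.

Let aC i : adapted (Hst i) (C i).
Proof. by apply: adapted_cos; apply: adaptedDc; apply: adaptedcM; exact: adapted_euler. Qed.
Let aS i : adapted (Hst i) (S i).
Proof. by apply: adapted_sin; apply: adaptedDc; apply: adaptedcM; exact: adapted_euler. Qed.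
Let acD i : adapted (Hst i.+1) (cD i).
Proof. by apply: adapted_cos; apply: adaptedcM; exact: adapted_step. Qed.
Let asD i : adapted (Hst i.+1) (sD i).
Proof. by apply: adapted_sin; apply: adaptedcM; exact: adapted_step. Qed.
Let bC i : bmf (C i).
Proof. by apply: adapted_bmf (@aC i) _; exists 1 => w; exact: cos_max. Qed.
Let bS i : bmf (S i).
Proof. by apply: adapted_bmf (@aS i) _; exists 1 => w; exact: sin_max. Qed.
Let bcD i : bmf (cD i).
Proof. by apply: adapted_bmf (@acD i) _; exists 1 => w; exact: cos_max. Qed.
Let bsD i : bmf (sD i).
Proof. by apply: adapted_bmf (@asD i) _; exists 1 => w; exact: sin_max. Qed.
Let bm i : bmf (m i).
Proof.
apply: bmfB; first by apply: bmfM => //; apply: bmfB => //; exact: bmf_cst.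
exact: bmfM.
Qed.
Let am i : adapted (Hst i.+1) (m i).
Proof.
apply: adaptedB; apply: adaptedM => //.
- exact: adapted_mono (@aC i).
- by apply: adaptedB => //; exact: adapted_cst.
- exact: adapted_mono (@aS i).
Qed.

Let Em0 i B : adapted (Hst i) B -> bmf B -> \int[P]_w (B w * m i w) = 0.
Proof.
move=> aB bB.
have [h1 _] := @step_freezing i (fun w => B w * C i w) (fun=> k * sg)
  (adaptedM aB (@aC i)) (@adapted_cst (Hst i) (k * sg)) (bmfM bB (bC i)).2.
have [_ h2] := @step_freezing i (fun w => B w * S i w) (fun=> k * sg)
  (adaptedM aB (@aS i)) (@adapted_cst (Hst i) (k * sg)) (bmfM bB (bS i)).2.
have -> : \int[P]_w (B w * m i w) = \int[P]_w ((B w * C i w * cD i w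
    - alpha * (B w * C i w)) - B w * S i w * sD i w).
  by apply: eq_Rintegral => w _; rewrite /m; ring.
have b1 : bmf (fun w => B w * C i w) by exact: bmfM.
rewrite ExB; first last.
- by apply: bmfM => //; exact: bmfM.
- by apply: bmfB; [exact: bmfM|exact: bmfZ].
rewrite h2 subr0 ExB; [|exact: bmfM|exact: bmfZ].
rewrite h1 ExZ//; under eq_Rintegral do rewrite mulrC.
by rewrite ExZ// (_ : expR _ = alpha) ?subrr// /alpha /c mulrA.
Qed.

Let alpha_ge : 1 - alpha <= dt * c.
Proof. by have := expR_ge1Dx (- (dt * c)); rewrite -/alpha; lra. Qed.

Let EcD i : \int[P]_w (1 - cD i w) <= dt * c.
Proof.
have [h1 _] := @step_freezing i (fun=> 1) (fun=> k * sg)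
  (@adapted_cst (Hst i) 1) (@adapted_cst (Hst i) (k * sg)) (bmf_cst 1).2.
rewrite ExB; [|exact: bmf_cst|by []].
rewrite Ex_cst (_ : \int[P]_w cD i w = alpha)//.
have -> : alpha = \int[P]_w (1 * expR (- (dt * (k * sg) ^+ 2 / 2))).
  by rewrite Ex_cst mul1r /alpha /c mulrA.
by rewrite -h1; apply: eq_Rintegral => w _; rewrite mul1r.
Qed.

Let cD1 i w : 0 <= 1 - cD i w.
Proof. by rewrite subr_ge0 (le_trans (ler_norm _))// cos_max. Qed.

Let sD2 i w : sD i w ^+ 2 <= 2 * (1 - cD i w).
Proof.
have := cos2Dsin2 (k * sg * step_incr i w); rewrite -/(cD i w) -/(sD i w).
by have := cD1 i w; nra.
Qed.

Let alpha_le1 : alpha <= 1.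
Proof. by rewrite -expR0 ler_expR oppr_le0. Qed.

(** Both sD^2 and (cD - alpha)^2 are controlled by 1 - cD and 1 - alpha, of mean at most c dt; hence
    the order dt, with a generous constant. *)
Let Em2 i : \int[P]_w (m i w ^+ 2) <= 16 * (dt * c).
Proof.
have h w : m i w ^+ 2 <= 8 * (1 - cD i w) + 4 * (1 - alpha).
  have a0 : 0 <= alpha := expR_ge0 _.
  have a1 := alpha_le1.
  have h1 : m i w ^+ 2 <= 2 * (cD i w - alpha) ^+ 2 + 2 * sD i w ^+ 2.
    rewrite /m; set x := cD i w - alpha.
    have : `|C i w| <= 1 by exact: cos_max.
    have : `|S i w| <= 1 by exact: sin_max.
    have hC : C i w ^+ 2 + S i w ^+ 2 = 1 by exact: cos2Dsin2.
    have := sqr_ge0 (C i w * sD i w + S i w * x).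
    (* The pair (C, S) acts as a rotation on (x, sD), so one coordinate of the image has at most the
       full squared length. *)
    have e : (C i w * x - S i w * sD i w) ^+ 2 + (C i w * sD i w + S i w * x) ^+ 2 = (C i w ^+ 2 + S i w ^+ 2) * (x ^+ 2 + sD i w ^+ 2).
      by ring.
    by move: e; rewrite hC; have := sqr_ge0 x; have := sqr_ge0 (sD i w); lra.
  have := sD2 i w; have := cD1 i w.
  have : cD i w <= 1 by have := cD1 i w; lra.
  have : -1 <= cD i w by have := cos_max (k * sg * step_incr i w); rewrite ler_norml => /andP[].
  have : (cD i w - alpha) ^+ 2 <= 2 * (1 - cD i w) + 2 * (1 - alpha).
    have := cD1 i w; set y := 1 - cD i w => y0.
    have -> : cD i w - alpha = (1 - alpha) - y by rewrite /y; ring.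
    have : y <= 2.
      by rewrite /y; have := cos_max (k * sg * step_incr i w); rewrite ler_norml -/(cD i w) => /andP[]; lra.
    by nra.
  by lra.
apply: le_trans (Ex_le P _ _ h) _; first exact: bmfX.
  by apply: bmfD; [apply/bmfZ/bmfB => //|]; exact: bmf_cst.
rewrite ExD; first last.
- exact: bmf_cst.
- by apply/bmfZ/bmfB => //; exact: bmf_cst.
rewrite ExZ ?Ex_cst; last by apply/bmfB => //; exact: bmf_cst.
by have := EcD i; have := alpha_ge; have := cdt0; lra.
Qed.

Let M j w := \sum_(i < j) m i w.
Let aM j : adapted (Hst j) (M j).
Proof.
apply: adapted_sum => i ij.
exact: adapted_mono (@am i).
Qed.
Let bM j : bmf (M j). Proof. exact: bmf_sum. Qed.

(** Orthogonality of martingale increments: the cross term vanishes by [Em0], so second moments add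
    up. *)
Let EM2 j : \int[P]_w (M j w ^+ 2) <= j%:R * (16 * (dt * c)).
Proof.
elim: j => [|j IH].
  by under eq_Rintegral do rewrite /M big_ord0 expr0n; rewrite Ex_cst mul0r.
have -> : \int[P]_w (M j.+1 w ^+ 2) =
    \int[P]_w (M j w ^+ 2 + 2 * (M j w * m j w) + m j w ^+ 2).
  by apply: eq_Rintegral => w _; rewrite /M big_ord_recr/=; ring.
have b1 : bmf (fun w => 2 * (M j w * m j w)) by apply/bmfZ/bmfM.
rewrite ExD; [|by apply: bmfD => //; exact: bmfX|exact: bmfX].
rewrite ExD//; last exact: bmfX.
rewrite ExZ; last exact: bmfM.
rewrite Em0 ?mulr0 ?addr0; [|exact: aM|by []].
by rewrite -natr1 mulrDl mul1r lerD ?Em2.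
Qed.

(** The Riemann sum of the generator - lam sin (y) d/dy + (sg^2 / 2) d^2/dy^2 applied to cos (k y +
    b). By [trig_sumE] it equals boundary terms minus a martingale and minus the remainders. *)
Definition trig_sum (n : nat) (w : T) : R :=
  \sum_(i < n) (k * lam * sin (euler i w) * S i w - c * C i w) * dt.

Let err i w := C i.+1 w - C i w - m i w - (k * lam * sin (euler i w) * S i w - c * C i w) * dt.

Let berr i : bmf (err i).
Proof.
apply: bmfB; first by apply: bmfB => //; exact: bmfB.
apply: bmfM; last exact: bmf_cst.
apply: bmfB; last exact: bmfZ.
apply: bmfM => //; apply: bmfZ; apply: bmf_sin; exact: measurable_euler.
Qed.

Let err_le i w : `|err i w| <= (k * lam * dt) ^+ 2 + (dt * c) ^+ 2 +
  k * lam * dt * ((1 - cD i w) + `|sD i w|).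
Proof.
set h := - (k * lam * sin (euler i w) * dt).
set x := k * euler i w + b + k * sg * step_incr i w.
have e1 : C i.+1 w = cos (x + h) by rewrite /C /x /h /=; congr cos; ring.
have e2 : cos x = C i w * cD i w - S i w * sD i w by rewrite /x cosD.
have e3 : sin x = S i w * cD i w + C i w * sD i w by rewrite /x sinD.
have -> : err i w = (cos (x + h) - cos x + h * sin x)
    + (C i w * (alpha - 1 + dt * c)) - h * (sin x - S i w).
  by rewrite /err e1 /m e2 /h; ring.
have kl0 : 0 <= k * lam by rewrite mulr_ge0 ?(ltW lam0).
have h1 : `|h| <= k * lam * dt.
  rewrite normrN !normrM (ger0_norm (ltW dt0)) ler_wpM2r ?(ltW dt0)//.
  by rewrite (ger0_norm k0) (ger0_norm (ltW lam0)) ler_piMr// sin_max.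
rewrite (le_trans (ler_normB _ _))// lerD//.
  rewrite (le_trans (ler_normD _ _))// lerD//.
    apply: le_trans (cos_taylor1 _ _) _.
    by rewrite -(real_normK (num_real h)) lerXn2r ?nnegrE// mulr_ge0// ltW.
  rewrite normrM (le_trans (ler_piMl _ (cos_max _)))//.
  by apply: expRN_taylor1.
rewrite normrM ler_pM// e3.
have -> : S i w * cD i w + C i w * sD i w - S i w = - (S i w * (1 - cD i w)) + C i w * sD i w.
  by ring.
rewrite (le_trans (ler_normD _ _))// lerD// ?normrN normrM.
  by rewrite (ger0_norm (cD1 i w)) ler_piMl// sin_max.
by rewrite ler_piMl// cos_max.
Qed.

Hypothesis dt1 : dt <= 1.
Let sq := Num.sqrt dt.
Let sq0 : 0 < sq. Proof. by rewrite sqrtr_gt0. Qed.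
Let sq2 : sq ^+ 2 = dt. Proof. by rewrite sqr_sqrtr// ltW. Qed.
Let sq1 : sq <= 1. Proof. by rewrite -sqrtr1 ler_wsqrtr. Qed.

Definition err_cst := (k * lam) ^+ 2 + c ^+ 2 + k * lam * (2 * c + 1).

(** The worst remainder is the product of the drift step, of order dt, with the noise, of order sqrt
    dt. *)
Let Eerr i : \int[P]_w `|err i w| <= dt * (err_cst * sq).
Proof.
have kl0 : 0 <= k * lam by rewrite mulr_ge0 ?(ltW lam0).
have h w : `|err i w| <= ((k * lam * dt) ^+ 2 + (dt * c) ^+ 2 + k * lam * dt * (sq / 2))
    + k * lam * dt * (1 + sq^-1) * (1 - cD i w).
  apply: le_trans (err_le i w) _; rewrite -[leRHS]addrA lerD2l.
  have -> : k * lam * dt * (sq / 2) + k * lam * dt * (1 + sq^-1) * (1 - cD i w) =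
    k * lam * dt * (sq / 2 + (1 + sq^-1) * (1 - cD i w)) by ring.
  apply: ler_wpM2l; first by rewrite mulr_ge0// ltW.
  (* The inequality 2 |s| q <= s^2 + q^2 with sD^2 <= 2 (1 - cD) takes the place of Cauchy-Schwarz,
     so that only the mean of 1 - cD is required. *)
  have : `|sD i w| <= sq / 2 + sq^-1 * (1 - cD i w).
    rewrite -(ler_pM2l sq0) mulrDr mulrA mulrA mulfV ?gt_eqF// mul1r -expr2.
    have := sD2 i w; rewrite -(real_normK (num_real (sD i w))).
    by set y := `|sD i w|; have := sqr_ge0 (y - sq); nra.
  by rewrite mulrDl mul1r; lra.
apply: le_trans (Ex_le P _ _ h) _; first exact: bmf_norm.
  by apply: bmfD; [exact: bmf_cst|apply/bmfZ/bmfB => //; exact: bmf_cst].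
have bb : bmf (fun w => 1 - cD i w) by apply/bmfB => //; exact: bmf_cst.
rewrite ExD; [|exact: bmf_cst|exact: bmfZ].
rewrite Ex_cst ExZ//.
have : k * lam * dt * (1 + sq^-1) * \int[P]_w (1 - cD i w) <= k * lam * dt * (1 + sq^-1) * (dt * c).
  apply: ler_wpM2l (EcD i); apply: mulr_ge0; first by rewrite mulr_ge0// ltW.
  by rewrite addr_ge0// invr_ge0 ltW.
have e : sq^-1 * dt = sq by rewrite -sq2 expr2 mulrA mulVf ?mul1r// gt_eqF.
have -> : k * lam * dt * (1 + sq^-1) * (dt * c) = k * lam * dt * c * (dt + sq).
  by rewrite -[in X in _ = _ * (_ + X)]e; ring.
have dsq : dt <= sq by rewrite -sq2 expr2 ler_piMl ?(ltW sq0).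
move=> hh.
have h2 : (k * lam * dt) ^+ 2 <= dt * ((k * lam) ^+ 2 * sq).
  have -> : (k * lam * dt) ^+ 2 = dt * ((k * lam) ^+ 2 * dt) by ring.
  by rewrite ler_wpM2l ?(ltW dt0)// ler_wpM2l ?sqr_ge0.
have h3 : (dt * c) ^+ 2 <= dt * (c ^+ 2 * sq).
  have -> : (dt * c) ^+ 2 = dt * (c ^+ 2 * dt) by ring.
  by rewrite ler_wpM2l ?(ltW dt0)// ler_wpM2l ?sqr_ge0.
have h4 : k * lam * dt * c * (dt + sq) <= k * lam * dt * c * (2 * sq).
  by apply: ler_wpM2l; [rewrite !mulr_ge0// ltW|lra].
have h5 : k * lam * dt * (sq / 2) <= k * lam * dt * sq.
  by apply: ler_wpM2l; [rewrite !mulr_ge0// ltW|move: sq0; lra].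
have -> : dt * (err_cst * sq) = dt * ((k * lam) ^+ 2 * sq) + dt * (c ^+ 2 * sq) +
    k * lam * dt * sq + k * lam * dt * c * (2 * sq) by rewrite /err_cst; ring.
by lra.
Qed.

Lemma trig_sumE n w : trig_sum n w = C n w - C 0%N w - M n w - \sum_(i < n) err i w.
Proof.
elim: n => [|n IH]; first by rewrite /trig_sum /M !big_ord0; ring.
rewrite /trig_sum /M !big_ord_recr/= -/(trig_sum n w) -/(M n w) IH /err; ring.
Qed.

Lemma bmf_trig_sum n : bmf (trig_sum n).
Proof.
apply: (@bmf_sum _ _ _ n (fun i w => (k * lam * sin (euler i w) * S i w - c * C i w) * dt)).
move=> i _; apply: bmfM; last exact: bmf_cst.
apply: bmfB; last exact: bmfZ.
apply: bmfM => //; apply: bmfZ; apply: bmf_sin; exact: measurable_euler.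
Qed.

(** Boundary terms are bounded, the martingale is of order sqrt (n dt) by [EM2], and the remainders
    add up to n dt sqrt dt, which the condition n dt^2 <= 1 brings down to the same order. After
    division by the horizon the error tends to 0. *)
Lemma trig_sum_bound n : 1 <= n%:R * dt -> n%:R * dt * dt <= 1 ->
  \int[P]_w `|trig_sum n w| <= (3 + 8 * c + err_cst) * Num.sqrt (n%:R * dt).
Proof.
set Tm := n%:R * dt => T1 Tdt.
set q := Num.sqrt Tm.
have q1 : 1 <= q by rewrite -sqrtr1 ler_wsqrtr.
have q2 : q ^+ 2 = Tm by rewrite sqr_sqrtr// (le_trans _ T1).
have q0 : 0 < q by rewrite (lt_le_trans _ q1).
have h w : `|trig_sum n w| <= (2 + q / 2) + (2 * q)^-1 * M n w ^+ 2 + \sum_(i < n) `|err i w|.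
  rewrite trig_sumE (le_trans (ler_normB _ _))// lerD ?ler_norm_sum//.
  rewrite (le_trans (ler_normB _ _))// -addrA lerD//.
    rewrite (le_trans (ler_normB _ _))// (_ : 2 = 1 + 1)//.
    by rewrite lerD// cos_max.
  rewrite -(ler_pM2l q0) mulrDr invfM mulrA (mulrA q) (mulrA q) (mulrAC q _ q^-1) mulfV ?gt_eqF// mul1r -expr2.
  rewrite -(real_normK (num_real (M n w))).
  by set y := `|M n w|; have := sqr_ge0 (y - q); nra.
have berrs : bmf (fun w => \sum_(i < n) `|err i w|).
  by apply: (@bmf_sum _ _ _ n (fun i w => `|err i w|)) => i _; exact: bmf_norm.
have bM2 : bmf (fun w => (2 * q)^-1 * M n w ^+ 2) by apply/bmfZ/bmfX.
apply: le_trans (Ex_le P _ _ h) _; first exact/bmf_norm/bmf_trig_sum.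
  by apply: bmfD => //; apply: bmfD => //; exact: bmf_cst.
rewrite ExD//; last by apply: bmfD => //; exact: bmf_cst.
rewrite ExD//; last exact: bmf_cst.
rewrite Ex_cst ExZ; last exact: bmfX.
rewrite (@Ex_sum _ _ _ _ n (fun i w => `|err i w|)); last by move=> i _; exact: bmf_norm.
have h1 : (2 * q)^-1 * \int[P]_w (M n w ^+ 2) <= 8 * c * q.
  have -> : 8 * c * q = (2 * q)^-1 * (n%:R * (16 * (dt * c))).
    have -> : n%:R * (16 * (dt * c)) = 16 * c * Tm by rewrite /Tm; ring.
    by rewrite -q2; field; rewrite gt_eqF.
  by apply: ler_wpM2l; [rewrite invr_ge0 mulr_ge0// ltW|exact: EM2].
have h2 : \sum_(i < n) \int[P]_w `|err i w| <= err_cst * q.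
  apply: (@le_trans _ _ (\sum_(i < n) dt * (err_cst * sq))).
    by apply: ler_sum => i _; exact: Eerr.
  rewrite sumr_const card_ord -mulr_natl mulrA -/Tm.
  have : 0 <= err_cst.
    have := c0; have := mulr_ge0 k0 (ltW lam0).
    by rewrite /err_cst; set x := k * lam; set y := c; nra.
  (* The square of the left-hand side is n dt^2. *)
  have : q * sq <= 1.
    rewrite -(@ler_pXn2r _ 2)// ?nnegrE ?mulr_ge0 ?(ltW q0) ?(ltW sq0)//.
    by rewrite exprMn q2 sq2 expr1n.
  move=> qs ec; rewrite -q2 expr2.
  have -> : q * q * (err_cst * sq) = (err_cst * q) * (q * sq) by ring.
  by rewrite ler_piMr// mulr_ge0// ltW.
by have := q1; lra.
Qed.

End ergodic.

End euler.

(** * Bessel functions and the limit of the second harmonic *)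

Section bessel.
Context {R : realType}.
Variable x : R.
Hypothesis x0 : 0 < x.
Let y := x / 2.
Let y0 : 0 < y. Proof. by rewrite divr_gt0. Qed.
Let t (n k : nat) : R := y ^+ (2 * k + n)%N / (k`! * (k + n)`!)%N%:R.

Let t_ge0 n k : 0 <= t n k.
Proof. by rewrite divr_ge0// exprn_ge0// ltW. Qed.

Let t_le n k : t n k <= expR y * exp_coeff (y ^+ 2) k.
Proof.
have h1 : y ^+ n / n`!%:R <= expR y.
  case: n => [|n]; first by rewrite expr0 divr1 -expR0 ler_expR ltW.
  by rewrite (le_trans _ (expR_ge1Dxn n (ltW y0)))// lerDr.
apply: (@le_trans _ _ (y ^+ n / n`!%:R * exp_coeff (y ^+ 2) k)); last first.
  by rewrite ler_wpM2r// exp_coeff_ge0// sqr_ge0.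
rewrite /exp_coeff/= -exprM mulf_div -exprD [(n + _)%N]addnC -natrM.
rewrite ler_wpM2l ?exprn_ge0 ?(ltW y0)// lef_pV2 ?posrE ?ltr0n ?muln_gt0 ?fact_gt0//.
rewrite ler_nat [(n`! * _)%N]mulnC leq_mul2l; apply/orP; right.
by elim: k => [|k IH]; rewrite ?add0n// addSn factS (leq_trans IH)// leq_pmull.
Qed.

Let cexp : cvgn (series (fun k => expR y * exp_coeff (y ^+ 2) k)) /\
  limn (series (fun k => expR y * exp_coeff (y ^+ 2) k)) = expR y * expR (y ^+ 2).
Proof.
have e : series (fun k => expR y * exp_coeff (y ^+ 2) k) = fun n => expR y * series (exp_coeff (y ^+ 2)) n.
  by apply/funext => n; rewrite /series/= mulr_sumr.
have c : expR y * series (exp_coeff (y ^+ 2)) n @[n --> \oo] --> expR y * expR (y ^+ 2).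
  by apply: cvgMl_tmp; exact: is_cvg_series_exp_coeff.
by rewrite e; split; [apply/cvg_ex; exists (expR y * expR (y ^+ 2))|exact: cvg_lim c].
Qed.

Let ct n : cvgn (series (t n)).
Proof.
apply: (series_le_cvg (t_ge0 n) _ (t_le n)).
  by move=> k; rewrite mulr_ge0 ?expR_ge0// exp_coeff_ge0// sqr_ge0.
exact: cexp.1.
Qed.

(** Termwise comparison with an exponential series. The bound does not depend on the order [n], as
    needed when all harmonics are compared at once. *)
Lemma besselI_le n : besselI n x <= expR y * expR (y ^+ 2).
Proof.
have h := lim_series_le (@ct n) cexp.1 (t_le n).
by apply: (le_trans h); rewrite cexp.2.
Qed.

Let besselI_ge n : y ^+ n / n`!%:R <= besselI n x.
Proof.
rewrite -[leRHS]/(limn (series (t n))).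
apply: limr_ge; [exact: ct|]; exists 1%N => // k /= k1.
rewrite /series/= -(prednK k1) big_nat_recl//= -/(t n 0) /t muln0 fact0 add0n mul1n.
by rewrite lerDl; apply: sumr_ge0 => i _; exact: (t_ge0 n i.+1).
Qed.

Lemma besselI_ge0 n : 0 <= besselI n x.
Proof. by apply: le_trans (besselI_ge n); rewrite divr_ge0// exprn_ge0// ltW. Qed.

Lemma besselI0_ge1 : 1 <= besselI 0 x.
Proof. by have := besselI_ge 0; rewrite expr0 fact0 divr1. Qed.

Lemma besselI_rec n :
  besselI n x - besselI n.+2 x = 2 * n.+1%:R / x * besselI n.+1 x.
Proof.
(* The series of order n + 2 starts two powers of y later, so its partial sum is one term shorter;
   then the identity holds term by term and passes to the limit. *)
have h (N : nat) : y * (series (t n) N.+1 - series (t n.+2) N) = n.+1%:R * series (t n.+1) N.+1.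
  elim: N => [|N IH].
    rewrite /series/= !big_nat1 big_geq// subr0 /t !muln0 !add0n fact0 !mul1n factS natrM exprS.
    by field; rewrite nat1r !pnatr_eq0 -lt0n fact_gt0.
  have st m k : series (t m) k.+1 = series (t m) k + t m k by rewrite /series/= big_nat_recr.
  rewrite (st n) (st n.+2) (st n.+1) [in RHS]mulrDr -IH.
  suff e : y * (t n N.+1 - t n.+2 N) = n.+1%:R * t n.+1 N.+1.
    by rewrite -e; ring.
  rewrite /t.
  have -> : (2 * N.+1 + n = (2 * N + n).+2)%N by rewrite mulnS.
  have -> : (2 * N.+1 + n.+1 = (2 * N + n).+3)%N by rewrite mulnS addnS.
  rewrite ?(addnS, addSn) !factS !natrM !exprS.
  rewrite -!natr1 natrD.
  field.
  by rewrite -!natrD !natr1 !pnatr_eq0 -!lt0n !fact_gt0.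
have c1 : y * (series (t n) N.+1 - series (t n.+2) N) @[N --> \oo] --> y * (besselI n x - besselI n.+2 x).
  apply: cvgMl_tmp; apply: cvgB; last exact: ct.
  by rewrite cvg_shiftS; exact: ct.
have c2 : n.+1%:R * series (t n.+1) N.+1 @[N --> \oo] --> n.+1%:R * besselI n.+1 x.
  by apply: cvgMl_tmp; rewrite cvg_shiftS; exact: ct.
have e : y * (besselI n x - besselI n.+2 x) = n.+1%:R * besselI n.+1 x.
  move: c1; under eq_fun do rewrite h.
  by move=> c1; apply: (cvg_unique _ c1 c2).
apply: (@mulfI _ y); first by rewrite gt_eqF.
by rewrite e /y; field; rewrite gt_eqF.
Qed.

(** The recurrence gives (2 / x) I_1, and the first term of I_1 is x / 2. This keeps the asymptotic
    information for [lambda] away from 0. *)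
Lemma besselI2_lt : 1 <= besselI 0 x - besselI 2 x.
Proof.
rewrite besselI_rec mulr1; have := besselI_ge 1; rewrite expr1 divr1.
move=> h; have e : 2 / x * y = 1 by rewrite /y; field; rewrite gt_eqF.
by rewrite -[leLHS]e ler_wpM2l// divr_ge0// ltW.
Qed.

End bessel.

Section recurrence.
Context {R : realType}.

(* Multiplying the recurrence by r_(j+1) makes the left-hand side telescope, which
   yields an energy bound that dies out as M tends to infinity. *)
Lemma perturbed_recurrence (r e : nat -> R) (g B : R) (M : nat) :
  0 < g -> r 0 = 0 -> (forall k, `|r k| <= B) ->
  (forall j, r j - r j.+2 = g * j.+1%:R * r j.+1 + e j) ->
  2 * g * r 2 ^+ 2 <= 2 * B ^+ 2 / g / M.+2%:R + (B / g + B) * \sum_(j < M.+2) `|e j|.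
Proof.
move=> g0 r0 rB rec.
have B0 : 0 <= B by rewrite (le_trans _ (rB 0)).
have tele N : \sum_(j < N) g * j.+1%:R * r j.+1 ^+ 2 = - (r N * r N.+1) - \sum_(j < N) e j * r j.+1.
  elim: N => [|N IH]; first by rewrite !big_ord0 r0 mul0r oppr0 addr0.
  rewrite !big_ord_recr/= IH.
  have -> : g * N.+1%:R * r N.+1 ^+ 2 = (r N - r N.+2 - e N) * r N.+1 by rewrite rec; ring.
  ring.
have h1 : 2 * g * r 2 ^+ 2 <= \sum_(j < M.+2) g * j.+1%:R * r j.+1 ^+ 2.
  rewrite big_ord_recl big_ord_recl /= /bump/= add1n.
  rewrite addrCA mulr1 [g * 2]mulrC lerDl addr_ge0//.
    by rewrite mulr_ge0 ?sqr_ge0// ltW.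
  by apply: sumr_ge0 => i _; rewrite mulr_ge0 ?sqr_ge0// mulr_ge0// ltW.
apply: le_trans h1 _; rewrite tele.
have h2 : `|\sum_(j < M.+2) e j * r j.+1| <= B * \sum_(j < M.+2) `|e j|.
  rewrite (le_trans (ler_norm_sum _ _ _))// mulr_sumr; apply: ler_sum => i _.
  by rewrite normrM mulrC ler_wpM2r.
have M0 : 0 < M.+2%:R :> R by rewrite ltr0n.
(* The boundary term of the telescoped sum must vanish as M grows, which the bound B^2 does not
   give; the recurrence itself forces r_(M+2) to be of order 1 / M up to the error term. *)
have h3 : g * M.+2%:R * `|r M.+2| <= 2 * B + `|e M.+1|.
  have -> : g * M.+2%:R * `|r M.+2| = `|r M.+1 - r M.+3 - e M.+1|.
    by rewrite rec addrK normrM (gtr0_norm (mulr_gt0 g0 M0)).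
  rewrite (le_trans (ler_normB _ _))// lerD2r (le_trans (ler_normB _ _))//.
  by have := rB M.+1; have := rB M.+3; lra.
have h4 : `|e M.+1| <= \sum_(j < M.+2) `|e j|.
  by rewrite big_ord_recr/= lerDr sumr_ge0.
have h5 : - (r M.+2 * r M.+3) <= B / g / M.+2%:R * (2 * B + `|e M.+1|).
  apply: (@le_trans _ _ (B * `|r M.+2|)).
    by rewrite (le_trans (ler_norm _))// normrN normrM mulrC ler_wpM2r.
  rewrite -!mulrA ler_wpM2l// mulrA -invfM ler_pdivlMl ?mulr_gt0//.
have h6 : B / g / M.+2%:R * `|e M.+1| <= B / g * \sum_(j < M.+2) `|e j|.
  rewrite -[leLHS]mulrA ler_wpM2l ?divr_ge0 ?(ltW g0)//.
  apply: le_trans h4; by rewrite mulrC ler_pdivrMr// ler_peMr// ler1n.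
have := ler_norm (- \sum_(j < M.+2) e j * r j.+1); rewrite normrN.
move: h5; rewrite mulrDr.
have -> : B / g / M.+2%:R * (2 * B) = 2 * B ^+ 2 / g / M.+2%:R.
  by field; rewrite !gt_eqF.
rewrite [(B / g + B) * _]mulrDl; move: h2 h6.
set a1 := \sum_(j < _) `|_|; set a2 := \sum_(j < _) _; set a3 := r _ * r _.
set a4 := B / g * a1; set a5 := B * a1; set a6 := 2 * _ / _ / _; set a7 := _ * `|e _|.
by lra.
Qed.

End recurrence.

Definition euler_mean {R : realType} {d : measure_display} {T : measurableType d} (lam sg : R) (W : R -> T -> R)
    (X0 : T -> R) (dt k b : R) (n : nat) (w : T) : R :=
  (\sum_(i < n) cos (k * euler lam sg W X0 dt i w + b) * dt) / (n%:R * dt).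

Section euler_mean.
Context {R : realType} {d : measure_display} {T : measurableType d}.
Variables (P : probability T R) (W : R -> T -> R) (X0 : T -> R).
Hypothesis bmW : brownian_motion P W.
Hypothesis mX0 : measurable_fun setT X0.
Hypothesis iX0 : indep_rv_sigma P X0 (sigma_gen W `[0, +oo[).
Variables (lam sg dt b : R) (n : nat).
Hypothesis lam0 : 0 < lam.
Hypothesis sg0 : 0 < sg.
Hypothesis dt0 : 0 < dt.
Hypothesis n0 : (0 < n)%N.

Let Tm := n%:R * dt.
Let Tm0 : 0 < Tm. Proof. by rewrite mulr_gt0// ltr0n. Qed.

Let hm (k : R) := euler_mean lam sg W X0 dt k b n.

Lemma euler_mean_le1 k w : `|hm k w| <= 1.
Proof.
rewrite /hm /euler_mean normrM normfV (gtr0_norm Tm0) ler_pdivrMr// mul1r.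
rewrite (le_trans (ler_norm_sum _ _ _))// /Tm mulr_natl -[X in _ *+ X]card_ord -sumr_const.
apply: ler_sum => i _.
by rewrite normrM (gtr0_norm dt0) ler_piMl ?cos_max// ltW.
Qed.

Lemma bmf_euler_mean k : bmf (hm k).
Proof.
split; last by exists 1 => w; exact: euler_mean_le1.
have : bmf (fun w => \sum_(i < n) cos (k * euler lam sg W X0 dt i w + b) * dt).
  apply: (@bmf_sum _ _ _ n (fun i w => cos (k * euler lam sg W X0 dt i w + b) * dt)).
  move=> i _; apply: bmfM; last exact: bmf_cst.
  apply: bmf_cos; apply: measurable_funD => //; apply: measurable_funM => //.
  exact: (measurable_euler lam sg bmW mX0 dt0).
by move=> [mS _]; apply: measurable_funM.
Qed.

(** The product sin (y) sin (k y + b) splits into the two neighbouring harmonics, so the generator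
    couples only k - 1, k and k + 1. *)
Lemma trig_sum_harmonic k w : trig_sum lam sg W X0 dt k b n w =
  Tm * (k * lam / 2 * (hm (k - 1) w - hm (k + 1) w) - (k * sg) ^+ 2 / 2 * hm k w).
Proof.
have hmE k' : hm k' w * Tm = \sum_(i < n) cos (k' * euler lam sg W X0 dt i w + b) * dt.
  by rewrite /hm /euler_mean divfK// gt_eqF.
have -> : Tm * (k * lam / 2 * (hm (k - 1) w - hm (k + 1) w) - (k * sg) ^+ 2 / 2 * hm k w) =
  k * lam / 2 * (hm (k - 1) w * Tm - hm (k + 1) w * Tm) - (k * sg) ^+ 2 / 2 * (hm k w * Tm).
  by ring.
rewrite !hmE -sumrB !mulr_sumr -sumrB /trig_sum; apply: eq_bigr => i _.
set y := euler _ _ _ _ _ _ _.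
have -> : (k - 1) * y + b = k * y + b - y by ring.
have -> : (k + 1) * y + b = k * y + b + y by ring.
set z := k * y + b; by rewrite (cosB z y) (cosD z y); field.
Qed.

Hypothesis dt1 : dt <= 1.
Hypothesis Tm1 : 1 <= Tm.
Hypothesis Tmdt : Tm * dt <= 1.

Let g := sg ^+ 2 / lam.

Let resid (j : nat) w := hm j%:R w - hm j.+2%:R w - g * j.+1%:R * hm j.+1%:R w.

Let residE j w : resid j w = 2 / (j.+1%:R * lam * Tm) * trig_sum lam sg W X0 dt j.+1%:R b n w.
Proof.
rewrite trig_sum_harmonic /resid /g.
have -> : j.+1%:R - 1 = j%:R :> R by rewrite -natr1 addrK.
rewrite natr1.
by field; rewrite nat1r pnatr_eq0/= gt_eqF//= gt_eqF.
Qed.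

Let bmf_resid j : bmf (resid j).
Proof.
apply: bmfB; first by apply: bmfB; exact: bmf_euler_mean.
by apply: bmfZ; exact: bmf_euler_mean.
Qed.

Definition resid_cst (l1 : R) (j : nat) : R :=
  3 + 8 * ((j%:R * sg) ^+ 2 / 2) + err_cst l1 sg j%:R.

Let Eresid (l0 l1 : R) j (M : nat) : 0 < l0 -> l0 <= lam <= l1 -> (j < M.+2)%N ->
  \int[P]_w `|resid j w| <= 2 / l0 * resid_cst l1 M.+2 / Num.sqrt Tm.
Proof.
move=> l00 /andP[l0l ll1] jM.
have q0 : 0 < Num.sqrt Tm by rewrite sqrtr_gt0.
have k0 : 0 < j.+1%:R :> R by rewrite ltr0n.
have k1 : 1 <= j.+1%:R :> R by rewrite ler1n.
have kM : j.+1%:R <= M.+2%:R :> R by rewrite ler_nat.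
have h := trig_sum_bound bmW mX0 iX0 dt0 b (ltW k0) sg0 lam0 dt1 Tm1 Tmdt.
have -> : \int[P]_w `|resid j w| = 2 / (j.+1%:R * lam * Tm) * \int[P]_w `|trig_sum lam sg W X0 dt j.+1%:R b n w|.
  rewrite -ExZ; last by apply: bmf_norm; exact: (bmf_trig_sum lam sg bmW mX0 dt0).
  apply: eq_Rintegral => w _; rewrite residE normrM ger0_norm//.
  by rewrite divr_ge0// !mulr_ge0// ltW.
apply: (@le_trans _ _ (2 / (j.+1%:R * lam * Tm) * (resid_cst l1 M.+2 * Num.sqrt Tm))).
  apply: ler_wpM2l; first by rewrite divr_ge0// !mulr_ge0// ltW.
  apply: le_trans h _; apply: ler_wpM2r; first exact: sqrtr_ge0.
  have l10 : 0 <= l1 by rewrite (le_trans (ltW lam0)).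
  have a1 : (j.+1%:R * sg) ^+ 2 / 2 <= (M.+2%:R * sg) ^+ 2 / 2.
    rewrite ler_pM2r// lerXn2r ?nnegrE ?mulr_ge0 ?(ltW sg0)//.
    by rewrite ler_wpM2r ?(ltW sg0).
  have a2 : j.+1%:R * lam <= M.+2%:R * l1 by rewrite ler_pM// ltW.
  have a3 : 0 <= j.+1%:R * lam by rewrite mulr_ge0// ltW.
  have a4 : 0 <= (j.+1%:R * sg) ^+ 2 / 2 by rewrite divr_ge0// sqr_ge0.
  rewrite /resid_cst /err_cst; move: a1 a2 a3 a4.
  set x1 := (_ * sg) ^+ 2 / 2; set x2 := (_ * sg) ^+ 2 / 2; set y1 := _ * lam; set y2 := _ * l1.
  by nra.
rewrite -[X in _ / (_ * _ * X)](sqr_sqrtr (ltW Tm0)).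
have -> : 2 / (j.+1%:R * lam * Num.sqrt Tm ^+ 2) * (resid_cst l1 M.+2 * Num.sqrt Tm) =
    2 / (j.+1%:R * lam) * resid_cst l1 M.+2 / Num.sqrt Tm.
  by field; rewrite nat1r pnatr_eq0/= !gt_eqF.
apply: ler_wpM2r; first by rewrite invr_ge0 ltW.
apply: ler_wpM2r.
  have l10 : 0 <= l1 by rewrite (le_trans (ltW lam0)).
  rewrite /resid_cst /err_cst; have := mulr_ge0 (ler0n R M.+2) l10.
  have : 0 <= (M.+2%:R * sg) ^+ 2 / 2 by rewrite divr_ge0// sqr_ge0.
  by set x := _ / 2; set y := _ * l1; nra.
apply: ler_wpM2l => //; rewrite lef_pV2 ?posrE ?mulr_gt0//.
by apply: (le_trans l0l); rewrite ler_peMl// ltW.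
Qed.

(** The sequence cos b I_k / I_0 solves the exact recurrence with kappa = 2 lam / sg^2, so its
    difference from the averages solves the perturbed one. [B] and [g0] involve [l1] in place of
    [lam], which makes the bound uniform; [M] stays free, to be fixed before the horizon. *)
Lemma second_harmonic_bound (l0 l1 : R) (M : nat) : 0 < l0 -> l0 <= lam <= l1 ->
  forall B g0 : R, B = 1 + expR (l1 / sg ^+ 2) * expR ((l1 / sg ^+ 2) ^+ 2) ->
  g0 = sg ^+ 2 / l1 ->
  2 * g0 * \int[P]_w ((hm 2 w - cos b * (besselI 2 (2 * lam / sg ^+ 2) / besselI 0 (2 * lam / sg ^+ 2))) ^+ 2) <=
  2 * B ^+ 2 / g0 / M.+2%:R + (B / g0 + B) * (M.+2%:R * (2 / l0 * resid_cst l1 M.+2 / Num.sqrt Tm)).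
Proof.
move=> l00 l01 B g0 BE g0E.
have /andP[l0l ll1] := l01.
have l10 : 0 < l1 by rewrite (lt_le_trans lam0).
set kap := 2 * lam / sg ^+ 2.
have s2 : 0 < sg ^+ 2 by rewrite exprn_gt0.
have kap0 : 0 < kap by rewrite divr_gt0// mulr_gt0.
have I0 : 0 < besselI 0 kap by rewrite (lt_le_trans _ (besselI0_ge1 kap0)).
pose beta (k : nat) := cos b * (besselI k kap / besselI 0 kap).
pose r (w : T) (k : nat) := hm k%:R w - beta k.
have g00 : 0 < g0 by rewrite g0E divr_gt0.
have g_gt0 : 0 < g by rewrite divr_gt0.
have gg : g0 <= g by rewrite g0E ler_wpM2l ?(ltW s2)// lef_pV2 ?posrE.
have rB w k : `|r w k| <= B.
  rewrite BE (le_trans (ler_normB _ _))// lerD ?euler_mean_le1//.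
  rewrite normrM (le_trans (ler_piMl _ (cos_max _)))//.
  rewrite ger0_norm; last by rewrite divr_ge0 ?besselI_ge0// ltW.
  apply: (@le_trans _ _ (besselI k kap)).
    by rewrite ler_pdivrMr// ler_peMr ?besselI_ge0// besselI0_ge1.
  apply: le_trans (besselI_le kap0 k) _.
  have e : kap / 2 <= l1 / sg ^+ 2.
    by rewrite /kap mulrAC (mulrAC 2) mulfV// mul1r ler_wpM2r// invr_ge0 ltW.
  by rewrite ler_pM ?expR_ge0// ler_expR// lerXn2r// nnegrE ltW// divr_gt0.
(* The harmonic of order 0 is the constant cos b, so its average is exact. *)
have r0 w : r w 0%N = 0.
  rewrite /r /beta divff ?gt_eqF// mulr1 /hm /euler_mean.
  under eq_bigr do rewrite mul0r add0r.
  rewrite sumr_const card_ord -[cos b * dt *+ n]mulr_natl.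
  by rewrite mulrCA -/Tm mulfK ?gt_eqF// subrr.
have betaE j : beta j - beta j.+2 = g * j.+1%:R * beta j.+1.
  have := besselI_rec kap0 j => h.
  have -> : beta j - beta j.+2 = cos b / besselI 0 kap * (besselI j kap - besselI j.+2 kap).
    by rewrite /beta; ring.
  rewrite h /beta /g /kap; field; rewrite !gt_eqF//.
have rec w j : r w j - r w j.+2 = g * j.+1%:R * r w j.+1 + resid j w.
  have := betaE j; rewrite /r /resid => e.
  by rewrite mulrBr -e; ring.
have key w : 2 * g0 * r w 2%N ^+ 2 <= 2 * B ^+ 2 / g0 / M.+2%:R + (B / g0 + B) * \sum_(j < M.+2) `|resid j w|.
  have B0 : 0 <= B by rewrite (le_trans _ (rB w 0%N)).
  have S0 : 0 <= \sum_(j < M.+2) `|resid j w| by apply: sumr_ge0.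
  apply: (@le_trans _ _ (2 * g * r w 2%N ^+ 2)).
    by rewrite ler_wpM2r ?sqr_ge0// ler_wpM2l.
  apply: le_trans (perturbed_recurrence M g_gt0 (r0 w) (rB w) (rec w)) _.
  have gi : g^-1 <= g0^-1 by rewrite lef_pV2 ?posrE.
  apply: lerD.
    by rewrite ler_wpM2r// ler_wpM2l// mulr_ge0// sqr_ge0.
  by rewrite ler_wpM2r// lerD2r ler_wpM2l.
have br : bmf (fun w => r w 2%N) by apply: bmfB; [exact: bmf_euler_mean|exact: bmf_cst].
have bS : bmf (fun w => \sum_(j < M.+2) `|resid j w|).
  apply: (@bmf_sum _ _ _ M.+2 (fun j w => `|resid j w|)) => j _.
  by apply: bmf_norm; exact: bmf_resid.
rewrite -ExZ; last exact: bmfX.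
apply: le_trans (Ex_le P _ _ key) _.
- by apply: bmfZ; exact: bmfX.
- by apply: bmfD; [exact: bmf_cst|exact: bmfZ].
rewrite ExD; [|exact: bmf_cst|exact: bmfZ].
have B0 : 0 <= B by rewrite (le_trans _ (rB point 0%N)).
rewrite Ex_cst ExZ// lerD2l ler_wpM2l ?addr_ge0 ?divr_ge0 ?(ltW g00)//.
rewrite (@Ex_sum _ _ _ _ M.+2 (fun j w => `|resid j w|)); last first.
  by move=> j _; apply: bmf_norm; exact: bmf_resid.
rewrite mulr_natl -[X in _ *+ X]card_ord -sumr_const; apply: ler_sum => j _.
exact: Eresid.
Qed.

End euler_mean.

Lemma second_harmonic_L1 {R : realType} (sg l0 l1 eta : R) :
  0 < sg -> 0 < l0 -> 0 < l1 -> 0 < eta ->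
  exists2 T0 : R, 1 <= T0 & forall (d : measure_display) (T : measurableType d)
    (P : probability T R) (W : R -> T -> R) (X0 : T -> R) (lam dt b : R) (n : nat),
  brownian_motion P W -> measurable_fun setT X0 ->
  indep_rv_sigma P X0 (sigma_gen W `[0, +oo[) -> l0 <= lam <= l1 ->
  0 < dt -> dt <= 1 -> T0 <= n%:R * dt -> n%:R * dt * dt <= 1 ->
  \int[P]_w `|euler_mean lam sg W X0 dt 2 b n w -
    cos b * (besselI 2 (2 * lam / sg ^+ 2) / besselI 0 (2 * lam / sg ^+ 2))| <= eta.
Proof.
move=> sg0 l00 l10 eta0.
pose B : R := 1 + expR (l1 / sg ^+ 2) * expR ((l1 / sg ^+ 2) ^+ 2).
pose g0 : R := sg ^+ 2 / l1.
have B0 : 0 < B by rewrite addr_gt0// mulr_gt0// expR_gt0.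
have g00 : 0 < g0 by rewrite divr_gt0// exprn_gt0.
(* [M] makes the truncation term at most g0 eta^2. With [M] fixed, [T0] does the same for the
   accumulated residuals, which decay like 1 / sqrt T. *)
pose M := Num.truncn (2 * B ^+ 2 / g0 / (g0 * eta ^+ 2)).
pose K : R := (B / g0 + B) * (M.+2%:R * (2 / l0 * resid_cst sg l1 M.+2)).
pose T0 : R := Num.max 1 ((K / (g0 * eta ^+ 2)) ^+ 2).
have ge0 : 0 < g0 * eta ^+ 2 by rewrite mulr_gt0// exprn_gt0.
exists T0; first by rewrite le_max lexx.
move=> d T P W X0 lam dt b n bmW mX0 iX0 ll dt0 dt1 T0n ndt.
have lam0 : 0 < lam by have /andP[+ _] := ll; exact: lt_le_trans.
have Tm1 : 1 <= n%:R * dt by apply: le_trans T0n; rewrite le_max lexx.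
have n0 : (0 < n)%N.
  by rewrite lt0n; apply: contraTneq Tm1 => ->; rewrite mul0r ler10.
have := second_harmonic_bound bmW mX0 iX0 b lam0 sg0 dt0 n0 dt1 Tm1 ndt M l00 ll (erefl B) (erefl g0).
set beta := cos b * _; pose X w := euler_mean lam sg W X0 dt 2 b n w - beta.
have bX : bmf X.
  by apply: bmfB; [exact: (bmf_euler_mean bmW mX0)|exact: bmf_cst].
have -> : \int[P]_w `|euler_mean lam sg W X0 dt 2 b n w - beta| = \int[P]_w `|X w| by [].
have -> : \int[P]_w ((euler_mean lam sg W X0 dt 2 b n w - beta) ^+ 2) = \int[P]_w (X w ^+ 2) by [].
move=> h.
have h1 : 2 * B ^+ 2 / g0 / M.+2%:R <= g0 * eta ^+ 2.
  rewrite ler_pdivrMr ?ltr0n// -ler_pdivrMl// mulrC ltW//.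
  by rewrite (lt_le_trans (truncnS_gt _))// ler_nat.
have q0 : 0 < Num.sqrt (n%:R * dt) by rewrite sqrtr_gt0 (lt_le_trans ltr01).
have h2 : (B / g0 + B) * (M.+2%:R * (2 / l0 * resid_cst sg l1 M.+2 / Num.sqrt (n%:R * dt))) <= g0 * eta ^+ 2.
  have -> : (B / g0 + B) * (M.+2%:R * (2 / l0 * resid_cst sg l1 M.+2 / Num.sqrt (n%:R * dt))) =
    K / Num.sqrt (n%:R * dt) by rewrite /K; ring.
  rewrite ler_pdivrMr// -ler_pdivrMl// mulrC.
  apply: le_trans (ler_norm _) _.
  rewrite -sqrtr_sqr ler_wsqrtr// (le_trans _ T0n)// le_max lexx orbT//.
have E2 : \int[P]_w (X w ^+ 2) <= eta ^+ 2.
  have g2 : 0 < 2 * g0 by apply: mulr_gt0.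
  rewrite -(@ler_pM2l _ (2 * g0))//; apply: (le_trans h).
  have -> : 2 * g0 * eta ^+ 2 = g0 * eta ^+ 2 + g0 * eta ^+ 2 by ring.
  exact: lerD.
have h3 w : `|X w| <= (2 * eta)^-1 * X w ^+ 2 + eta / 2.
  rewrite -(@ler_pM2l _ (2 * eta)) ?mulr_gt0// mulrDr mulrA mulfV ?mul1r ?mulf_neq0 ?gt_eqF//.
  rewrite -(real_normK (num_real (X w))).
  by set y := `|X w|; have := sqr_ge0 (y - eta); nra.
apply: le_trans (Ex_le P _ _ h3) _; first exact: bmf_norm.
  by apply: bmfD; [apply/bmfZ/bmfX|exact: bmf_cst].
rewrite ExD; [|by apply/bmfZ/bmfX|exact: bmf_cst].
rewrite Ex_cst ExZ; last exact: bmfX.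
have : (2 * eta)^-1 * \int[P]_w (X w ^+ 2) <= (2 * eta)^-1 * eta ^+ 2.
  by rewrite ler_wpM2l// invr_ge0 mulr_ge0// ltW.
have -> : (2 * eta)^-1 * eta ^+ 2 = eta / 2 by field; rewrite gt_eqF.
by lra.
Qed.

(** * Pathwise convergence of the Euler scheme *)

Section pathwise.
Context {R : realType}.
Local Notation mu := (@lebesgue_measure R).

Lemma within_postcomp (A : set R) (f g : R -> R) :
  {within A, continuous f} -> continuous g -> {within A, continuous (fun x => g (f x))}.
Proof. by move=> cf cg x; apply: continuous_comp; [exact: cf|exact: cg]. Qed.

Lemma heine_cantor (f : R -> R) (a b e : R) : {within `[a, b], continuous f} ->
  0 < e -> exists2 r : R, 0 < r & forall x y, x \in `[a, b] -> y \in `[a, b] ->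
    `|x - y| < r -> `|f x - f y| <= e.
Proof.
move=> cf e0.
pose Q (r x : R) := x \in `[a, b] -> forall y, y \in `[a, b] -> `|x - y| < r -> `|f x - f y| <= e.
have /compact_near_coveringP K := @segment_compact R a b.
have KQ : \forall r \near 0^'+, `[a, b]%classic `<=` Q r.
  apply: K => x xab.
  have /cvgrPdist_lt/(_ (e / 2)) : f y @[y --> within [set` `[a, b]] (nbhs x)] --> f x.
    by move/subspace_continuousP: cf; exact.
  rewrite divr_gt0// => /(_ isT) [r /= r0 rf].
  have r20 : 0 < r / 2 by rewrite divr_gt0.
  exists (ball x (r / 2), [set s | s < r / 2]).
    by split => /=; [exact: nbhsx_ballx|exact: nbhs_right_lt].
  move=> [x' s] [/= xx'] /= sr x'ab y yab x'y.
  have h1 : `|f x - f x'| < e / 2.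
    by apply: rf => //=; apply: lt_trans xx' _; rewrite ltr_pdivrMr// ltr_pMr// ltr1n.
  have h2 : `|f x - f y| < e / 2.
    apply: rf => //=; rewrite (splitr r) (le_lt_trans (ler_distD x' _ _))//.
    by rewrite ltrD// (lt_trans x'y).
  rewrite (le_trans (ler_distD (f x) _ _))// (splitr e) lerD// ltW//.
  by rewrite distrC.
near (0 : R)^'+ => r; exists r; first by near: r; exact: nbhs_right_gt.
have rQ : `[a, b]%classic `<=` Q r by near: r.
by move=> x y xab; exact: rQ.
Unshelve. all: by end_near. Qed.

Lemma Rintegral_increment (f : R -> R) (Tm a b c e : R) :
  {within `[0, Tm], continuous f} -> 0 <= a -> a <= b -> b <= Tm ->
  (forall s, a <= s <= b -> `|f s - c| <= e) ->
  `|\int[mu]_(s in `[0, b]) f s - \int[mu]_(s in `[0, a]) f s - c * (b - a)| <= e * (b - a).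
Proof.
move=> cf a0 ab bT fc.
have iT : mu.-integrable `[0, Tm] (EFin \o f).
  by apply: continuous_compact_integrable => //; exact: segment_compact.
have ib : mu.-integrable `[0, b] (EFin \o f).
  by apply: integrableS iT => //; apply: subset_itvl; rewrite bnd_simp.
have iab : mu.-integrable `]a, b] (EFin \o f).
  by apply: integrableS ib => //; apply: subset_itvr; rewrite bnd_simp.
rewrite Rintegral_itvB//.
have lab : fine (mu `]a, b]) = b - a.
  rewrite lebesgue_measure_itv/= lte_fin; case: ltP => // ba.
  by rewrite (@le_anti _ _ a b) ?subrr// ab ba.
have muab : (mu `]a, b] < +oo)%E.
  by rewrite lebesgue_measure_itv/= lte_fin; case: ifP => // _; rewrite -EFinB ltry.
have icst (k : R) : mu.-integrable `]a, b] (EFin \o cst k).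
  apply: measurable_bounded_integrable => //; exists `|k|; split; first exact: num_real.
  by move=> M kM x _ /=; rewrite ltW.
rewrite -lab -[c * _]Rintegral_cst// -RintegralB//; last exact: icst.
rewrite -[leRHS]Rintegral_cst//.
apply: le_trans (le_normr_Rintegral _ _) _ => //.
  by have := integrableB _ iab (icst c); apply.
apply: le_Rintegral => //.
- by apply: integrable_norm; have := integrableB _ iab (icst c); apply.
- exact: icst.
- move=> s; rewrite /= in_itv/= => /andP[as_ sb]; apply: fc.
  by rewrite ltW.
Qed.

(* Up to cubic terms, the left-endpoint sum of - sin (x + a) is the increment of
   cos (x + a) plus half the sum of cos (x + a) times the squared increments. *)
Lemma left_sum_compare (x y : nat -> R) (n : nat) (a q A Q : R) :
  x 0 = y 0 -> 0 <= q -> q <= 1 ->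
  (forall i, (i <= n)%N -> `|x i - y i| <= q) ->
  (forall i, (i < n)%N -> `|x i.+1 - x i| <= q) ->
  (forall i, (i < n)%N -> `|y i.+1 - y i| <= 3 * q) ->
  \sum_(i < n) (x i.+1 - x i) ^+ 2 <= A -> \sum_(i < n) (y i.+1 - y i) ^+ 2 <= A ->
  \sum_(i < n) `|(x i.+1 - x i) - (y i.+1 - y i)| <= Q ->
  `|\sum_(i < n) - sin (x i + a) * (x i.+1 - x i) -
    \sum_(i < n) - sin (y i + a) * (y i.+1 - y i)| <= q * (1 + 5 * A + 2 * Q).
Proof.
move=> xy0 q0 q1 xy dx dy xA yA xyQ.
pose F (z : nat -> R) i := cos (z i.+1 + a) - cos (z i + a) + (z i.+1 - z i) * sin (z i + a)
  + (z i.+1 - z i) ^+ 2 / 2 * cos (z i + a).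
have Fle (z : nat -> R) (r : R) i : `|z i.+1 - z i| <= r -> `|F z i| <= r * (z i.+1 - z i) ^+ 2.
  move=> zr; rewrite /F.
  have -> : cos (z i.+1 + a) = cos (z i + a + (z i.+1 - z i)) by congr cos; ring.
  apply: le_trans (cos_taylor2 _ _) _.
  by rewrite exprS (real_normK (num_real _)) ler_wpM2r// sqr_ge0.
have Fsum (z : nat -> R) : \sum_(i < n) - sin (z i + a) * (z i.+1 - z i) =
    cos (z n + a) - cos (z 0 + a) + \sum_(i < n) (z i.+1 - z i) ^+ 2 / 2 * cos (z i + a)
    - \sum_(i < n) F z i.
  elim: n {xy dx dy xA yA xyQ} => [|m IH]; first by rewrite !big_ord0; ring.
  by rewrite !big_ord_recr/= IH /F; ring.
rewrite (Fsum x) (Fsum y) -xy0.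
have hx : `|\sum_(i < n) F x i| <= q * A.
  apply: le_trans (ler_norm_sum _ _ _) _.
  apply: (@le_trans _ _ (\sum_(i < n) q * (x i.+1 - x i) ^+ 2)).
    by apply: ler_sum => i _; apply: Fle; exact: dx.
  by rewrite -mulr_sumr ler_wpM2l.
have hy : `|\sum_(i < n) F y i| <= 3 * q * A.
  apply: le_trans (ler_norm_sum _ _ _) _.
  apply: (@le_trans _ _ (\sum_(i < n) 3 * q * (y i.+1 - y i) ^+ 2)).
    by apply: ler_sum => i _; apply: Fle; exact: dy.
  by rewrite -mulr_sumr ler_wpM2l// mulr_ge0.
have hn : `|cos (x n + a) - cos (y n + a)| <= q.
  apply: le_trans (cos_lip _ _) _.
  by rewrite (_ : x n + a - (y n + a) = x n - y n) ?xy//; ring.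
have hq : `|\sum_(i < n) (x i.+1 - x i) ^+ 2 / 2 * cos (x i + a) -
    \sum_(i < n) (y i.+1 - y i) ^+ 2 / 2 * cos (y i + a)| <= q * A + 2 * q * Q.
  rewrite -sumrB; apply: le_trans (ler_norm_sum _ _ _) _.
  apply: (@le_trans _ _ (\sum_(i < n) (q * (x i.+1 - x i) ^+ 2 + 2 * q * `|(x i.+1 - x i) - (y i.+1 - y i)|))).
    apply: ler_sum => i _.
    set u := x i.+1 - x i; set v := y i.+1 - y i.
    have -> : u ^+ 2 / 2 * cos (x i + a) - v ^+ 2 / 2 * cos (y i + a) =
      u ^+ 2 / 2 * (cos (x i + a) - cos (y i + a)) + (u - v) * ((u + v) / 2 * cos (y i + a)).
      by ring.
    rewrite (le_trans (ler_normD _ _))// lerD//.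
      have u2 : 0 <= u ^+ 2 / 2 by rewrite divr_ge0 ?sqr_ge0.
      rewrite normrM (ger0_norm u2) (@le_trans _ _ (u ^+ 2 / 2 * q))//; last first.
        by have := mulr_ge0 q0 (sqr_ge0 u); lra.
      rewrite ler_wpM2l//; apply: le_trans (cos_lip _ _) _.
      by rewrite (_ : x i + a - (y i + a) = x i - y i) ?xy ?(ltnW (ltn_ord i))//; ring.
    rewrite normrM mulrC ler_wpM2r// normrM (le_trans (ler_piMr _ (cos_max _)))//.
    rewrite normrM (@ger0_norm _ 2^-1)// ler_pdivrMr//.
    rewrite (le_trans (ler_normD _ _))//.
    by have := dx i (ltn_ord i); have := dy i (ltn_ord i); rewrite -/u -/v; lra.
  rewrite big_split/= -!mulr_sumr lerD// ler_wpM2l// mulr_ge0//.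
move: hx hy hn hq; set s1 := \sum_(i < n) F x i; set s2 := \sum_(i < n) F y i.
set s3 := \sum_(i < n) _; set s4 := \sum_(i < n) _.
rewrite !ler_norml => /andP[? ?] /andP[? ?] /andP[? ?] /andP[? ?].
by apply/andP; split; lra.
Qed.

End pathwise.

Section euler_convergence.
Context {R : realType} {d : measure_display} {T : measurableType d}.
Local Notation mu := (@lebesgue_measure R).
Variables (lam sg Tm : R) (W : R -> T -> R) (x : R -> T -> R) (w : T).
Hypothesis lam0 : 0 < lam.
Hypothesis sg0 : 0 < sg.
Hypothesis Tm0 : 0 < Tm.
Hypothesis cx : {within `[0, +oo[, continuous (x ^~ w)}.
Hypothesis eqx : forall t, 0 <= t -> x t w = x 0 w
  + \int[mu]_(s in `[0, t]) (- lam * sin (x s w)) + sg * W t w.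

Let cxT : {within `[0, Tm], continuous (x ^~ w)}.
Proof.
by apply: continuous_subspaceW cx => t; rewrite /= !in_itv/= => /andP[->].
Qed.

Let dt n := Tm / n%:R.
Let Y n := euler lam sg W (x 0) (dt n).

Lemma grid_le n i : (i <= n)%N -> i%:R * dt n <= Tm.
Proof.
case: n => [|n] ni; first by move: ni; rewrite leqn0 => /eqP ->; rewrite mul0r ltW.
by rewrite mulrCA ger_pMr// ler_pdivrMr ?ltr0n// mul1r ler_nat.
Qed.

Lemma grid_ge0 n i : 0 <= i%:R * dt n.
Proof. by rewrite mulr_ge0// divr_ge0// ltW. Qed.

(** The third bound carries a factor [dt n] because the process and the scheme share the same
    Brownian increment, which cancels; summed over the grid it stays of order q. *)
Definition euler_close (q : R) (n : nat) :=
  [/\ forall i, (i <= n)%N -> `|x (i%:R * dt n) w - Y n i w| <= q,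
      forall i, (i < n)%N -> `|x (i.+1%:R * dt n) w - x (i%:R * dt n) w| <= q,
      forall i, (i < n)%N -> `|(x (i.+1%:R * dt n) w - x (i%:R * dt n) w) -
        (Y n i.+1 w - Y n i w)| <= q * dt n &
      forall i, (i < n)%N -> `|step_incr W (dt n) i w| <= q].

Lemma euler_converges (q : R) : 0 < q ->
  exists N, forall n, (N <= n)%N -> (0 < n)%N -> euler_close q n /\
    forall i s, (i < n)%N -> i%:R * dt n <= s <= i.+1%:R * dt n ->
      `|x s w - x (i%:R * dt n) w| <= q.
Proof.
move=> q0.
pose E := expR (lam * Tm).
have E1 : 1 <= E by rewrite -expR0 ler_expR mulr_ge0 ?(ltW lam0) ?(ltW Tm0).
(* One summand for each loss with respect to the modulus of continuity [r]: oscillation of the path,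
   distance to the scheme, difference of the increments, and size of the Brownian increments. *)
pose K := 1 + E + lam * (E + 1) + (1 + 2 * lam) / sg.
have K1 : 0 <= lam * (E + 1) by rewrite mulr_ge0 ?(ltW lam0)// addr_ge0// (le_trans _ E1).
have K2 : 0 <= (1 + 2 * lam) / sg by rewrite divr_ge0 ?(ltW sg0)// addr_ge0// mulr_ge0// ltW.
have K0 : 0 < K by rewrite /K; lra.
pose r := q / K.
have r0 : 0 < r by rewrite divr_gt0.
have rK : r * K = q by rewrite divfK// gt_eqF.
have [rho rho0 xrho] := heine_cantor cxT r0.
pose m := Num.min rho (Num.min r 1).
have m0 : 0 < m by rewrite !lt_min rho0 r0 ltr01.
exists (Num.truncn (Tm / m)).+1 => n Nn n0.
have n0R : 0 < n%:R :> R by rewrite ltr0n.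
have dtm : dt n < m.
  rewrite /dt ltr_pdivrMr// -ltr_pdivrMl// mulrC.
  by rewrite (lt_le_trans (truncnS_gt _))// ler_nat.
move: dtm; rewrite !lt_min => /andP[dtrho /andP[dtr dt1]].
have dt0 : 0 < dt n by rewrite divr_gt0.
have tS i : i.+1%:R * dt n = i%:R * dt n + dt n by rewrite -natr1 mulrDl mul1r.
have osc i s : (i < n)%N -> i%:R * dt n <= s <= i.+1%:R * dt n ->
    `|x s w - x (i%:R * dt n) w| <= r.
  move=> ni /andP[s1 s2]; apply: xrho.
  - by rewrite in_itv/= (le_trans (grid_ge0 n i))//= (le_trans s2)// grid_le.
  - by rewrite in_itv/= grid_ge0 grid_le// ltnW.
  - rewrite ger0_norm ?subr_ge0// (le_lt_trans _ dtrho)//.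
    by move: s2; rewrite tS; lra.
have dx i : (i < n)%N -> `|x (i.+1%:R * dt n) w - x (i%:R * dt n) w| <= r.
  by move=> ni; apply: osc => //; rewrite lexx tS lerDl ltW.
have cb : {within `[0, Tm], continuous (fun s => - lam * sin (x s w))}.
  apply: (@within_postcomp _ _ (x ^~ w) (fun y => - lam * sin y)) => // y.
  by apply: cvgMl_tmp; exact: continuous_sin.
have eps i : (i < n)%N -> `|x (i.+1%:R * dt n) w - x (i%:R * dt n) w
    + lam * sin (x (i%:R * dt n) w) * dt n - sg * step_incr W (dt n) i w| <= lam * r * dt n.
  move=> ni.
  have := @Rintegral_increment R (fun s => - lam * sin (x s w)) Tm (i%:R * dt n) (i.+1%:R * dt n)
    (- lam * sin (x (i%:R * dt n) w)) (lam * r) cb (grid_ge0 n i) _ (grid_le ni) _.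
  rewrite tS lerDl -tS => /(_ (ltW dt0)) h.
  move: h; set b1 := sin (x (i%:R * dt n) w) => h.
  rewrite (eqx (grid_ge0 n i.+1)) (eqx (grid_ge0 n i)) /step_incr.
  have e : i.+1%:R * dt n - i%:R * dt n = dt n by rewrite tS addrAC subrr add0r.
  move: h; rewrite e.
  set a1 := \int[_]_(_ in _) _; set a2 := \int[_]_(_ in _) _.
  move=> h.
  have -> : x 0 w + a1 + sg * W (i.+1%:R * dt n) w - (x 0 w + a2 + sg * W (i%:R * dt n) w)
    + lam * b1 * dt n - sg * (W (i.+1%:R * dt n) w - W (i%:R * dt n) w) =
    a1 - a2 - - lam * b1 * dt n by ring.
  apply: h => s hs.
  rewrite -mulrBr normrM normrN (gtr0_norm lam0) ler_pM2l//.
  by rewrite (le_trans (sin_lip _ _))// osc.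
have ld : 0 <= lam * dt n by apply: mulr_ge0; exact: ltW.
have lr : 0 <= lam * r by apply: mulr_ge0; exact: ltW.
(* A discrete Gronwall inequality: the error grows by a factor 1 + lam dt and gains lam r dt at each
   step. *)
have err i : (i <= n)%N -> `|x (i%:R * dt n) w - Y n i w| <= r * (expR (lam * (i%:R * dt n)) - 1).
  elim: i => [_|i IH ni]; first by rewrite /Y/= !mul0r mulr0 expR0 !subrr normr0 mulr0.
  have {}IH := IH (ltnW ni).
  set e := expR (lam * (i%:R * dt n)) in IH.
  have eS : expR (lam * (i.+1%:R * dt n)) = e * expR (lam * dt n).
    by rewrite /e -expRD tS mulrDr.
  rewrite eS /Y/= -/(Y n i w).
  have -> : x (i.+1%:R * dt n) w - (Y n i w - lam * sin (Y n i w) * dt n + sg * step_incr W (dt n) i w) =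
    (x (i%:R * dt n) w - Y n i w) - lam * dt n * (sin (x (i%:R * dt n) w) - sin (Y n i w)) +
    (x (i.+1%:R * dt n) w - x (i%:R * dt n) w
    + lam * sin (x (i%:R * dt n) w) * dt n - sg * step_incr W (dt n) i w) by ring.
  apply: le_trans (ler_normD _ _) _.
  apply: le_trans (lerD (ler_normB _ _) (eps i ni)) _.
  have h1 : `|lam * dt n * (sin (x (i%:R * dt n) w) - sin (Y n i w))| <= lam * dt n * (r * (e - 1)).
    rewrite normrM (ger0_norm ld); apply: ler_wpM2l => //.
    exact: le_trans (sin_lip _ _) IH.
  apply: le_trans (lerD (lerD IH h1) (lexx _)) _.
  have -> : r * (e - 1) + lam * dt n * (r * (e - 1)) + lam * r * dt n = r * (e * (1 + lam * dt n) - 1) by ring.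
  rewrite ler_wpM2l ?(ltW r0)// lerD2r ler_wpM2l ?expR_ge0 ?expR_ge1Dx//.
have errE i : (i <= n)%N -> `|x (i%:R * dt n) w - Y n i w| <= r * E.
  move=> ni; apply: (le_trans (err i ni)); apply: ler_wpM2l; first exact: ltW.
  have : expR (lam * (i%:R * dt n)) <= E by rewrite ler_expR ler_wpM2l ?(ltW lam0)// grid_le.
  by lra.
have rq c : 0 <= c -> c <= K -> r * c <= q by move=> c0 cK; rewrite -rK ler_wpM2l// ltW.
split; last first.
  move=> i s ni hs; rewrite (le_trans (osc i s ni hs))// -[r]mulr1 rq//.
  by rewrite /K; lra.
split.
- by move=> i ni; rewrite (le_trans (errE i ni))// rq//; rewrite /K; lra.
- by move=> i ni; rewrite (le_trans (dx i ni))// -[r]mulr1 rq//; rewrite /K; lra.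
- move=> i ni; rewrite /Y/= -/(Y n i w).
  have -> : x (i.+1%:R * dt n) w - x (i%:R * dt n) w -
    (Y n i w - lam * sin (Y n i w) * dt n + sg * step_incr W (dt n) i w - Y n i w) =
    (x (i.+1%:R * dt n) w - x (i%:R * dt n) w
    + lam * sin (x (i%:R * dt n) w) * dt n - sg * step_incr W (dt n) i w)
    - lam * dt n * (sin (x (i%:R * dt n) w) - sin (Y n i w)) by ring.
  apply: le_trans (ler_normB _ _) _.
  have h1 : `|lam * dt n * (sin (x (i%:R * dt n) w) - sin (Y n i w))| <= lam * dt n * (r * E).
    rewrite normrM (ger0_norm ld); apply: ler_wpM2l => //.
    by apply: (le_trans (sin_lip _ _)); apply: errE; exact: ltnW.
  apply: le_trans (lerD (eps i ni) h1) _.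
  have -> : lam * r * dt n + lam * dt n * (r * E) = r * (lam * (E + 1)) * dt n by ring.
  by rewrite ler_wpM2r ?(ltW dt0)// rq//; rewrite /K; lra.
- move=> i ni.
  apply: (@le_trans _ _ (r * ((1 + 2 * lam) / sg))); last by rewrite rq//; rewrite /K; lra.
  rewrite mulrA ler_pdivlMr// mulrC -[X in X * _](gtr0_norm sg0) -normrM.
  have -> : sg * step_incr W (dt n) i w = (x (i.+1%:R * dt n) w - x (i%:R * dt n) w)
    + lam * sin (x (i%:R * dt n) w) * dt n - (x (i.+1%:R * dt n) w - x (i%:R * dt n) w
    + lam * sin (x (i%:R * dt n) w) * dt n - sg * step_incr W (dt n) i w) by ring.
  apply: le_trans (ler_normB _ _) _.
  apply: le_trans (lerD (ler_normD _ _) (eps i ni)) _.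
  have h2 : `|lam * sin (x (i%:R * dt n) w) * dt n| <= lam * r.
    rewrite normrM normrM (gtr0_norm lam0) (gtr0_norm dt0); apply: ler_pM.
    - by apply: mulr_ge0; [exact: ltW|].
    - exact: ltW.
    - by rewrite ler_piMr ?(ltW lam0)// sin_max.
    - exact: ltW.
  have h3 : lam * r * dt n <= lam * r by rewrite ler_piMr// ltW.
  by have := dx i ni; lra.
Qed.

End euler_convergence.

Section eventually_mostly.
Context {R : realType} {d : measure_display} {T : measurableType d}.
Variable P : probability T R.

Lemma measurable_forall_lt (n : nat) (Q : nat -> set T) :
  (forall i, (i < n)%N -> measurable (Q i)) ->
  measurable [set w | forall i, (i < n)%N -> Q i w].
Proof.
move=> mQ; rewrite (_ : mkset _ = \bigcap_(i in [set i | (i < n)%N]) Q i) //.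
by apply: bigcap_measurableType => i; exact: mQ.
Qed.

Lemma measurable_norm_le (X : T -> R) (c : R) : measurable_fun setT X ->
  measurable [set w | `|X w| <= c].
Proof.
move=> mX; apply: measurable_set_le; last exact: measurable_cst.
exact: measurableT_comp.
Qed.

(* The limit [h] need not be measurable, since [P] is not assumed complete. *)
Lemma mostly_cvg (h_ : nat -> T -> R) (h : T -> R) :
  (forall n, measurable_fun setT (h_ n)) ->
  {ae P, forall w, h_ ^~ w @ \oo --> h w} ->
  forall c e : R, 0 < c -> 0 < e ->
  \forall n \near \oo, mostly P e (fun w => `|h_ n w - h w| <= c).
Proof.
move=> mh ch c e c0 e0.
pose h' w := fine (limn_esup (fun n => (h_ n w)%:E)).
have mh' : measurable_fun setT h'.
  apply: (measurableT_comp (@fine_measurable R setT measurableT)) => //.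
  by apply: (@measurable_fun_limn_esup _ _ _ setT (fun n w => (h_ n w)%:E)) => n; exact: measurableT_comp.
have hh' : {ae P, forall w, h_ ^~ w @ \oo --> h w /\ h' w = h w}.
  apply: filterS ch => w hw; split => //.
  have /cvg_limn_einf_sup[_ e1] : (h_ n w)%:E @[n --> \oo] --> (h w)%:E.
    exact: (cvg_comp _ _ hw).
  by rewrite /h' e1.
have e20 : 0 < e / 2 by rewrite divr_gt0.
have := @ev_mostly _ _ _ P (fun n => [set w | `|h_ n w - h' w| <= c]) _ e20.
have H1 n : measurable [set w | `|h_ n w - h' w| <= c].
  by apply: measurable_norm_le; exact: measurable_funB.
have H2 : {ae P, forall w, \forall n \near \oo, `|h_ n w - h' w| <= c}.
  apply: filterS hh' => w [+ ->].
  by move/cvgrPdist_le => /(_ _ c0); apply: filterS => n; rewrite distrC.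
move=> /(_ H1 H2); apply: filterS => n Gn.
have := mostlyI Gn (mostly_ae (ltW e20) hh').
by apply: mostly_mono; [lra|move=> w [/= + [_ <-]]].
Qed.

End eventually_mostly.

(** * Scores, averages and left-endpoint sums on one Euler scheme *)

Section euler_approximation.
Context {R : realType} {d : measure_display} {T : measurableType d}.
Local Notation mu := (@lebesgue_measure R).
Variables (P : probability T R) (W x : R -> T -> R) (lam sg Tm : R).
Hypothesis lam0 : 0 < lam.
Hypothesis sg0 : 0 < sg.
Hypothesis Tm0 : 0 < Tm.
Hypothesis bmW : brownian_motion P W.
Hypothesis mx : forall t, 0 <= t -> measurable_fun setT (x t).
Hypothesis ix : indep_rv_sigma P (x 0) (sigma_gen W `[0, +oo[).
Hypothesis cx : {ae P, forall w, {within `[0, +oo[, continuous (x ^~ w)}}.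
Hypothesis ex : {ae P, forall w, forall t, 0 <= t -> x t w = x 0 w
  + \int[mu]_(s in `[0, t]) (- lam * sin (x s w)) + sg * W t w}.

Let dt n := Tm / n%:R.
Let Y n := euler lam sg W (x 0) (dt n).
Let Yem n b := euler_mean lam sg W (x 0) (dt n) 2 b n.

Let dt0 n : 0 < dt n.+1.
Proof. by rewrite divr_gt0. Qed.

Let ndt n : n.+1%:R * dt n.+1 = Tm.
Proof. by rewrite mulrCA divff ?mulr1// pnatr_eq0. Qed.

Let sumdt n : \sum_(i < n.+1) dt n.+1 = Tm.
Proof. by rewrite sumr_const card_ord -[LHS]mulr_natl ndt. Qed.

Let mY n i : measurable_fun setT (Y n.+1 i).
Proof. by apply: (measurable_euler lam sg bmW) => //; exact: mx. Qed.

Let mstep n i : measurable_fun setT (step_incr W (dt n.+1) i).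
Proof.
by case: bmW => mW _ _ _ _; apply: measurable_funB; apply: mW; exact: grid_ge0.
Qed.

Let mxi n i : measurable_fun setT (x (i%:R * dt n.+1)).
Proof. by apply: mx; exact: grid_ge0. Qed.

Lemma euler_close_mostly (q e : R) : 0 < q -> 0 < e ->
  \forall n \near \oo, mostly P e (fun w => euler_close lam sg Tm W x w q n.+1).
Proof.
move=> q0 e0; apply: (@ev_mostly _ _ _ P (fun n => [set w | euler_close lam sg Tm W x w q n.+1])) => //.
- move=> n; rewrite (_ : mkset _ =
    [set w | forall i, (i < n.+2)%N -> `|x (i%:R * dt n.+1) w - Y n.+1 i w| <= q] `&`
    ([set w | forall i, (i < n.+1)%N -> `|x (i.+1%:R * dt n.+1) w - x (i%:R * dt n.+1) w| <= q] `&`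
    ([set w | forall i, (i < n.+1)%N -> `|(x (i.+1%:R * dt n.+1) w - x (i%:R * dt n.+1) w) -
        (Y n.+1 i.+1 w - Y n.+1 i w)| <= q * dt n.+1] `&`
    [set w | forall i, (i < n.+1)%N -> `|step_incr W (dt n.+1) i w| <= q]))); last first.
    by apply/seteqP; split => w; [case|case=> ? [? [? ?]]; split].
  do !apply: measurableI; apply: measurable_forall_lt => i _; apply: measurable_norm_le.
  + exact: measurable_funB.
  + exact: measurable_funB.
  + by apply: measurable_funB; exact: measurable_funB.
  + exact: mstep.
- apply: filterS2 cx ex => w cw ew.
  have [N hN] := euler_converges lam0 sg0 Tm0 cw ew q0.
  exists N => // n /= Nn; have [] := hN n.+1 _ _ => //.
  exact: leq_trans Nn _.
Qed.

(** Squared increments are replaced by the bounded variables 4 (1 - cos), whose mean 4 (1 - exp (-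
    dt / 2)) is at most 2 dt; Markov's inequality then bounds their sum independently of [n]. *)
Lemma quadratic_variation_mostly (e : R) : 0 < e -> forall n,
  mostly P e (fun w => \sum_(i < n.+1) 4 * (1 - cos (step_incr W (dt n.+1) i w)) <= 2 * Tm / e).
Proof.
move=> e0 n.
pose V w := \sum_(i < n.+1) 4 * (1 - cos (step_incr W (dt n.+1) i w)).
have b1 i : bmf (fun w => cos (step_incr W (dt n.+1) i w)) by apply: bmf_cos.
have b2 i : bmf (fun w => 1 - cos (step_incr W (dt n.+1) i w)).
  by apply: bmfB => //; exact: bmf_cst.
have b3 i : bmf (fun w => 4 * (1 - cos (step_incr W (dt n.+1) i w))) by exact: bmfZ.
have bV : bmf V by apply: (@bmf_sum _ _ _ _ (fun i w => 4 * (1 - cos (step_incr W (dt n.+1) i w)))).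
have V0 w : 0 <= V w.
  by apply: sumr_ge0 => i _; rewrite mulr_ge0// subr_ge0 cos_le1.
have EV : \int[P]_w `|V w| <= 2 * Tm.
  under eq_Rintegral do rewrite ger0_norm//.
  rewrite (Ex_sum P (X := fun i w => 4 * (1 - cos (step_incr W (dt n.+1) i w))))//.
  have -> : 2 * Tm = \sum_(i < n.+1) 2 * dt n.+1.
    by rewrite sumr_const card_ord -mulr_natl -(ndt n); ring.
  apply: ler_sum => i _.
  rewrite ExZ// ExB ?Ex_cst//; last exact: bmf_cst.
  have bd1 : exists M : R, forall w : T, `|1 : R| <= M by exists 1 => _; rewrite normr1.
  have := brownian_freezing bmW (mx (lexx 0)) ix 0 (grid_ge0 Tm0 n.+1 i) (_ : i%:R * dt n.+1 < i.+1%:R * dt n.+1)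
    (@adapted_cst _ _ _ _ (1:R)) (@adapted_cst _ _ _ _ (1:R)) bd1.
  rewrite cos0 mul1r ltr_pM2r// ltr_nat ltnSn => /(_ isT).
  rewrite expr1n mulr1 -mulrBl -natrB// subSnn mul1r.
  under eq_Rintegral do rewrite !mul1r addr0.
  under [in X in _ = X]eq_Rintegral do rewrite mul1r.
  rewrite Ex_cst => ->.
  have := expR_ge1Dx (- (dt n.+1 / 2)); lra.
have A0 : 0 < 2 * Tm / e by rewrite divr_gt0// mulr_gt0.
have := mostly_markov bV A0 (_ : \int[P]_w `|V w| <= 2 * Tm / e * e).
rewrite divfK ?gt_eqF// => /(_ EV); apply: mostly_mono => // w.
by rewrite ger0_norm// => /ltW.
Qed.

Let lsum n a w := \sum_(i < n.+1) - sin (x (i%:R * dt n.+1) w + a) *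
  (x (i.+1%:R * dt n.+1) w - x (i%:R * dt n.+1) w).

Let ysum n a w := \sum_(i < n.+1) - sin (Y n.+1 i w + a) * (Y n.+1 i.+1 w - Y n.+1 i w).

Lemma left_sum_euler (a c e : R) : 0 < c -> 0 < e ->
  \forall n \near \oo, mostly P e (fun w => `|lsum n a w - ysum n a w| <= c).
Proof.
move=> c0 e0.
have e20 : 0 < e / 2 by rewrite divr_gt0.
(* [A1] bounds the sum of squared increments of the scheme and [A] that of the process, outside the
   exceptional set of the quadratic variation. The bound 1 / 4 in [q] is the range of
   [sqr_le_cos]. *)
pose A1 := 2 * lam ^+ 2 * Tm + 2 * sg ^+ 2 * (2 * Tm / (e / 2)).
pose A := 2 * A1 + 2 * Tm.
have A10 : 0 <= A1.
  apply: addr_ge0; apply: mulr_ge0; [|exact: ltW| |].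
  - by apply: mulr_ge0; [|exact: sqr_ge0].
  - by apply: mulr_ge0; [|exact: sqr_ge0].
  - by apply: divr_ge0; [apply: mulr_ge0 => //|]; exact: ltW.
have K0 : 0 < 1 + 5 * A + 2 * Tm by rewrite /A; move: Tm0; lra.
pose q := Num.min (1 / 4) (c / (1 + 5 * A + 2 * Tm)).
have q0 : 0 < q by rewrite lt_min divr_gt0// divr_gt0.
have q4 : q <= 1 / 4 by rewrite ge_min lexx.
have qc : q * (1 + 5 * A + 2 * Tm) <= c by rewrite -ler_pdivlMr// ge_min lexx orbT.
have ev : \forall n \near \oo, dt n.+1 <= 1.
  exists (Num.truncn Tm) => // n /= Nn.
  rewrite ler_pdivrMr ?ltr0n// mul1r; apply: ltW.
  by apply: lt_le_trans (truncnS_gt _) _; rewrite ler_nat ltnS.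
have := euler_close_mostly q0 e20.
apply: filterS2 ev => n dt1 hn.
have := mostlyI hn (quadratic_variation_mostly e20 n).
apply: mostly_mono; first lra.
move=> w [[c1 c2 c3 c4] QV].
have dn0 := dt0 n.
have d2 : dt n.+1 ^+ 2 <= dt n.+1 by rewrite expr2 ler_piMl// ltW.
have stp : \sum_(i < n.+1) step_incr W (dt n.+1) i w ^+ 2 <= 2 * Tm / (e / 2).
  apply: le_trans QV; apply: ler_sum => i _; apply: sqr_le_cos.
  by apply: le_trans q4; exact: c4.
have sY : \sum_(i < n.+1) (Y n.+1 i.+1 w - Y n.+1 i w) ^+ 2 <= A1.
  rewrite /A1 -[X in _ * X + _](sumdt n) !mulr_sumr.
  apply: (@le_trans _ _ (\sum_(i < n.+1) (2 * lam ^+ 2 * dt n.+1 + 2 * sg ^+ 2 * step_incr W (dt n.+1) i w ^+ 2))).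
    apply: ler_sum => i _; rewrite /Y/= -/(Y n.+1 i w).
    set s1 := sin _; set s2 := step_incr _ _ _ _.
    have -> : Y n.+1 i w - lam * s1 * dt n.+1 + sg * s2 - Y n.+1 i w = sg * s2 - lam * s1 * dt n.+1 by ring.
    have h1 : (lam * s1 * dt n.+1) ^+ 2 <= lam ^+ 2 * dt n.+1.
      rewrite exprMn [X in X * _]exprMn -mulrA ler_wpM2l ?sqr_ge0//.
      apply: le_trans d2; rewrite ler_piMl ?sqr_ge0//; exact: sqr_sin_le1.
    have := sqr_ge0 (sg * s2 + lam * s1 * dt n.+1).
    move: h1; set u1 := lam * s1 * dt n.+1; set u2 := sg * s2.
    have -> : 2 * sg ^+ 2 * s2 ^+ 2 = 2 * u2 ^+ 2 by rewrite /u2; ring.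
    nra.
  rewrite big_split/= lerD2l -mulr_sumr; apply: ler_wpM2l => //.
  by apply: mulr_ge0 => //; exact: sqr_ge0.
have sX : \sum_(i < n.+1) (x (i.+1%:R * dt n.+1) w - x (i%:R * dt n.+1) w) ^+ 2 <= A.
  apply: (@le_trans _ _ (\sum_(i < n.+1) (2 * (Y n.+1 i.+1 w - Y n.+1 i w) ^+ 2 + 2 * dt n.+1))).
    apply: ler_sum => i _; have := c3 i (ltn_ord i).
    set u1 := x _ w - x _ w; set u2 := _ - Y _ _ _ => h.
    have h1 : (u1 - u2) ^+ 2 <= dt n.+1.
      rewrite -real_normK ?num_real//; apply: le_trans d2; rewrite lerXn2r// ?nnegrE ?normr_ge0 ?(ltW dn0)//.
      apply: le_trans h _; rewrite ler_piMl ?(ltW dn0)//; lra.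
    have := sqr_ge0 (u1 - 2 * u2); nra.
  have s2 : \sum_(i < n.+1) 2 * dt n.+1 = 2 * Tm by rewrite -mulr_sumr sumdt.
  rewrite big_split/= s2 /A lerD2r -mulr_sumr; apply: ler_wpM2l => //; exact: sY.
have := @left_sum_compare R (fun i => x (i%:R * dt n.+1) w) (fun i => Y n.+1 i w) n.+1 a q A Tm.
move/(_ _ (ltW q0) _ c1 c2 _ sX _ _) => h.
apply: le_trans (h _ _ _ _ _) qc.
- by rewrite mul0r.
- by lra.
- move=> i ni; have := c3 i ni; have := c2 i ni.
  set u1 := x _ w - x _ w; set u2 := _ - Y _ _ _ => h1 h2.
  have -> : u2 = u1 - (u1 - u2) by ring.
  apply: le_trans (ler_normB _ _) _.
  have h3 : q * dt n.+1 <= q by rewrite ler_piMr// ltW.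
  rewrite -/(dt n.+1) in h2.
  by apply: le_trans (lerD h1 h2) _; lra.
- by apply: le_trans sY _; rewrite /A; move: Tm0; lra.
- apply: (@le_trans _ _ (\sum_(i < n.+1) dt n.+1)); last by rewrite sumdt.
  apply: ler_sum => i _; apply: le_trans (c3 i (ltn_ord i)) _.
  rewrite ler_piMl ?(ltW dn0)//; lra.
Qed.

Lemma sin_mul_shift (y a : R) : sin (y + a) * sin y = (cos a - cos (2 * y + a)) / 2.
Proof.
have -> : 2 * y + a = y + (y + a) by ring.
have -> : cos a = cos ((y + a) - y) by congr cos; ring.
by rewrite cosB (cosD y (y + a)); field.
Qed.

(** An increment of the scheme is drift plus noise. The noise part is the score, and [sin_mul_shift]
    turns the drift part into a second harmonic. *)
Lemma ysum_score n a w : ysum n a w = lam / 2 * (Tm * (cos a - Yem n.+1 a w)) +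
  sg * score lam sg W (x 0) (dt n.+1) a n.+1 w.
Proof.
rewrite /Yem /euler_mean ndt mulrBr [Tm * (_ / _)]mulrC divfK ?gt_eqF//.
have -> : Tm * cos a = \sum_(i < n.+1) cos a * dt n.+1.
  by rewrite sumr_const card_ord -mulr_natl -(ndt n); ring.
rewrite -sumrB /score !mulr_sumr -big_split/=.
apply: eq_bigr => i _; rewrite /Y/= -/(Y n.+1 i w).
set y := Y n.+1 i w.
have := sin_mul_shift y a; set s1 := sin (y + a); set s2 := sin y.
set c1 := cos _; set c2 := cos _ => h.
have -> : c1 * dt n.+1 - c2 * dt n.+1 = (c1 - c2) / 2 * 2 * dt n.+1 by field.
by rewrite -h; field.
Qed.

Lemma info_euler_mean n a w : info lam sg W (x 0) (dt n.+1) a n.+1 w =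
  Tm / 2 * (1 - Yem n.+1 (2 * a) w).
Proof.
rewrite /Yem /euler_mean ndt mulrBr mulr1.
have {1}-> : Tm / 2 = \sum_(i < n.+1) dt n.+1 / 2.
  by rewrite -mulr_suml sumdt.
set S := \sum_(i < n.+1) cos _ * _.
have -> : Tm / 2 * (S / Tm) = 2^-1 * S by field; rewrite gt_eqF.
rewrite mulr_sumr -sumrB; apply: eq_bigr => i _.
rewrite -/(Y n.+1) -/(Y n.+1 i w); set y := Y n.+1 i w.
have := sin_mul_shift (y + a) 0; rewrite addr0 cos0.
have -> : 2 * (y + a) + 0 = 2 * y + 2 * a by ring.
by rewrite -expr2 => ->; field.
Qed.

(** This is [clt_bound] at the frequency u / sqrt T, for which the horizon disappears from the
    exponent. The variance [v] is (1 - be) / 2 for [a = 0] and (1 + be) / 2 for [a = - (pi / 2)]. *)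
Lemma score_char n (a v be eta : R) : - 1 <= be <= 1 -> v = (1 - cos (2 * a) * be) / 2 ->
  \int[P]_w `|Yem n.+1 (2 * a) w - cos (2 * a) * be| <= eta ->
  forall u b, `|\int[P]_w cos (u * (score lam sg W (x 0) (dt n.+1) a n.+1 w / Num.sqrt Tm) + b)
    - cos b * expR (- (u ^+ 2 / 2 * v))| <= u ^+ 2 / 4 * expR (u ^+ 2 / 2) * eta.
Proof.
move=> hbe ev hE u b.
pose z := u / Num.sqrt Tm.
have sT0 : 0 < Num.sqrt Tm by rewrite sqrtr_gt0.
have sT2 : Num.sqrt Tm ^+ 2 = Tm by rewrite sqr_sqrtr// ltW.
have uT : z ^+ 2 * Tm = u ^+ 2.
  by rewrite /z exprMn exprVn sT2 mulfVK// gt_eqF.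
have cbe : - 1 <= cos (2 * a) * be <= 1.
  have := cos_le1 (2 * a); have := cos_geN1 (2 * a).
  by move: hbe => /andP[? ?] ? ?; apply/andP; split; nra.
have v01 : 0 <= v <= 1 by move: cbe => /andP[? ?]; apply/andP; split; rewrite ev; lra.
have vT : 0 <= Tm * v <= n.+1%:R * dt n.+1.
  move: v01 => /andP[? ?]; rewrite ndt mulr_ge0//= ?(ltW Tm0)//.
  by rewrite ger_pMr.
have := clt_bound lam sg bmW (mx (lexx 0)) ix (dt0 n) z a b vT.
have -> : z ^+ 2 / 2 * (Tm * v) = u ^+ 2 / 2 * v by rewrite -uT; field.
rewrite ndt.
have -> : z ^+ 2 / 2 * Tm = u ^+ 2 / 2 by rewrite -uT; field.
have -> : \int[P]_w `|info lam sg W (x 0) (dt n.+1) a n.+1 w - Tm * v| =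
    Tm / 2 * \int[P]_w `|Yem n.+1 (2 * a) w - cos (2 * a) * be|.
  rewrite -ExZ; last first.
    apply: bmf_norm; apply: bmfB; last exact: bmf_cst.
    exact: (bmf_euler_mean bmW (mx (lexx 0))).
  apply: eq_Rintegral => w _; rewrite info_euler_mean ev.
  have T2 : 0 <= Tm / 2 by rewrite divr_ge0// ltW.
  set em := Yem _ _ _; set cb := cos _ * be.
  have -> : Tm / 2 * (1 - em) - Tm * ((1 - cb) / 2) = - (Tm / 2 * (em - cb)) by field.
  by rewrite normrN normrM (ger0_norm T2).
set I0 := \int[P]_w cos _; set I1 := \int[P]_w _ in hE *.
move=> h.
have -> : \int[P]_w cos (u * (score lam sg W (x 0) (dt n.+1) a n.+1 w / Num.sqrt Tm) + b) = I0.
  by apply: eq_Rintegral => w _; rewrite /z mulrCA mulrC.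
apply: le_trans h _.
have -> : z ^+ 2 / 2 * expR (u ^+ 2 / 2) * (Tm / 2 * I1) =
  u ^+ 2 / 4 * expR (u ^+ 2 / 2) * I1.
  by rewrite -uT; field.
by rewrite ler_wpM2l// mulr_ge0 ?expR_ge0// divr_ge0// sqr_ge0.
Qed.

Lemma euler_mean_cvg b : {ae P, forall w,
  (fun n => Tm * Yem n.+1 b w) @ \oo --> \int[mu]_(s in `[0, Tm]) cos (2 * x s w + b)}.
Proof.
apply: filterS2 cx ex => w cw ew; apply/cvgrPdist_le => c c0.
pose q := c / (4 * Tm).
have q0 : 0 < q by rewrite divr_gt0// mulr_gt0.
have qT : 4 * q * Tm = c by rewrite /q; field; rewrite gt_eqF.
have [N hN] := euler_converges lam0 sg0 Tm0 cw ew q0.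
exists N => // n /= Nn; have [[h1 _ _ _] h2] := hN n.+1 (leq_trans Nn (leqnSn n)) isT.
have cf : {within `[0, Tm], continuous (fun s => cos (2 * x s w + b))}.
  have cwT : {within `[0, Tm], continuous (x ^~ w)}.
    by apply: continuous_subspaceW cw => t; rewrite /= !in_itv/= => /andP[->].
  pose g (y : R) : R := cos (2 * y + b).
  suff cg : continuous g.
    have h := @within_postcomp _ _ (x ^~ w) g cwT cg.
    exact: h.
  move=> y; apply: (@continuous_comp _ _ _ (fun y : R => 2 * y + b) cos); last exact: continuous_cos.
  by apply: cvgD; [apply: cvgMl_tmp; exact: cvg_id|exact: cvg_cst].
have H k : (k <= n.+1)%N -> `|\int[mu]_(s in `[0, k%:R * dt n.+1]) cos (2 * x s w + b) -
    \sum_(i < k) cos (2 * Y n.+1 i w + b) * dt n.+1| <= 4 * q * (k%:R * dt n.+1).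
  elim: k => [_|k IH kn].
    by rewrite big_ord0 !mul0r mulr0 set_itv1 Rintegral_set1 subrr normr0.
  have tS : k.+1%:R * dt n.+1 = k%:R * dt n.+1 + dt n.+1 by rewrite -natr1 mulrDl mul1r.
  have := @Rintegral_increment R (fun s => cos (2 * x s w + b)) Tm (k%:R * dt n.+1) (k.+1%:R * dt n.+1)
    (cos (2 * Y n.+1 k w + b)) (4 * q) cf (grid_ge0 Tm0 n.+1 k) _ (grid_le Tm0 kn) _.
  rewrite {1}tS lerDl => /(_ (ltW (dt0 n))).
  have e : k.+1%:R * dt n.+1 - k%:R * dt n.+1 = dt n.+1 by rewrite tS addrAC subrr add0r.
  rewrite e => h; rewrite big_ord_recr/= [in leRHS]tS mulrDr.
  have := IH (ltnW kn); move: h.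
  set i1 := \int[_]_(_ in _) _; set i2 := \int[_]_(_ in _) _; set s1 := \sum_(i < k) _.
  set c1 := cos _ => h h'.
  have -> : i1 - (s1 + c1 * dt n.+1) = (i2 - s1) + (i1 - i2 - c1 * dt n.+1) by ring.
  apply: le_trans (ler_normD _ _) _; apply: lerD => //; apply: h => s hs.
  apply: le_trans (cos_lip _ _) _.
  have -> : 2 * x s w + b - (2 * Y n.+1 k w + b) = 2 * ((x s w - x (k%:R * dt n.+1) w) +
    (x (k%:R * dt n.+1) w - Y n.+1 k w)) by ring.
  rewrite normrM ger0_norm//.
  have := ler_normD (x s w - x (k%:R * dt n.+1) w) (x (k%:R * dt n.+1) w - Y n.+1 k w).
  have := h1 k (ltnW kn); have := h2 k s kn hs.
  by rewrite -/(Y n.+1); lra.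
have := H n.+1 (leqnn _); rewrite /Yem /euler_mean ndt qT.
by rewrite [Tm * (_ / _)]mulrC divfK ?gt_eqF.
Qed.

(* [X1] and [X2] are the normalized scores of one Euler scheme of small enough step;
   [J1] and [J2] stand for the Ito integrals of - sin x and cos x against x. *)
Lemma euler_approximation (be eta : R) (J1 J2 : T -> R) : - 1 <= be <= 1 -> 0 < eta ->
  (forall n b, dt n.+1 <= 1 -> Tm * dt n.+1 <= 1 ->
    \int[P]_w `|Yem n.+1 b w - cos b * be| <= Num.min eta (eta / 2 * (eta / 8))) ->
  (forall c e : R, 0 < c -> 0 < e -> \forall n \near \oo,
     mostly P e (fun w => `|lsum n 0 w - J1 w| <= c)) ->
  (forall c e : R, 0 < c -> 0 < e -> \forall n \near \oo,
     mostly P e (fun w => `|lsum n (- (pi / 2)) w - J2 w| <= c)) ->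
  exists X1 X2 : T -> R, [/\ measurable_fun setT X1, measurable_fun setT X2,
    forall u b, `|\int[P]_w cos (u * X1 w + b) - cos b * expR (- (u ^+ 2 / 2 * ((1 - be) / 2)))|
      <= u ^+ 2 / 4 * expR (u ^+ 2 / 2) * eta,
    forall u b, `|\int[P]_w cos (u * X2 w + b) - cos b * expR (- (u ^+ 2 / 2 * ((1 + be) / 2)))|
      <= u ^+ 2 / 4 * expR (u ^+ 2 / 2) * eta &
    mostly P eta (fun w =>
      forall C S, C = \int[mu]_(s in `[0, Tm]) cos (2 * x s w) ->
      S = \int[mu]_(s in `[0, Tm]) cos (2 * x s w - pi / 2) -> [/\ `|C / Tm - be| <= eta, `|S / Tm| <= eta,
        `|J1 w - lam / 2 * (Tm - C) - sg * (Num.sqrt Tm * X1 w)| <= eta &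
        `|J2 w + lam / 2 * S - sg * (Num.sqrt Tm * X2 w)| <= eta])].
Proof.
move=> hbe eta0 LLN hJ1 hJ2.
(* The first bound is for the averages, which are divided by [Tm]; the second for the Ito integrals,
   where the tolerance [c] enters twice and once more with factor lam / 2. *)
pose c := Num.min (eta / 2 * Tm) (eta / (2 + lam)).
have lam2 : 0 < 2 + lam by rewrite addr_gt0.
have c0 : 0 < c by rewrite lt_min mulr_gt0 ?divr_gt0.
have cT : c <= eta / 2 * Tm by rewrite ge_min lexx.
have cl : c * (2 + lam) <= eta by rewrite -ler_pdivlMr// ge_min lexx orbT.
(* Eight exceptional sets are united below: two each for the Ito integrals, the comparison with the
   scheme, the Riemann sums and the law of large numbers. *)
pose e := eta / 8.
have e0 : 0 < e by rewrite divr_gt0.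
have mem b n : measurable_fun setT (fun w => Tm * Yem n.+1 b w).
  apply: measurable_funM => //.
  exact: (bmf_euler_mean bmW (mx (lexx 0)) lam sg b (dt0 n) (ltn0Sn n) 2).1.
have evdt (r : R) : 0 < r -> \forall n \near \oo, dt n.+1 <= r.
  move=> r0; exists (Num.truncn (Tm / r)) => // n /= Nn.
  rewrite ler_pdivrMr ?ltr0n// mulrC -ler_pdivrMr//; apply: ltW.
  by apply: lt_le_trans (truncnS_gt _) _; rewrite ler_nat ltnS.
near \oo => n.
have hdt : dt n.+1 <= 1 by near: n; exact: evdt.
have hTdt : Tm * dt n.+1 <= 1.
  rewrite mulrC -ler_pdivlMr// div1r; near: n; apply: evdt; rewrite invr_gt0//.
have E1 : mostly P e (fun w => `|lsum n 0 w - J1 w| <= c) by near: n; exact: hJ1.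
have E2 : mostly P e (fun w => `|lsum n (- (pi / 2)) w - J2 w| <= c) by near: n; exact: hJ2.
have E3 : mostly P e (fun w => `|lsum n 0 w - ysum n 0 w| <= c) by near: n; exact: left_sum_euler.
have E4 : mostly P e (fun w => `|lsum n (- (pi / 2)) w - ysum n (- (pi / 2)) w| <= c).
  by near: n; exact: left_sum_euler.
have E5 : mostly P e (fun w => `|Tm * Yem n.+1 0 w - \int[mu]_(s in `[0, Tm]) cos (2 * x s w + 0)| <= c).
  near: n; exact: (mostly_cvg (mem 0) (euler_mean_cvg 0)).
have E6 : mostly P e (fun w => `|Tm * Yem n.+1 (- (pi / 2)) w -
    \int[mu]_(s in `[0, Tm]) cos (2 * x s w - pi / 2)| <= c).
  near: n; exact: (mostly_cvg (mem _) (euler_mean_cvg _)).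
have LLN' b : mostly P e (fun w => `|Yem n.+1 b w - cos b * be| < eta / 2).
  apply: mostly_markov; last 2 first.
  - by rewrite divr_gt0.
  - by apply: le_trans (LLN n b hdt hTdt) _; rewrite ge_min lexx orbT.
  apply: bmfB; last exact: bmf_cst.
  exact: (bmf_euler_mean bmW (mx (lexx 0)) lam sg b (dt0 n) (ltn0Sn n) 2).
have sT0 : 0 < Num.sqrt Tm by rewrite sqrtr_gt0.
have chr a v := @score_char n a v be eta hbe.
have LLNe b : \int[P]_w `|Yem n.+1 b w - cos b * be| <= eta.
  by apply: le_trans (LLN n b hdt hTdt) _; rewrite ge_min lexx.
pose X a w := score lam sg W (x 0) (dt n.+1) a n.+1 w / Num.sqrt Tm.
have mX a : measurable_fun setT (X a).
  apply: measurable_funM => //; apply: (measurable_score lam sg bmW) => //; exact: mx.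
exists (X 0), (X (- (pi / 2))); split.
- exact: mX.
- exact: mX.
- by apply: chr; [rewrite mulr0 cos0 mul1r|exact: LLNe].
- apply: chr; last exact: LLNe.
  have -> : 2 * - (pi / 2) = - pi :> R by field.
  by rewrite cosN cospi; field.
have := mostlyI (mostlyI (mostlyI E1 E2) (mostlyI E3 E4))
  (mostlyI (mostlyI E5 E6) (mostlyI (LLN' 0) (LLN' (- (pi / 2))))).
apply: mostly_mono; first by rewrite /e; lra.
move=> w [[[h1 h2] [h3 h4]] [[h5 h6] [h7 h8]]] C S eC eS.
have XE a : sg * (Num.sqrt Tm * X a w) = sg * score lam sg W (x 0) (dt n.+1) a n.+1 w.
  by rewrite /X; field; rewrite gt_eqF.
move: h5 h7 h3; rewrite cos0 mul1r ysum_score cos0.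
under eq_Rintegral do rewrite addr0.
rewrite -eC => h5 h7 h3; move: h5 h7 h3 h6; rewrite -eS => h5 h7 h3 h6.
move: h8 h4; rewrite ysum_score cosN cos_pihalf !mul0r !sub0r subr0.
rewrite !XE; move: h1 h2 h3 h5 h6 h7; set s1 := score _ _ _ _ _ _ _ _; set s2 := score _ _ _ _ _ _ _ _.
set y1 := Yem _ _ _; set y2 := Yem _ _ _ => h1 h2 h3 h5 h6 h7 h8 h4.
have bnd (z y b : R) : `|Tm * y - z| <= c -> `|y - b| < eta / 2 -> `|z / Tm - b| <= eta.
  move=> k1 k2.
  have -> : z / Tm - b = (y - b) - (Tm * y - z) / Tm by field; rewrite gt_eqF.
  apply: le_trans (ler_normB _ _) _.
  have k3 : `|(Tm * y - z) / Tm| <= eta / 2.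
    by rewrite normrM normfV (gtr0_norm Tm0) ler_pdivrMr// (le_trans k1).
  by apply: le_trans (lerD (ltW k2) k3) _; rewrite -splitr.
split.
- exact: bnd h5 h7.
- by rewrite -[X in `|X|]subr0; apply: bnd h6 _; rewrite subr0.
- have k1 : `|lam / 2 * (Tm * y1 - C)| <= lam / 2 * c.
    by rewrite normrM gtr0_norm ?divr_gt0// ler_pM2l ?divr_gt0.
  move: h1 h3 k1; rewrite !ler_norml => /andP[a1 a2] /andP[a3 a4] /andP[a5 a6].
  have lc := mulr_ge0 (ltW lam0) (ltW c0); clear - a1 a2 a3 a4 a5 a6 lc cl.
  by apply/andP; split; lra.
- have k1 : `|lam / 2 * (Tm * y2 - S)| <= lam / 2 * c.
    by rewrite normrM gtr0_norm ?divr_gt0// ler_pM2l ?divr_gt0.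
  move: h2 h4 k1; rewrite !ler_norml => /andP[a1 a2] /andP[a3 a4] /andP[a5 a6].
  have lc := mulr_ge0 (ltW lam0) (ltW c0); clear - a1 a2 a3 a4 a5 a6 lc cl.
  by apply/andP; split; lra.
Unshelve. all: by end_near. Qed.

End euler_approximation.

(** * The likelihood equations *)

Section maximum_likelihood_equations.
Context {R : realType}.
Implicit Types (f : R * R -> R) (q : R * R).

Lemma cos_sinD2pi (x : R) (k : int) :
  cos (x + 2 * pi * k%:~R) = cos x /\ sin (x + 2 * pi * k%:~R) = sin x.
Proof.
have e : 2 * pi = pi *+ 2 :> R by rewrite mulr_natl.
have H (y : R) (n : nat) : cos (y + 2 * pi * n%:R) = cos y /\ sin (y + 2 * pi * n%:R) = sin y.
  by rewrite mulr_natr e; split; [apply: periodicn; exact: cosD2pi|apply: periodicn; exact: sinD2pi].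
case: (intP k) => [|n|n]; first by rewrite mulr0 addr0.
- exact: H.
- have [h1 h2] := H (x + 2 * pi * (- n.+1%:Z)%:~R) n.+1.
  have e2 : x + 2 * pi * (- n.+1%:Z)%:~R + 2 * pi * n.+1%:R = x by rewrite rmorphN/=; ring.
  by rewrite -h1 -h2 e2.
Qed.

Lemma cos_sin_angle (x : R) : cos (angle x) = cos x /\ sin (angle x) = sin x.
Proof. by have [_ [k ->]] := angleP x; exact: cos_sinD2pi. Qed.

Lemma polar_coordinates (a c mu : R) : 0 < a ->
  exists2 q, param_space q & q.1 * cos (q.2 - mu) = a /\ q.1 * sin (q.2 - mu) = c.
Proof.
move=> a0; pose t := atan (c / a).
have ct : 0 < cos t by apply: cos_gt0_pihalf; rewrite atan_gtNpi2 atan_ltpi2.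
have tt : sin t = c / a * cos t by rewrite -[c / a]atanK /tan divfK ?gt_eqF.
have p2 : 0 < 2 * pi :> R by rewrite mulr_gt0// pi_gt0.
pose k := Num.floor ((t + mu) / (2 * pi)).
exists (a / cos t, t + mu + 2 * pi * (- k)%:~R).
  split; first by rewrite divr_gt0.
  have := floor_itv ((t + mu) / (2 * pi)).
  rewrite -/k ler_pdivlMr// ltr_pdivrMr// rmorphN/= rmorphD/= => /andP[h1 h2].
  by apply/andP; split; lra.
rewrite /=; have -> : t + mu + 2 * pi * (- k)%:~R - mu = t + 2 * pi * (- k)%:~R by ring.
have [-> ->] := cos_sinD2pi t (- k); rewrite tt; split.
  by rewrite divfK// gt_eqF.
by field; rewrite !gt_eqF.
Qed.

(** Completing the square at the stationary point (a, c) leaves a positive definite form. The point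
    corresponds to a parameter by [polar_coordinates], so a maximizer exists and all maximizers
    share its Cartesian coordinates. *)
Lemma quadratic_maximizer (m11 m12 m22 B1 B2 a c mu k : R) f :
  0 < k -> 0 < m11 -> m12 ^+ 2 < m11 * m22 -> 0 < a ->
  m11 * a - m12 * c = B1 -> - m12 * a + m22 * c = B2 ->
  (forall q, param_space q -> let x := q.1 * cos (q.2 - mu) in let y := q.1 * sin (q.2 - mu) in
    f q = k * (x * B1 + y * B2 - (m11 * x ^+ 2 - 2 * m12 * (x * y) + m22 * y ^+ 2) / 2)) ->
  (exists q, maximizer f q) /\
  forall q, maximizer f q -> q.1 * cos (q.2 - mu) = a /\ q.1 * sin (q.2 - mu) = c.
Proof.
move=> k0 m110 D a0 e1 e2 fE.
pose Q x y := (m11 * x ^+ 2 - 2 * m12 * (x * y) + m22 * y ^+ 2) / 2.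
pose G x y := x * B1 + y * B2 - Q x y.
have GE x y : G x y = G a c - Q (x - a) (y - c) by rewrite /G /Q -e1 -e2; field.
have QE x y : m11 * Q x y = ((m11 * x - m12 * y) ^+ 2 + (m11 * m22 - m12 ^+ 2) * y ^+ 2) / 2.
  by rewrite /Q; field.
have D0 : 0 < m11 * m22 - m12 ^+ 2 by rewrite subr_gt0.
have Q0 x y : 0 <= Q x y.
  by rewrite -(pmulr_rge0 _ m110) QE divr_ge0// addr_ge0 ?sqr_ge0// mulr_ge0 ?sqr_ge0// ltW.
have Q00 x y : Q x y <= 0 -> x = 0 /\ y = 0.
  move=> h; have {}h : Q x y = 0 by apply/eqP; rewrite eq_le h Q0.
  have := QE x y; rewrite h mulr0 => /esym.
  have h1 := sqr_ge0 (m11 * x - m12 * y); have h2 : 0 <= (m11 * m22 - m12 ^+ 2) * y ^+ 2.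
    by rewrite mulr_ge0 ?sqr_ge0// ltW.
  move=> h3; have : (m11 * m22 - m12 ^+ 2) * y ^+ 2 = 0 by lra.
  move/eqP; rewrite mulf_eq0 gt_eqF//= sqrf_eq0 => /eqP y0; split => //.
  have : (m11 * x - m12 * y) ^+ 2 = 0 by lra.
  by move/eqP; rewrite sqrf_eq0 y0 mulr0 subr0 mulf_eq0 gt_eqF//= => /eqP.
have [q0 pq0 [q0a q0c]] := polar_coordinates c mu a0.
have fG q : param_space q -> f q = k * (G a c - Q (q.1 * cos (q.2 - mu) - a) (q.1 * sin (q.2 - mu) - c)).
  by move=> pq; rewrite -GE fE.
have fq0 : f q0 = k * G a c.
  by rewrite fG// q0a q0c !subrr /Q; field.
split.
  exists q0; split => // r pr; rewrite fq0 fG// ler_pM2l//.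
  by have := Q0 (r.1 * cos (r.2 - mu) - a) (r.1 * sin (r.2 - mu) - c); lra.
move=> q [pq mq]; have := mq _ pq0; rewrite fq0 fG// ler_pM2l// => h.
have [] := Q00 (q.1 * cos (q.2 - mu) - a) (q.1 * sin (q.2 - mu) - c); first lra.
by move=> /subr0_eq -> /subr0_eq ->.
Qed.

(** The length error comes from (r - a) (r + a) = c^2. For the angle, c / r = sin t and |t - sin t|
    <= t^2 <= 4 (1 - cos t), once t is known to be small. *)
Lemma polar_expansion (lam r a c t : R) : 0 < lam -> lam / 2 <= a -> 0 < r ->
  r * cos t = a -> r * sin t = c -> - pi < t <= pi -> 128 * c ^+ 2 < lam ^+ 2 ->
  0 <= r - a <= c ^+ 2 / lam /\ `|t - c / r| <= 8 * c ^+ 2 / lam ^+ 2.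
Proof.
move=> lam0 la r0 ra rc tpi hc.
have r2 : r ^+ 2 = a ^+ 2 + c ^+ 2 by rewrite -ra -rc !exprMn -mulrDr cos2Dsin2 mulr1.
have a0 : 0 < a by apply: lt_le_trans la; rewrite divr_gt0.
have ra' : a <= r by rewrite -ra ger_pMr// cos_le1.
have lra' : lam <= r + a by lra.
have e : (r - a) * (r + a) = c ^+ 2 by rewrite -subr_sqr r2; ring.
have rac : r - a <= c ^+ 2 / lam.
  by rewrite ler_pdivlMr// -e ler_wpM2l// subr_ge0.
split; first by rewrite subr_ge0 ra' rac.
have k1 : 1 - cos t <= 2 * c ^+ 2 / lam ^+ 2.
  have -> : cos t = a / r by rewrite -ra; field; rewrite gt_eqF.
  have -> : 1 - a / r = (r - a) / r by field; rewrite gt_eqF.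
  rewrite ler_pdivrMr// (le_trans rac)//.
  have -> : 2 * c ^+ 2 / lam ^+ 2 * r = c ^+ 2 / lam * (2 * r / lam) by field; rewrite gt_eqF.
  rewrite ler_peMr ?divr_ge0 ?sqr_ge0 ?(ltW lam0)// ler_pdivlMr//; lra.
(* 1 - cos (1 / 4) is at least 1 / 64 by [sqr_le_cos], so monotonicity of cos on [0, pi] yields |t|
   <= 1 / 4; the constant 128 is 2 * 64. *)
have k2 : 2 * c ^+ 2 / lam ^+ 2 < 1 / 64.
  by rewrite ltr_pdivrMr ?exprn_gt0//; lra.
have t4 : `|t| <= 1 / 4.
  have q4 : 1 / 4 <= pi :> R by have := @pi_ge2 R; lra.
  have c4 : cos (1 / 4) < cos `|t| :> R.
    have := @sqr_le_cos R (1 / 4); rewrite ger0_norm// => /(_ (lexx _)).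
    have -> : cos `|t| = cos t by case: (ler0P t) => _; rewrite ?cosN.
    by lra.
  rewrite leNgt; apply/negP => tq.
  have tin : `|t| \in `[0, pi].
    rewrite in_itv/= normr_ge0/= ler_norml; move: tpi => /andP[? ?]; apply/andP; split => //; exact: ltW.
  have qin : 1 / 4 \in `[0 : R, pi] by rewrite in_itv/= q4 andbT.
  by move: tq; rewrite -(ltr_cos qin tin) ltNge (ltW c4).
have := sin_taylor1 0 t; rewrite add0r sin0 subr0 cos0 mulr1.
have -> : c / r = sin t by rewrite -rc; field; rewrite gt_eqF.
rewrite distrC => h; apply: le_trans h _.
by have := sqr_le_cos t4; lra.
Qed.

(** A perturbed diagonal system: diagonal dominance first bounds the solution by [M], and then the
    perturbation times this bound is an error of order eta. *)
Lemma linear_expansion (v0 v1 v2 n11 n12 n22 g1 g2 X1 X2 X Y A eta M sg : R) :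
  0 < v0 -> v0 <= v1 -> v0 <= v2 -> 0 <= eta -> eta <= v0 / 4 -> 0 < sg ->
  `|n11 - v1| <= eta -> `|n12| <= eta -> `|n22 - v2| <= eta ->
  `|g1 - sg * X1| <= eta -> `|g2 - sg * X2| <= eta -> `|X1| <= A -> `|X2| <= A ->
  n11 * X - n12 * Y = g1 -> - n12 * X + n22 * Y = g2 -> M = 4 * (sg * A + eta) / v0 ->
  [/\ `|X| <= M, `|Y| <= M, `|X - sg * X1 / v1| <= eta * (2 * M + 1) / v0 &
    `|Y - sg * X2 / v2| <= eta * (2 * M + 1) / v0].
Proof.
move=> v00 v01 v02 eta0 etav sg0 h11 h12 h22 k1 k2 A1 A2 e1 e2 ->.
have sX1 : `|sg * X1| <= sg * A by rewrite normrM gtr0_norm// ler_pM2l.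
have sX2 : `|sg * X2| <= sg * A by rewrite normrM gtr0_norm// ler_pM2l.
have G (g s : R) : `|g - s| <= eta -> `|s| <= sg * A -> `|g| <= sg * A + eta.
  move=> a1 a2; have -> : g = s + (g - s) by ring.
  by apply: le_trans (ler_normD _ _) _; exact: lerD.
have g1b := G _ _ k1 sX1; have g2b := G _ _ k2 sX2.
have B (n v x y g : R) : v0 <= v -> `|n - v| <= eta -> n * x - n12 * y = g -> `|g| <= sg * A + eta ->
    3 / 4 * v0 * `|x| <= sg * A + eta + v0 / 4 * `|y|.
  move=> hv hn eg hg.
  have n34 : 3 / 4 * v0 <= n by move: hn; rewrite ler_norml => /andP[? ?]; lra.
  have n0 : 0 < n by apply: lt_le_trans n34; rewrite mulr_gt0.
  apply: (@le_trans _ _ (n * `|x|)); first by rewrite ler_wpM2r.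
  have -> : n * `|x| = `|g + n12 * y| by rewrite -eg subrK normrM gtr0_norm.
  apply: le_trans (ler_normD _ _) _; rewrite lerD// normrM ler_wpM2r//.
  exact: le_trans h12 etav.
have bX := B _ _ _ _ _ v01 h11 e1 g1b.
have bY : 3 / 4 * v0 * `|Y| <= sg * A + eta + v0 / 4 * `|X|.
  by apply: (B n22 v2 _ _ g2) => //; rewrite -e2; ring.
(* The sum of the two bounds, with v0 / 4 (|X| + |Y|) moved to the left; this is the origin of the 4
   in [M]. *)
have XY : v0 * (`|X| + `|Y|) <= 4 * (sg * A + eta) by lra.
have bM z : 0 <= `|X| + `|Y| - z -> z <= 4 * (sg * A + eta) / v0.
  rewrite subr_ge0 => hz; apply: le_trans hz _; rewrite ler_pdivlMr// mulrC//.
have XM : `|X| <= 4 * (sg * A + eta) / v0 by apply: bM; have := normr_ge0 Y; lra.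
have YM : `|Y| <= 4 * (sg * A + eta) / v0 by apply: bM; have := normr_ge0 X; lra.
move: XM YM; set M' := _ / v0 => XM YM.
have F (n v x y g s : R) : v0 <= v -> `|n - v| <= eta -> n * x - n12 * y = g -> `|g - s| <= eta ->
    `|x| <= M' -> `|y| <= M' -> `|x - s / v| <= eta * (2 * M' + 1) / v0.
  move=> hv hn eg gs xM yM.
  have v0' : 0 < v by apply: lt_le_trans hv.
  have -> : x - s / v = ((g - s) - (n - v) * x + n12 * y) / v.
    by rewrite -eg; field; rewrite gt_eqF.
  have b1 : `|(g - s) - (n - v) * x + n12 * y| <= eta * (2 * M' + 1).
    apply: le_trans (ler_normD _ _) _; apply: le_trans (lerD (ler_normB _ _) (lexx _)) _.
    have b2 : `|(n - v) * x| <= eta * M' by rewrite normrM ler_pM.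
    have b3 : `|n12 * y| <= eta * M' by rewrite normrM ler_pM.
    by lra.
  rewrite normrM normfV (gtr0_norm v0') ler_pM ?invr_ge0 ?(ltW v0')//.
  by rewrite lef_pV2 ?posrE.
split => //.
- by apply: (F n11 v1 _ _ g1 _ v01 h11 e1 k1).
- by apply: (F n22 v2 _ X g2) => //; rewrite -e2; ring.
Qed.

Lemma normal_equations (v0 v1 v2 n11 n12 n22 g1 g2 eta : R) :
  0 < v0 -> v0 <= v1 -> v0 <= v2 -> eta <= v0 / 4 ->
  `|n11 - v1| <= eta -> `|n12| <= eta -> `|n22 - v2| <= eta ->
  [/\ 0 < n11, n12 ^+ 2 < n11 * n22 &
    exists X Y, n11 * X - n12 * Y = g1 /\ - n12 * X + n22 * Y = g2].
Proof.
move=> v00 v01 v02 etav bn11 bn12 bn22.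
have n11l : 3 / 4 * v0 <= n11 by move: bn11; rewrite ler_norml => /andP[? ?]; lra.
have n22l : 3 / 4 * v0 <= n22 by move: bn22; rewrite ler_norml => /andP[? ?]; lra.
have n12l : n12 ^+ 2 <= (1 / 4 * v0) ^+ 2.
  rewrite -real_normK ?num_real// lerXn2r ?nnegrE//; last lra.
  by rewrite mulr_ge0// ltW.
have n11n22 : (3 / 4 * v0) ^+ 2 <= n11 * n22.
  by rewrite expr2 ler_pM// mulr_ge0// ltW.
have vsq : 0 < v0 ^+ 2 by rewrite exprn_gt0.
pose D := n11 * n22 - n12 ^+ 2.
have D0 : 0 < D by rewrite /D; move: n12l n11n22; rewrite !exprMn; lra.
split; [by apply: lt_le_trans n11l; rewrite mulr_gt0|by rewrite -subr_gt0|].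
exists ((n22 * g1 + n12 * g2) / D), ((n12 * g1 + n11 * g2) / D).
by split; rewrite /D; field; rewrite gt_eqF.
Qed.

(** Here [s] is the square root of the horizon and X / s, Y / s are the Cartesian deviations. The
    three terms divided by [s] bound the curvature of the length, that of the angle, and the
    replacement of 1 / r by 1 / lam. The condition 16 M <= s l0 supplies the smallness required by
    [polar_expansion]. *)
Lemma polar_error (l0 lam M s X Y r t z1 z2 e' eps : R) : 0 < l0 -> l0 <= lam -> 0 < M -> 1 <= s ->
  16 * M <= s * l0 -> `|X| <= M -> `|Y| <= M -> 0 < r -> r * cos t = lam + X / s -> r * sin t = Y / s ->
  - pi < t <= pi -> (M ^+ 2 / l0 + 8 * M ^+ 2 / l0 ^+ 2 + 2 * M * (M + M ^+ 2 / l0) / l0 ^+ 2) / s <= eps / 2 ->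
  `|X - z1| <= e' -> `|Y - z2| <= e' -> 0 < eps -> e' <= eps / 2 -> e' <= eps * l0 / 2 ->
  `|s * (r - lam) - z1| <= eps /\ `|s * t - z2 / lam| <= eps.
Proof.
move=> l00 l0l M0 s_1 sM XM YM rr0 qa qc tpi sK XE YE eps0 e'1 e'2.
have s0 : 0 < s by apply: lt_le_trans s_1.
have lam0 : 0 < lam by apply: lt_le_trans l0l.
pose a := lam + X / s; pose c := Y / s.
have K1 : 0 <= M ^+ 2 / l0 by rewrite divr_ge0 ?sqr_ge0// ltW.
have K2 : 0 <= 8 * M ^+ 2 / l0 ^+ 2 by apply: divr_ge0; [apply: mulr_ge0 => //|]; exact: sqr_ge0.
have K3 : 0 <= 2 * M * (M + M ^+ 2 / l0) / l0 ^+ 2.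
  by apply: divr_ge0; [apply: mulr_ge0; [apply: mulr_ge0|apply: addr_ge0] => //; exact: ltW|exact: sqr_ge0].
have Zs z : `|z| <= M -> `|z / s| <= M / s.
  by rewrite normrM normfV (gtr0_norm s0) ler_pM2r ?invr_gt0.
have Xs := Zs _ XM.
have Ms : M / s <= l0 / 16 by rewrite ler_pdivrMr//; lra.
have la : lam / 2 <= a by move: Xs; rewrite /a ler_norml => /andP[? ?]; lra.
have c2 : c ^+ 2 <= (M / s) ^+ 2.
  rewrite -real_normK ?num_real// lerXn2r ?nnegrE// ?Zs//.
  by apply: divr_ge0; exact: ltW.
have Ms2 : (M / s) ^+ 2 <= l0 ^+ 2 / 256.
  have -> : l0 ^+ 2 / 256 = (l0 / 16) ^+ 2 by field.
  by rewrite lerXn2r// nnegrE divr_ge0// ltW.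
have ll2 : l0 ^+ 2 <= lam ^+ 2 by rewrite lerXn2r// nnegrE ltW.
have l02 : 0 < l0 ^+ 2 by rewrite exprn_gt0.
have c128 : 128 * c ^+ 2 < lam ^+ 2 by lra.
have [/andP[b1 b2] b3] := polar_expansion lam0 la rr0 qa qc tpi c128.
have sc : s * c ^+ 2 <= M ^+ 2 / s.
  apply: (@le_trans _ _ (s * (M / s) ^+ 2)); first by rewrite ler_pM2l.
  by rewrite le_eqVlt; apply/orP; left; apply/eqP; field; rewrite gt_eqF.
have ilam : lam^-1 <= l0^-1 by rewrite lef_pV2 ?posrE.
have ilam2 : (lam ^+ 2)^-1 <= (l0 ^+ 2)^-1 by rewrite lef_pV2 ?posrE// exprn_gt0.
have M20 : 0 <= M ^+ 2 / s by rewrite divr_ge0 ?sqr_ge0// ltW.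
have r1 : s * (r - a) <= M ^+ 2 / l0 / s.
  apply: (@le_trans _ _ (s * (c ^+ 2 / lam))); first by rewrite ler_pM2l.
  rewrite mulrA [leRHS]mulrAC; apply: ler_pM => //; last by rewrite invr_ge0 ltW.
  by apply: mulr_ge0; [exact: ltW|exact: sqr_ge0].
have r0 : 0 <= s * (r - a) by rewrite mulr_ge0// ltW.
have ps (x : R) : 0 <= x -> 0 <= x / s by move=> h; rewrite divr_ge0// ltW.
have KE : (M ^+ 2 / l0 + 8 * M ^+ 2 / l0 ^+ 2 + 2 * M * (M + M ^+ 2 / l0) / l0 ^+ 2) / s = M ^+ 2 / l0 / s + 8 * M ^+ 2 / l0 ^+ 2 / s + 2 * M * (M + M ^+ 2 / l0) / l0 ^+ 2 / s.
  by rewrite !mulrDl.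
have := ps _ K1; have := ps _ K2; have := ps _ K3 => p3 p2 p1.
have sE : s * (r - lam) = X + s * (r - a) by rewrite /a; field; rewrite gt_eqF.
split.
  rewrite sE; have -> : X + s * (r - a) - z1 =
    (X - z1) + s * (r - a) by ring.
  apply: le_trans (ler_normD _ _) _; rewrite [X in _ + X]ger0_norm//.
  by move: sK; rewrite KE; lra.
have -> : s * t - z2 / lam =
  s * (t - c / r) + Y * (lam - r) / (r * lam) + (Y - z2) / lam.
  by rewrite /c; field; rewrite !gt_eqF.
apply: le_trans (ler_normD _ _) _; apply: le_trans (lerD (ler_normD _ _) (lexx _)) _.
have u1 : `|s * (t - c / r)| <= 8 * M ^+ 2 / l0 ^+ 2 / s.
  rewrite normrM (gtr0_norm s0); apply: (@le_trans _ _ (s * (8 * c ^+ 2 / lam ^+ 2))).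
    by rewrite ler_pM2l.
  have -> : s * (8 * c ^+ 2 / lam ^+ 2) = 8 * (s * c ^+ 2) / lam ^+ 2 by ring.
  rewrite [leRHS]mulrAC; apply: ler_pM => //.
  - by apply: mulr_ge0 => //; apply: mulr_ge0; [exact: ltW|exact: sqr_ge0].
  - by rewrite invr_ge0 sqr_ge0.
  - by rewrite -[leRHS]mulrA ler_pM2l.
have u3 : `|(Y - z2) / lam| <= eps / 2.
  rewrite normrM normfV (gtr0_norm lam0) ler_pdivrMr//.
  have : eps * l0 <= eps * lam by rewrite ler_pM2l.
  by lra.
have u4 : `|lam - r| <= (M + M ^+ 2 / l0) / s.
  rewrite ler_pdivlMr// mulrC -[X in X * _](gtr0_norm s0) -normrM.
  have -> : s * (lam - r) = - (X + s * (r - a)) by rewrite -sE; ring.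
  rewrite normrN; apply: le_trans (ler_normD _ _) _; rewrite [X in _ + X]ger0_norm//.
  apply: lerD => //; apply: le_trans r1 _.
  by rewrite ler_pdivrMr// ler_peMr.
have u2 : `|Y * (lam - r) / (r * lam)| <= 2 * M * (M + M ^+ 2 / l0) / l0 ^+ 2 / s.
  rewrite normrM normrM normfV (gtr0_norm (mulr_gt0 rr0 lam0)).
  have -> : 2 * M * (M + M ^+ 2 / l0) / l0 ^+ 2 / s = M * ((M + M ^+ 2 / l0) / s) * (2 / l0 ^+ 2) by ring.
  apply: ler_pM; [by rewrite mulr_ge0|by rewrite invr_ge0 mulr_ge0// ltW|by rewrite ler_pM|].
  rewrite -[2]invrK -invfM lef_pV2 ?posrE ?mulr_gt0 ?exprn_gt0//.
  have : lam / 2 * lam <= r * lam by rewrite ler_pM2r//; lra.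
  by move: ll2; rewrite !expr2; lra.
by move: sK; rewrite KE; lra.
Qed.

(** Existence of a maximizer is part of the conclusion, since an estimator is constrained only where
    one exists. [eta] and [T1] do not involve the parameter, the path or the likelihood. *)
Lemma mle_expansion (l0 v0 sg A eps : R) : 0 < l0 -> 0 < v0 -> 0 < sg -> 0 < A -> 0 < eps ->
  exists2 eta, 0 < eta & exists2 T1, 1 <= T1 & forall mu lam be Tm X1 X2 C S B1 B2 f,
  l0 <= lam -> v0 <= (1 - be) / 2 -> v0 <= (1 + be) / 2 -> T1 <= Tm -> `|X1| <= A -> `|X2| <= A ->
  `|C / Tm - be| <= eta -> `|S / Tm| <= eta ->
  `|B1 - lam / 2 * (Tm - C) - sg * (Num.sqrt Tm * X1)| <= eta ->
  `|B2 + lam / 2 * S - sg * (Num.sqrt Tm * X2)| <= eta ->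
  (forall q, param_space q -> forall x y, x = q.1 * cos (q.2 - mu) -> y = q.1 * sin (q.2 - mu) ->
    f q = (sg ^+ 2)^-1 * (x * B1 + y * B2
      - ((x ^+ 2 + y ^+ 2) / 2 * Tm - (x ^+ 2 - y ^+ 2) / 2 * C - x * y * S) / 2)) ->
  (exists q, maximizer f q) /\ forall q, maximizer f q ->
    `|Num.sqrt Tm * (q.1 - lam) - sg * X1 / ((1 - be) / 2)| <= eps /\
    `|Num.sqrt Tm * angle (q.2 - mu) - sg * X2 / (lam * ((1 + be) / 2))| <= eps.
Proof.
move=> l00 v00 sg0 A0 eps0.
pose M := 4 * (sg * A + 1) / v0.
have sA : 0 < sg * A by rewrite mulr_gt0.
have M0 : 0 < M by rewrite divr_gt0// mulr_gt0// addr_gt0.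
pose e' := Num.min (eps / 2) (eps * l0 / 2).
have e'0 : 0 < e' by rewrite lt_min !divr_gt0// mulr_gt0.
have M1 : 0 < 2 * M + 1 by rewrite addr_gt0// mulr_gt0.
(* 1 makes the bound [M] independent of [eta], v0 / 4 gives diagonal dominance, and the last term
   brings the linear error below [e']. *)
pose eta := Num.min (Num.min 1 (v0 / 4)) (e' * v0 / (2 * M + 1)).
have eta0 : 0 < eta by rewrite !lt_min ltr01 !divr_gt0// mulr_gt0.
have eta1 : eta <= 1 by rewrite !ge_min lexx.
have etav : eta <= v0 / 4 by rewrite !ge_min lexx orbT.
have etae : eta * (2 * M + 1) / v0 <= e'.
  by rewrite ler_pdivrMr// -ler_pdivlMr// ge_min lexx orbT.
pose K := M ^+ 2 / l0 + 8 * M ^+ 2 / l0 ^+ 2 + 2 * M * (M + M ^+ 2 / l0) / l0 ^+ 2.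
have K1 : 0 <= M ^+ 2 / l0 by rewrite divr_ge0 ?sqr_ge0// ltW.
have K2 : 0 <= 8 * M ^+ 2 / l0 ^+ 2 by apply: divr_ge0; [apply: mulr_ge0 => //|]; exact: sqr_ge0.
have K3 : 0 <= 2 * M * (M + M ^+ 2 / l0) / l0 ^+ 2.
  by apply: divr_ge0; [apply: mulr_ge0; [apply: mulr_ge0|apply: addr_ge0] => //; exact: ltW|exact: sqr_ge0].
pose s1 := 1 + 16 * M / l0 + 2 * K / eps.
have K0 : 0 <= K by rewrite !addr_ge0.
have t1 : 0 <= 16 * M / l0 by rewrite divr_ge0 ?(ltW l00)// mulr_ge0// ltW.
have t2 : 0 <= 2 * K / eps by rewrite divr_ge0 ?(ltW eps0)// mulr_ge0.
have s11 : 1 <= s1 by rewrite /s1; lra.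
exists eta => //; exists (s1 ^+ 2); first by rewrite -[leLHS](expr1n _ 2) lerXn2r ?nnegrE// (le_trans _ s11).
move=> mu lam be Tm X1 X2 C S B1 B2 f l0l v01 v02 T1 X1A X2A hC hS hB1 hB2 fE.
have lam0 : 0 < lam by apply: lt_le_trans l0l.
pose s := Num.sqrt Tm.
have s1s : s1 <= s.
  rewrite -(@ger0_norm _ s1) ?(le_trans _ s11)// -sqrtr_sqr ler_sqrt//.
  by apply: le_trans T1; exact: sqr_ge0.
have s0 : 0 < s by apply: lt_le_trans s1s; apply: lt_le_trans s11.
have Tm0 : 0 < Tm by rewrite -sqrtr_gt0.
have s2 : s ^+ 2 = Tm by rewrite sqr_sqrtr// ltW.
have s_1 : 1 <= s by apply: le_trans s1s.
have sM : 16 * M <= s * l0.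
  by rewrite -ler_pdivrMr//; apply: le_trans s1s; rewrite /s1; lra.
have sK : K / s <= eps / 2.
  have : 2 * K / eps <= s by apply: le_trans s1s; rewrite /s1; lra.
  by rewrite ler_pdivrMr// => h; rewrite ler_pdivrMr//; lra.
pose n11 := (1 - C / Tm) / 2; pose n22 := (1 + C / Tm) / 2; pose n12 := S / Tm / 2.
pose g1 := (B1 - lam / 2 * (Tm - C)) / s; pose g2 := (B2 + lam / 2 * S) / s.
have bn11 : `|n11 - (1 - be) / 2| <= eta.
  have -> : n11 - (1 - be) / 2 = - ((C / Tm - be) / 2) by rewrite /n11; field; rewrite gt_eqF.
  by rewrite normrN normrM [X in _ * X]ger0_norm//; have := normr_ge0 (C / Tm - be); lra.
have bn22 : `|n22 - (1 + be) / 2| <= eta.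
  have -> : n22 - (1 + be) / 2 = (C / Tm - be) / 2 by rewrite /n22; field; rewrite gt_eqF.
  by rewrite normrM [X in _ * X]ger0_norm//; have := normr_ge0 (C / Tm - be); lra.
have bn12 : `|n12| <= eta.
  by rewrite /n12 normrM [X in _ * X]ger0_norm//; have := normr_ge0 (S / Tm); lra.
have bg (B X : R) : `|B - sg * (s * X)| <= eta -> `|B / s - sg * X| <= eta.
  move=> h; have -> : B / s - sg * X = (B - sg * (s * X)) / s by field; rewrite gt_eqF.
  by rewrite normrM normfV (gtr0_norm s0) ler_pdivrMr// (le_trans h)// ler_peMr// ltW.
have bg1 := bg _ _ hB1; have bg2 := bg _ _ hB2.
have [n110 nD [X [Y [e1 e2]]]] := normal_equations g1 g2 v00 v01 v02 etav bn11 bn12 bn22.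
have [XM YM XE YE] := linear_expansion v00 v01 v02 (ltW eta0) etav sg0 bn11 bn12 bn22 bg1 bg2 X1A X2A e1 e2 erefl.
set M' := 4 * (sg * A + eta) / v0 in XM YM XE YE.
have M'M : M' <= M.
  by rewrite /M' /M ler_pM2r ?invr_gt0// ler_pM2l// lerD2l.
have {}XM := le_trans XM M'M; have {}YM := le_trans YM M'M.
have ee : eta * (2 * M' + 1) / v0 <= e'.
  apply: le_trans etae; rewrite ler_pM2r ?invr_gt0// ler_pM2l// lerD2r ler_pM2l//.
have {}XE := le_trans XE ee; have {}YE := le_trans YE ee.
pose a := lam + X / s; pose c := Y / s.
have a0 : 0 < a.
  have : `|X / s| <= l0 / 16.
    rewrite normrM normfV (gtr0_norm s0) ler_pdivrMr//; apply: le_trans XM _; clear - sM; lra.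
  by rewrite /a ler_norml => /andP[xs _]; clear - xs l0l lam0; lra.
have k0 : 0 < (sg ^+ 2)^-1 by rewrite invr_gt0 exprn_gt0.
have [||||||exm qm] := @quadratic_maximizer (Tm * n11) (Tm * n12) (Tm * n22) B1 B2 a c mu _ f k0.
- by rewrite mulr_gt0.
- have -> : Tm * n11 * (Tm * n22) = Tm ^+ 2 * (n11 * n22) by ring.
  by rewrite exprMn ltr_pM2l ?exprn_gt0.
- exact: a0.
- have -> : B1 = lam / 2 * (Tm - C) + s * g1 by rewrite /g1; field; rewrite gt_eqF.
  rewrite -e1 /a /c /n11 /n12 -s2; field; rewrite gt_eqF//.
- have -> : B2 = - (lam / 2 * S) + s * g2 by rewrite /g2; field; rewrite gt_eqF.
  rewrite -e2 /a /c /n11 /n12 /n22 -s2; field; rewrite gt_eqF//.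
- move=> q pq; cbv zeta; rewrite (fE q pq _ _ erefl erefl) /n11 /n12 /n22; field.
  by rewrite !gt_eqF.
split => // q /[dup] -[[q10 _] _] /qm[qa qc].
have [ca sa] := cos_sin_angle (q.2 - mu); have [tpi _] := angleP (q.2 - mu).
rewrite -ca in qa; rewrite -sa in qc.
have -> : sg * X2 / (lam * ((1 + be) / 2)) = sg * X2 / ((1 + be) / 2) / lam by rewrite invfM mulrA mulrAC.
apply: (@polar_error l0 lam M s X Y q.1 (angle (q.2 - mu)) _ _ e' eps) => //.
- by rewrite ge_min lexx.
- by rewrite ge_min lexx orbT.
Qed.

End maximum_likelihood_equations.

(** * Ito integrals and the likelihood as a random quadratic polynomial *)

Section uniform_grid.
Context {R : realType} {d : measure_display} {T : measurableType d}.
Variables (P : probability T R) (Tm : R).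
Hypothesis Tm0 : 0 < Tm.

Let dt n := Tm / n%:R.
Let grid n : seq R := mkseq (fun i => i.+1%:R * dt n.+1) n.+1.

Let nth_grid n i : (i <= n.+1)%N -> nth 0 (0 :: grid n) i = i%:R * dt n.+1.
Proof. by case: i => [|i] ni /=; rewrite ?mul0r// nth_mkseq. Qed.

Let grid_partition n : itv_partition 0 Tm (grid n).
Proof.
split.
  apply/(pathP 0) => i; rewrite size_mkseq => ni.
  rewrite nth_grid ?nth_mkseq ?(ltnW ni)// ltr_pM2r ?ltr_nat// divr_gt0//.
apply/eqP; rewrite -nth_last size_mkseq nth_mkseq//.
by rewrite mulrCA divff ?mulr1// pnatr_eq0.
Qed.

Lemma ito_integral_grid (X Z : R -> T -> R) (J : T -> R) :
  (forall t, 0 <= t -> measurable_fun setT (X t)) ->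
  (forall t, 0 <= t -> measurable_fun setT (Z t)) ->
  ito_integral P X Z Tm J ->
  forall c e : R, 0 < c -> 0 < e -> \forall n \near \oo, mostly P e (fun w =>
    `|\sum_(i < n.+1) X (i%:R * dt n.+1) w *
      (Z (i.+1%:R * dt n.+1) w - Z (i%:R * dt n.+1) w) - J w| <= c).
Proof.
move=> mX mZ [mJ HJ] c e c0 e0.
(* The definition of the integral uses one number both as tolerance and as probability, so the
   smaller of the two is taken. *)
have ce0 : 0 < Num.min c e by rewrite lt_min c0.
have [h h0 Hh] := HJ _ ce0.
exists (Num.truncn (Tm / h)) => // n /= Nn.
have dth : dt n.+1 < h.
  rewrite ltr_pdivrMr ?ltr0n// mulrC -ltr_pdivrMr//.
  by apply: lt_le_trans (truncnS_gt _) _; rewrite ler_nat ltnS.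
have sumE w : left_sum X Z (grid n) w = \sum_(i < n.+1) X (i%:R * dt n.+1) w *
    (Z (i.+1%:R * dt n.+1) w - Z (i%:R * dt n.+1) w).
  rewrite /left_sum size_mkseq; apply: eq_bigr => i _.
  by rewrite !nth_grid// ltnW.
have := Hh (grid n) (grid_partition n) _.
rewrite size_mkseq => H; have {}H := H _.
apply: (@mostly_set _ _ _ _ _ [set w | Num.min c e <= `|left_sum X Z (grid n) w - J w|]).
- apply: measurable_set_le; first exact: measurable_cst.
  apply: measurableT_comp => //; apply: measurable_funB => //.
  rewrite (funext sumE).
  apply: (@measurable_sum _ _ _ _ _ (index_enum _) (fun (i : 'I_n.+1) w => X (i%:R * dt n.+1) w *
    (Z (i.+1%:R * dt n.+1) w - Z (i%:R * dt n.+1) w))) => i.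
  apply: measurable_funM; first by apply: mX; exact: grid_ge0.
  by apply: measurable_funB; apply: mZ; exact: grid_ge0.
- apply: le_trans (H _) _; last by rewrite lee_fin ge_min lexx orbT.
  move=> i ni; rewrite !nth_grid ?(ltnW ni)// -mulrBl -natrB ?leqnSn// subSnn mul1r//.
- move=> w /negP; rewrite -ltNge sumE => /ltW h1; apply: le_trans h1 _.
  by rewrite ge_min lexx.
Qed.

End uniform_grid.

Section likelihood_field.
Context {R : realType} {d : measure_display} {T : measurableType d}.
Local Notation mu := (@lebesgue_measure R).
Variables (P : probability T R) (sg Tm : R) (p : R * R) (W theta : R -> T -> R) (L : R * R -> T -> R).
Hypothesis sg0 : 0 < sg.
Hypothesis Tm0 : 0 < Tm.
Hypothesis pp : param_space p.
Hypothesis vM : von_mises_process P sg p W theta.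
Hypothesis LL : log_likelihood P sg theta Tm L.

Let x t w := theta t w - p.2.

Lemma shifted_measurable t : 0 <= t -> measurable_fun setT (x t).
Proof. by case: vM => _ mth _ _ _ t0; apply: measurable_funB => //; exact: mth. Qed.

Lemma shifted_indep : indep_rv_sigma P (x 0) (sigma_gen W `[0, +oo[).
Proof.
case: vM => _ _ ith _ _ A E mA GE.
have -> : x 0 @^-1` A = theta 0 @^-1` ((fun y : R => y - p.2) @^-1` A) by [].
apply: ith => //; rewrite -[X in measurable X]setTI.
by apply: measurable_funB.
Qed.

Lemma shifted_continuous : {ae P, forall w, {within `[0, +oo[, continuous (x ^~ w)}}.
Proof.
case: vM => _ _ _ + _; apply: filterS => w cw s.
by apply: cvgB; [exact: cw|exact: cvg_cst].
Qed.

Lemma shifted_equation : {ae P, forall w, forall t, 0 <= t -> x t w = x 0 w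
  + \int[mu]_(s in `[0, t]) (- p.1 * sin (x s w)) + sg * W t w}.
Proof.
by case: vM => _ _ _ _; apply: filterS => w ew t t0; rewrite /x ew// /drift; ring.
Qed.

Let cX q := q.1 * cos (q.2 - p.2).
Let cY q := q.1 * sin (q.2 - p.2).

Lemma drift_coordinates t w q :
  drift (theta t w) q = cX q * - sin (x t w) + cY q * cos (x t w).
Proof.
rewrite /drift /x /cX /cY; have -> : theta t w - q.2 = (theta t w - p.2) - (q.2 - p.2) by ring.
by rewrite sinB; ring.
Qed.

Lemma integral_drift_sqr w q : {within `[0, +oo[, continuous (x ^~ w)} ->
  \int[mu]_(t in `[0, Tm]) (drift (theta t w) q) ^+ 2 =
  (cX q ^+ 2 + cY q ^+ 2) / 2 * Tm
  - (cX q ^+ 2 - cY q ^+ 2) / 2 * \int[mu]_(t in `[0, Tm]) cos (2 * x t w)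
  - cX q * cY q * \int[mu]_(t in `[0, Tm]) cos (2 * x t w - pi / 2).
Proof.
move=> cw.
have cwT : {within `[0, Tm], continuous (x ^~ w)}.
  by apply: continuous_subspaceW cw => t; rewrite /= !in_itv/= => /andP[->].
have icos (b : R) : mu.-integrable `[0, Tm] (EFin \o (fun t => cos (2 * x t w + b))).
  apply: continuous_compact_integrable; first exact: segment_compact.
  apply: (@within_postcomp _ _ (x ^~ w) (fun y : R => cos (2 * y + b))) => // y.
  apply: (@continuous_comp _ _ _ (fun y : R => 2 * y + b) cos); last exact: continuous_cos.
  by apply: cvgD; [apply: cvgMl_tmp; exact: cvg_id|exact: cvg_cst].
have icst (k : R) : mu.-integrable `[0, Tm] (EFin \o (fun=> k)).
  by apply: continuous_compact_integrable; [exact: segment_compact|move=> t; exact: cvg_cst].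
have iZ (k : R) (f : R -> R) : mu.-integrable `[0, Tm] (EFin \o f) ->
    mu.-integrable `[0, Tm] (EFin \o (fun t => k * f t)).
  by move=> h; have := integrableZl _ k h; apply.
set X := cX q; set Y := cY q.
transitivity (\int[mu]_(t in `[0, Tm]) ((X ^+ 2 + Y ^+ 2) / 2
   - (X ^+ 2 - Y ^+ 2) / 2 * cos (2 * x t w + 0) - X * Y * cos (2 * x t w + - (pi / 2)))).
  apply: eq_Rintegral => t _; rewrite drift_coordinates -/X -/Y addr0 cosBpihalf.
  set z := x t w; have -> : 2 * z = z + z by ring.
  rewrite cosD sinD; have := cos2Dsin2 z; set a := cos z; set b := sin z => h.
  have -> : (X ^+ 2 + Y ^+ 2) / 2 = (X ^+ 2 + Y ^+ 2) / 2 * (a ^+ 2 + b ^+ 2) by rewrite h mulr1.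
  by field.
rewrite RintegralB//; last 2 first.
- by have := integrableB _ (icst ((X ^+ 2 + Y ^+ 2) / 2)) (iZ ((X ^+ 2 - Y ^+ 2) / 2) _ (icos 0)); apply.
- exact: iZ.
rewrite RintegralB//; [|exact: iZ].
have Zc k b : \int[mu]_(t in `[0, Tm]) (k * cos (2 * x t w + b)) =
    k * \int[mu]_(t in `[0, Tm]) cos (2 * x t w + b) by rewrite RintegralZl.
rewrite !Zc Rintegral_cst//.
have -> : fine (mu `[0, Tm]) = Tm by rewrite lebesgue_measure_itv/= lte_fin Tm0 oppr0 adde0.
by under eq_Rintegral do rewrite addr0.
Qed.

Let dt n := Tm / n%:R.
Let lsum n a w := \sum_(i < n.+1) - sin (x (i%:R * dt n.+1) w + a) *
  (x (i.+1%:R * dt n.+1) w - x (i%:R * dt n.+1) w).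

Let dsum n q w := \sum_(i < n.+1) drift (theta (i%:R * dt n.+1) w) q *
  (theta (i.+1%:R * dt n.+1) w - theta (i%:R * dt n.+1) w).

Let dsumE n q w : dsum n q w = cX q * lsum n 0 w + cY q * lsum n (- (pi / 2)) w.
Proof.
rewrite /dsum /lsum !mulr_sumr -big_split/=; apply: eq_bigr => i _.
by rewrite drift_coordinates sinBpihalf addr0 /x; ring.
Qed.

Let ito_drift q J : ito_integral P (fun t w => drift (theta t w) q) theta Tm J ->
  forall c e : R, 0 < c -> 0 < e ->
  \forall n \near \oo, mostly P e (fun w => `|dsum n q w - J w| <= c).
Proof.
have mth t : 0 <= t -> measurable_fun setT (theta t) by case: vM => _ + _ _ _; apply.
move=> HJ; apply: (ito_integral_grid Tm0 _ mth HJ) => t t0.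
apply: measurable_funM => //.
have mtq : measurable_fun setT (fun w => theta t w - q.2) by apply: measurable_funB => //; exact: mth.
exact: (bmf_sin mtq).1.
Qed.

(** The angle mu + pi / 2 is shifted by a full turn when it leaves [0, 2 pi[. The Ito integral at
    this parameter serves as that of cos (x). *)
Let quarter_turn : exists2 q, param_space q & cX q = 0 /\ cY q = 1.
Proof.
have [p1 /andP[p2 p3]] := pp; have pi0 := @pi_gt0 R.
have [h|h] := ltP p.2 (3 * pi / 2).
  exists (1, p.2 + pi / 2); first by split=> //=; apply/andP; split; lra.
  by rewrite /cX /cY /= addrAC subrr add0r cos_pihalf sin_pihalf mulr0 mulr1.
exists (1, p.2 - 3 * pi / 2); first by split=> //=; apply/andP; split; lra.
rewrite /cX /cY /=; have -> : p.2 - 3 * pi / 2 - p.2 = pi / 2 + 2 * pi * (-1)%:~R.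
  by rewrite rmorphN/=; field.
by have [e1 e2] := @cos_sinD2pi R (pi / 2) (-1); rewrite e1 e2 cos_pihalf sin_pihalf mulr0 mulr1.
Qed.

(** [J1] and [J2] are the Ito integrals at (1, mu) and at the quarter turn. The formula holds almost
    surely at each parameter; continuity of the field in q puts all parameters outside one null set,
    where maximization takes place. *)
Lemma likelihood_field : exists J1 J2 : T -> R, [/\
  forall c e : R, 0 < c -> 0 < e -> \forall n \near \oo,
    mostly P e (fun w => `|lsum n 0 w - J1 w| <= c),
  forall c e : R, 0 < c -> 0 < e -> \forall n \near \oo,
    mostly P e (fun w => `|lsum n (- (pi / 2)) w - J2 w| <= c) &
  {ae P, forall w, forall q, param_space q ->
    forall X Y, X = q.1 * cos (q.2 - p.2) -> Y = q.1 * sin (q.2 - p.2) ->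
    L q w = (sg ^+ 2)^-1 * (X * J1 w + Y * J2 w - ((X ^+ 2 + Y ^+ 2) / 2 * Tm
      - (X ^+ 2 - Y ^+ 2) / 2 * \int[mu]_(t in `[0, Tm]) cos (2 * x t w)
      - X * Y * \int[mu]_(t in `[0, Tm]) cos (2 * x t w - pi / 2)) / 2)}].
Proof.
have [LJ Lc] := LL.
have [p1 p2] := pp.
have q1p : param_space (1 : R, p.2) by split.
have [J1 IJ1 _] := LJ _ q1p.
have [q2 q2p [q2X q2Y]] := quarter_turn.
have [J2 IJ2 _] := LJ _ q2p.
have h1 c e : 0 < c -> 0 < e -> \forall n \near \oo,
    mostly P e (fun w => `|lsum n 0 w - J1 w| <= c).
  move=> c0 e0; have := ito_drift IJ1 c0 e0; apply: filterS => n.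
  apply: mostly_mono => // w; rewrite dsumE /cX /cY/= subrr cos0 sin0.
  by rewrite mulr0 mul0r addr0 !mul1r.
have h2 c e : 0 < c -> 0 < e -> \forall n \near \oo,
    mostly P e (fun w => `|lsum n (- (pi / 2)) w - J2 w| <= c).
  move=> c0 e0; have := ito_drift IJ2 c0 e0; apply: filterS => n.
  by apply: mostly_mono => // w; rewrite dsumE q2X q2Y mul0r add0r mul1r.
exists J1, J2; split => //.
pose C w := \int[mu]_(t in `[0, Tm]) cos (2 * x t w).
pose S w := \int[mu]_(t in `[0, Tm]) cos (2 * x t w - pi / 2).
pose F w q := (sg ^+ 2)^-1 * (cX q * J1 w + cY q * J2 w - ((cX q ^+ 2 + cY q ^+ 2) / 2 * Tm
      - (cX q ^+ 2 - cY q ^+ 2) / 2 * C w - cX q * cY q * S w) / 2).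
suff H : {ae P, forall w, forall q, param_space q -> L q w = F w q}.
  by apply: filterS H => w H q pq X Y -> ->; rewrite H.
have Lq q : param_space q -> {ae P, forall w, L q w = F w q}.
  move=> pq; have [J IJ LqE] := LJ _ pq.
  (* Linearity of the Ito integral: the left-endpoint sums are linear by [dsumE], and limits in
     probability are almost surely unique. *)
  have JE : {ae P, forall w, J w = cX q * J1 w + cY q * J2 w}.
    apply: mostly_eq.
    - exact: IJ.1.
    - by apply: measurable_funD; apply: measurable_funM => //; [exact: IJ1.1|exact: IJ2.1].
    move=> c e c0 e0.
    pose k := c / (1 + `|cX q| + `|cY q|).
    have K0 : 0 < 1 + `|cX q| + `|cY q| by rewrite -addrA ltr_wpDr// addr_ge0.
    have k0 : 0 < k by rewrite divr_gt0.
    have kK : k * (1 + `|cX q| + `|cY q|) = c by rewrite divfK// gt_eqF.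
    have e3 : 0 < e / 3 by rewrite divr_gt0.
    near \oo => n.
    have m0 : mostly P (e / 3) (fun w => `|dsum n q w - J w| <= k) by near: n; exact: ito_drift.
    have m1 : mostly P (e / 3) (fun w => `|lsum n 0 w - J1 w| <= k) by near: n; exact: h1.
    have m2 : mostly P (e / 3) (fun w => `|lsum n (- (pi / 2)) w - J2 w| <= k) by near: n; exact: h2.
    have := mostlyI m0 (mostlyI m1 m2); apply: mostly_mono; first by lra.
    move=> w [k1 [k2 k3]]; rewrite dsumE in k1.
    have -> : J w - (cX q * J1 w + cY q * J2 w) =
      - (cX q * lsum n 0 w + cY q * lsum n (- (pi / 2)) w - J w) +
      (cX q * (lsum n 0 w - J1 w) + cY q * (lsum n (- (pi / 2)) w - J2 w)) by ring.
    apply: le_trans (ler_normD _ _) _; rewrite normrN.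
    apply: le_trans (lerD k1 (ler_normD _ _)) _; rewrite [X in _ + (X + _)]normrM [X in _ + (_ + X)]normrM.
    rewrite -kK !mulrDr mulr1 addrA; apply: lerD; first apply: lerD => //.
      by rewrite [leRHS]mulrC ler_wpM2l.
    by rewrite [leRHS]mulrC ler_wpM2l.
  apply: filterS3 LqE JE shifted_continuous => w -> -> cw.
  by rewrite integral_drift_sqr// -/(C w) -/(S w) /F; field; rewrite gt_eqF.
pose rq (r : rat * rat) : R * R := (ratr r.1, ratr r.2).
(* Both sides are continuous in q, so their almost sure equality at each rational q
   extends to all q outside a single null set. *)
have Lrat : {ae P, forall w, forall n (r : rat * rat), unpickle n = Some r ->
    param_space (rq r) -> L (rq r) w = F w (rq r)}.
  apply: ae_foralln => n.
  case: (unpickle n) => [r|]; last by apply: filterE.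
  have [pr|npr] := pselect (param_space (rq r)).
    by apply: filterS (Lq _ pr) => w h r' [<-].
  by apply: filterE => w r' [<-].
apply: filterS2 Lc Lrat => w cL Lr q pq.
have cF : continuous (F w).
  have c2 : continuous (fun q : R * R => q.2 - p.2).
    by move=> r; apply: cvgB; [exact: cvg_snd|exact: cvg_cst].
  have cXc : continuous cX.
    move=> r; apply: cvgM; first exact: cvg_fst.
    exact: (continuous_comp (c2 r) (@continuous_cos R _)).
  have cYc : continuous cY.
    move=> r; apply: cvgM; first exact: cvg_fst.
    exact: (continuous_comp (c2 r) (@continuous_sin R _)).
  move=> r; apply: cvgM; first exact: cvg_cst.
  have cc (k : R) : cst k @ r --> k by exact: cvg_cst.
  have X2 : (fun q => cX q ^+ 2) @ r --> cX r ^+ 2 by apply: cvgM; exact: cXc.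
  have Y2 : (fun q => cY q ^+ 2) @ r --> cY r ^+ 2 by apply: cvgM; exact: cYc.
  apply: cvgB; first by apply: cvgD; (apply: cvgM; [first [exact: cXc|exact: cYc]|exact: cc]).
  apply: cvgM; [apply: cvgB; first apply: cvgB|exact: cc].
  - apply: cvgM; [apply: cvgM; [exact: cvgD|exact: cc]|exact: cc].
  - apply: cvgM; [apply: cvgM; [exact: cvgB|exact: cc]|exact: cc].
  - apply: cvgM; [apply: cvgM; [exact: cXc|exact: cYc]|exact: cc].
apply/eqP; rewrite -subr_eq0; apply/negPn/negP => ne0.
have /subspace_continuousP/(_ _ pq) cLq := cL.
have cFq : F w @ within param_space (nbhs q) --> F w q.
  by apply: cvg_trans (cF q); apply: cvg_fmap2; exact: cvg_within.
have cD : (fun r => L r w - F w r) @ within param_space (nbhs q) --> L q w - F w q.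
  by apply: (cvgB (f := L ^~ w) (g := F w)); [exact: cLq|exact: cFq].
have e0 : 0 < `|L q w - F w q| by rewrite normr_gt0.
have /cvgrPdist_lt/(_ _ e0) := cD.
rewrite /= near_withinE -nbhs_ballE => -[e /= e0' He].
have [pq1 /andP[pq2 pq3]] := pq.
(* Both rational coordinates are taken above those of q, and the angle below 2 pi, so that the
   nearby point stays in the half-open parameter space. *)
have [r1 r1q] : exists r : rat, (ratr r : R) \in `]q.1, q.1 + e[ by apply: rat_in_itvoo; rewrite ltrDl.
have [r2 r2q] : exists r : rat, (ratr r : R) \in `]q.2, Num.min (q.2 + e) (2 * pi)[.
  by apply: rat_in_itvoo; rewrite lt_min pq3 ltrDl e0'.
move: r1q r2q; rewrite !in_itv/= lt_min => /andP[a1 a2] /and3P[a3 a4 a5].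
have pr : param_space (rq (r1, r2)).
  by split; [exact: lt_trans a1|rewrite /= a5 (ltW (le_lt_trans pq2 a3))].
have := He (rq (r1, r2)) _ pr.
have -> : L (rq (r1, r2)) w = F w (rq (r1, r2)).
  by apply: (Lr (pickle (r1, r2)) (r1, r2)) => //; exact: pickleK.
rewrite subrr subr0 ltxx => h; have {}h := h _; suff : false by [].
apply: h; split; rewrite /ball/= ltr0_norm ?subr_lt0// opprB ltrBlDl//.
Unshelve. all: by end_near. Qed.

End likelihood_field.

(** * From characteristic functions to continuous functions *)

Section bernstein.
Context {R : realType}.
Implicit Types (f : nat -> R) (t c : R) (n : nat).

(* The expectation of [f] at a binomial variable with parameters [n] and [t], as a
   polynomial in [t]; the recursion conditions on the first trial. *)
Fixpoint bernstein n f : {poly R} :=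
  if n is m.+1 then (1 - 'X) * bernstein m f + 'X * bernstein m (f \o S) else (f 0)%:P.

Lemma bernsteinS n f t : (bernstein n.+1 f).[t] =
  (1 - t) * (bernstein n f).[t] + t * (bernstein n (f \o S)).[t].
Proof. by rewrite /= !hornerE. Qed.

Lemma bernstein_le n f g t : 0 <= t <= 1 -> (forall k, (k <= n)%N -> f k <= g k) ->
  (bernstein n f).[t] <= (bernstein n g).[t].
Proof.
move=> /andP[t0 t1]; elim: n f g => [|n IH] f g fg; first by rewrite /= !hornerC fg.
rewrite !bernsteinS lerD// ler_wpM2l ?subr_ge0//; apply: IH => k kn; apply: fg.
  exact: leq_trans kn _.
by rewrite ltnS.
Qed.

Lemma bernsteinD n f g t :
  (bernstein n (fun k => f k + g k)).[t] = (bernstein n f).[t] + (bernstein n g).[t].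
Proof.
elim: n f g => [|n IH] f g; first by rewrite /= !hornerC.
by rewrite !bernsteinS IH (IH (f \o S) (g \o S)); ring.
Qed.

Lemma bernsteinZ n f t c : (bernstein n (fun k => c * f k)).[t] = c * (bernstein n f).[t].
Proof.
elim: n f => [|n IH] f; first by rewrite /= !hornerC.
by rewrite !bernsteinS IH (IH (f \o S)); ring.
Qed.

Lemma bernstein_cst n c t : (bernstein n (fun=> c)).[t] = c.
Proof.
elim: n => [|n IH]; first by rewrite /= hornerC.
by rewrite bernsteinS IH; ring.
Qed.

Lemma bernstein_variance n c t :
  (bernstein n (fun k => (k%:R - c) ^+ 2)).[t] = n%:R * (t * (1 - t)) + (n%:R * t - c) ^+ 2.
Proof.
elim: n c => [|n IH] c; first by rewrite /= hornerC; ring.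
rewrite bernsteinS IH; have -> : bernstein n ((fun k => (k%:R - c) ^+ 2) \o S) =
    bernstein n (fun k => (k%:R - (c - 1)) ^+ 2).
  by congr bernstein; apply: funext => k /=; rewrite -natr1; ring.
by rewrite IH -natr1; ring.
Qed.

Lemma bernstein_norm_le n f t (M : R) : 0 <= t <= 1 -> (forall k, (k <= n)%N -> `|f k| <= M) ->
  `|(bernstein n f).[t]| <= M.
Proof.
move=> t01 fM; rewrite ler_norml; apply/andP; split.
  rewrite -[leLHS](bernstein_cst n _ t); apply: bernstein_le => // k kn.
  by have := fM k kn; rewrite ler_norml => /andP[].
rewrite -[leRHS](bernstein_cst n _ t); apply: bernstein_le => // k kn.
by have := fM k kn; rewrite ler_norml => /andP[].
Qed.

(** Bernstein's proof of the Weierstrass theorem. The approximant keeps the bound [M] of [h], which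
    later controls the contribution of tails. *)
Lemma bernstein_approx (h : R -> R) (M e : R) : {within `[0, 1], continuous h} ->
  (forall t, `|h t| <= M) -> 0 < e ->
  exists q : {poly R}, forall t, 0 <= t <= 1 -> `|q.[t] - h t| <= e /\ `|q.[t]| <= M.
Proof.
move=> ch hM e0.
have M0 : 0 <= M by apply: le_trans (hM 0).
have e20 : 0 < e / 2 by rewrite divr_gt0.
have [r r0 hr] := heine_cantor ch e20.
(* Far from t the difference is at most 2 M <= K (k / n - t)^2, and the binomial variance makes the
   mean of this at most K / n. *)
pose K := 2 * M / r ^+ 2.
have r20 : 0 < r ^+ 2 by rewrite exprn_gt0.
have K0 : 0 <= K by apply: divr_ge0; [exact: mulr_ge0|exact: ltW].
pose n := (Num.truncn (2 * K / e)).+1.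
have n0 : 0 < n%:R :> R by rewrite ltr0n.
have Kn : K / n%:R <= e / 2.
  rewrite ler_pdivrMr//; have : 2 * K / e < n%:R by exact: truncnS_gt.
  by rewrite ltr_pdivrMr// => h1; lra.
pose f k := h (k%:R / n%:R).
exists (bernstein n f) => t t01; split; last by apply: bernstein_norm_le => // k _; exact: hM.
have bnd k : (k <= n)%N -> `|f k - h t| <= e / 2 + K * (k%:R / n%:R - t) ^+ 2.
  move=> kn; have [kr|kr] := ltP `|k%:R / n%:R - t| r.
    apply: (@le_trans _ _ (e / 2)); last by rewrite lerDl mulr_ge0// sqr_ge0.
    apply: hr => //.
    by rewrite in_itv/= divr_ge0 ?ler0n//= ler_pdivrMr// mul1r ler_nat.
  apply: (@le_trans _ _ (2 * M)).
    by apply: le_trans (ler_normB _ _) _; have := hM (k%:R / n%:R); have := hM t; rewrite /f; lra.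
  apply: (@le_trans _ _ (K * (k%:R / n%:R - t) ^+ 2)); last by rewrite lerDr ltW.
  rewrite /K mulrAC ler_pdivlMr// ler_wpM2l ?mulr_ge0// -[leRHS]real_normK ?num_real//.
  by rewrite lerXn2r ?nnegrE// ltW.
have -> : (bernstein n f).[t] - h t = (bernstein n (fun k => f k + - h t)).[t].
  by rewrite bernsteinD bernstein_cst.
have V : (bernstein n (fun k => e / 2 + K * (k%:R / n%:R - t) ^+ 2)).[t] <= e.
  have -> : (fun k : nat => e / 2 + K * (k%:R / n%:R - t) ^+ 2) =
      (fun k : nat => e / 2 + (K / n%:R ^+ 2) * (k%:R - n%:R * t) ^+ 2).
    by apply: funext => k; field; rewrite gt_eqF.
  rewrite bernsteinD bernstein_cst bernsteinZ bernstein_variance subrr expr0n/= addr0.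
  have -> : K / n%:R ^+ 2 * (n%:R * (t * (1 - t))) = K / n%:R * (t * (1 - t)).
    by field; rewrite gt_eqF.
  move: t01 => /andP[? ?]; have : K / n%:R * (t * (1 - t)) <= K / n%:R.
    apply: ler_piMr; first exact: divr_ge0.
    by have := sqr_ge0 t; rewrite expr2 => t2; lra.
  by lra.
rewrite ler_norml; apply/andP; split.
  rewrite lerNl -mulN1r -bernsteinZ; apply: le_trans V; apply: bernstein_le => // k kn.
  by rewrite mulN1r; apply: le_trans (bnd k kn); rewrite -normrN; exact: ler_norm.
apply: le_trans V; apply: bernstein_le => // k kn.
by apply: le_trans (bnd k kn); exact: ler_norm.
Qed.

(** On [- A, A] the variable x is recovered from sin (x / (2 A)) by the arcsine, so g becomes a
    continuous function of the sine, approximated by a polynomial. Periodicity keeps the bound [M]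
    on the whole line. *)
Lemma trig_approx (g : R -> R) (M A e : R) : continuous g -> (forall x, `|g x| <= M) ->
  0 < A -> 0 < e -> exists q : {poly R},
  (forall x, `|x| <= A -> `|q.[sin ((2 * A)^-1 * x)] - g x| <= e) /\
  forall x, `|q.[sin ((2 * A)^-1 * x)]| <= M.
Proof.
move=> cg gM A0 e0.
have pi2 := @pi_ge2 R.
pose L := 2 * A; have L0 : 0 < L by rewrite mulr_gt0.
pose s1 : R := sin (1 / 2).
have pi_in (x : R) : `|x| <= 1 / 2 -> x \in `[(- (pi / 2)), (pi / 2)].
  by rewrite ler_norml in_itv/= => /andP[? ?]; apply/andP; split; lra.
have half_in : (1 / 2 : R) \in `[(- (pi / 2)), (pi / 2)] by apply: pi_in; rewrite ger0_norm.
have s10 : 0 < s1 by apply: sin_gt0_pihalf; apply/andP; split; lra.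
have s11 : s1 < 1.
  by rewrite -(@sin_pihalf R) ltr_sin//; [lra|rewrite in_itv/=; apply/andP; split; lra].
(* The clamp keeps the argument inside ]-1, 1[, where the arcsine is continuous, and is the identity
   on the values of sin at |y| <= 1 / 2. *)
pose cl (s : R) := Num.max (- s1) (Num.min s s1).
have cl_in s : - s1 <= cl s <= s1.
  by rewrite le_max lexx/= ge_max ge_min lexx orbT andbT; lra.
pose h t := g (L * asin (cl (2 * t - 1))).
have ch : continuous h.
  move=> t; apply: (@continuous_comp _ _ _ (fun t => L * asin (cl (2 * t - 1))) g); last exact: cg.
  apply: cvgMl_tmp.
  apply: (@continuous_comp _ _ _ (fun t => cl (2 * t - 1)) (@asin R)).
    apply: (@continuous_comp _ _ _ (fun t => 2 * t - 1) cl).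
      by apply: cvgB; [apply: cvgMl_tmp; exact: cvg_id|exact: cvg_cst].
    apply: continuous_max; first exact: cvg_cst.
    by apply: continuous_min; [exact: cvg_id|exact: cvg_cst].
  by apply: continuous_asin; have /andP[h1 h2] := cl_in (2 * t - 1); apply/andP; split; lra.
have [q0 hq] := bernstein_approx (continuous_subspaceT ch) (fun t => gM _) e0.
exists (q0 \Po (2^-1 *: (1 + 'X))).
have tE s : (2^-1 *: (1 + 'X) : {poly R}).[s] = (1 + s) / 2 by rewrite !hornerE mulrC.
have t01 (y : R) : 0 <= (1 + sin y) / 2 <= 1.
  by have := sin_geN1 y; have := sin_le1 y => h1 h2; apply/andP; split; lra.
split=> x; last by rewrite horner_comp tE; have [] := hq _ (t01 (L^-1 * x)).
move=> xA; rewrite horner_comp tE; have [+ _] := hq _ (t01 (L^-1 * x)).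
suff -> : h ((1 + sin (L^-1 * x)) / 2) = g x by [].
rewrite /h; have -> : 2 * ((1 + sin (L^-1 * x)) / 2) - 1 = sin (L^-1 * x) by field.
set y := L^-1 * x.
have y2 : `|y| <= 1 / 2.
  by rewrite /y normrM gtr0_norm ?invr_gt0// mulrC ler_pdivrMr// /L; lra.
have yin := pi_in _ y2.
have Nhalf_in : (- (1 / 2) : R) \in `[(- (pi / 2)), (pi / 2)] by apply: pi_in; rewrite normrN ger0_norm.
have -> : cl (sin y) = sin y.
  move: y2; rewrite ler_norml => /andP[y21 y22].
  have h1 : sin y <= s1 by rewrite leNgt ltr_sin// -leNgt.
  have h2 : - s1 <= sin y by rewrite /s1 -sinN leNgt ltr_sin// -leNgt.
  by rewrite /cl min_l// max_r.
by rewrite sinK// /y mulrA divff ?mul1r// gt_eqF.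
Qed.

End bernstein.

Section expectation_of_trigonometric_polynomials.
Context {R : realType} {d d' : measure_display} {T : measurableType d} {T' : measurableType d'}.
Variables (P : probability T R) (Q : probability T' R) (X : T -> R) (Y : T' -> R).
Hypothesis mX : measurable_fun setT X.
Hypothesis mY : measurable_fun setT Y.
Variables (U D : R).
Hypothesis cos_close : forall u b, `|u| <= U ->
  `|\int[P]_w cos (u * X w + b) - \int[Q]_w cos (u * Y w + b)| <= D.

Lemma sin_mul_cos (x y : R) :
  sin x * cos y = 2^-1 * cos (y + x - pi / 2) + - 2^-1 * cos (y - x - pi / 2).
Proof. by rewrite !cosBpihalf !sinD sinN cosN; field. Qed.

Lemma bmf_sinXcos {d0} {T0 : measurableType d0} (Z : T0 -> R) u m v b : measurable_fun setT Z ->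
  bmf (fun w => sin (u * Z w) ^+ m * cos (v * Z w + b)).
Proof.
move=> mZ; apply: bmfM.
  by apply: bmfX; apply: bmf_sin; exact: measurable_funM.
by apply: bmf_cos; apply: measurable_funD => //; exact: measurable_funM.
Qed.

(** Each factor sin trades one power for the frequencies v + u and v - u, with weights of total
    absolute value 1, so the error [D] does not grow while the frequencies stay below [U]. *)
Lemma expectation_sinXcos u : 0 <= u -> forall m v b, `|v| + m%:R * u <= U ->
  `|\int[P]_w (sin (u * X w) ^+ m * cos (v * X w + b)) -
    \int[Q]_w (sin (u * Y w) ^+ m * cos (v * Y w + b))| <= D.
Proof.
move=> u0; elim=> [|m IH] v b vU.
  rewrite mul0r addr0 in vU.
  under eq_Rintegral do rewrite expr0 mul1r.
  under [in X in _ - X]eq_Rintegral do rewrite expr0 mul1r.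
  exact: cos_close.
have E d0 (T0 : measurableType d0) (P0 : probability T0 R) (Z : T0 -> R) : measurable_fun setT Z ->
    \int[P0]_w (sin (u * Z w) ^+ m.+1 * cos (v * Z w + b)) =
    2^-1 * \int[P0]_w (sin (u * Z w) ^+ m * cos ((v + u) * Z w + (b - pi / 2)))
    + - 2^-1 * \int[P0]_w (sin (u * Z w) ^+ m * cos ((v - u) * Z w + (b - pi / 2))).
  move=> mZ; rewrite -!ExZ; [|exact: bmf_sinXcos..].
  rewrite -ExD; [|by apply: bmfZ; exact: bmf_sinXcos..].
  apply: eq_Rintegral => w _; rewrite exprSr -mulrA sin_mul_cos.
  have -> : v * Z w + b + u * Z w - pi / 2 = (v + u) * Z w + (b - pi / 2) by ring.
  have -> : v * Z w + b - u * Z w - pi / 2 = (v - u) * Z w + (b - pi / 2) by ring.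
  by ring.
rewrite (E _ _ P X mX) (E _ _ Q Y mY).
have vU1 : `|v + u| + m%:R * u <= U.
  by apply: le_trans vU; apply: le_trans (lerD (ler_normD _ _) (lexx _)) _; rewrite (ger0_norm u0) -natr1; lra.
have vU2 : `|v - u| + m%:R * u <= U.
  by apply: le_trans vU; apply: le_trans (lerD (ler_normB _ _) (lexx _)) _; rewrite (ger0_norm u0) -natr1; lra.
have := IH _ (b - pi / 2) vU1; have := IH _ (b - pi / 2) vU2.
rewrite !ler_norml => /andP[? ?] /andP[? ?]; apply/andP; split; lra.
Qed.

Lemma expectation_poly_sin (q : {poly R}) u : 0 <= u -> (size q)%:R * u <= U ->
  `|\int[P]_w q.[sin (u * X w)] - \int[Q]_w q.[sin (u * Y w)]| <= (\sum_(i < size q) `|q`_i|) * D.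
Proof.
move=> u0 qU.
have E d0 (T0 : measurableType d0) (P0 : probability T0 R) (Z : T0 -> R) : measurable_fun setT Z ->
    \int[P0]_w q.[sin (u * Z w)] =
    \sum_(i < size q) q`_i * \int[P0]_w (sin (u * Z w) ^+ i * cos (0 * Z w + 0)).
  move=> mZ; under eq_Rintegral do rewrite horner_coef.
  rewrite (Ex_sum P0 (X := fun i w => q`_i * sin (u * Z w) ^+ i)); last first.
    by move=> i _; apply: bmfZ; apply: bmfX; apply: bmf_sin; exact: measurable_funM.
  apply: eq_bigr => i _; rewrite -ExZ; last exact: bmf_sinXcos.
  by apply: eq_Rintegral => w _; rewrite mul0r addr0 cos0 mulr1.
rewrite (E _ _ P X mX) (E _ _ Q Y mY) -sumrB mulr_suml.
apply: le_trans (ler_norm_sum _ _ _) _; apply: ler_sum => i _.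
rewrite -mulrBr normrM ler_wpM2l//; apply: expectation_sinXcos => //.
by rewrite normr0 add0r (le_trans _ qU)// ler_wpM2r// ler_nat ltnW.
Qed.

End expectation_of_trigonometric_polynomials.

(** * Tightness and a quantitative continuity theorem *)

Section tightness.
Context {R : realType} {d : measure_display} {T : measurableType d}.
Variables (P : probability T R) (X : T -> R).
Hypothesis mX : measurable_fun setT X.

Lemma characteristic_tight (v vmax k eta : R) : 0 <= v <= vmax -> 0 <= k -> 0 <= eta <= 1 ->
  (forall u, `|\int[P]_w cos (u * X w + 0) - cos 0 * expR (- (u ^+ 2 / 2 * v))|
    <= k * u ^+ 2 * expR (k * u ^+ 2) * eta) ->
  forall A, 0 < A -> mostly P (4 * (vmax / 2 + k * expR k) / A ^+ 2) (fun w => `|X w| < A).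
Proof.
move=> /andP[v0 vv] k0 /andP[eta0 eta1] H A A0.
pose C := 4 * (vmax / 2 + k * expR k).
have A20 : 0 < A ^+ 2 by rewrite exprn_gt0.
(* 1 - cos (u X) controls (u X)^2 only where |u X| <= 1/4, so large values of X are
   reached by letting u = 1 / (4 (n + 1)) tend to 0. *)
pose B n := [set w | A <= `|X w|] `&` [set w | `|X w| <= n.+1%:R].
have mAX : measurable [set w | A <= `|X w|].
  by apply: measurable_set_le => //; exact: measurableT_comp.
have mB n : measurable (B n) by apply: measurableI => //; exact: measurable_norm_le.
have PB n : (P (B n) <= (C / A ^+ 2)%:E)%E.
  pose u : R := (4 * n.+1%:R)^-1.
  have n0 : 0 < n.+1%:R :> R by rewrite ltr0n.
  have u0 : 0 < u by rewrite invr_gt0 mulr_gt0.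
  have u1 : u <= 1.
    by rewrite invf_le1 ?mulr_gt0// -[leLHS]mulr1 ler_pM// ?ler1n// ler1n.
  have u2 : 0 < u ^+ 2 by rewrite exprn_gt0.
  have u21 : u ^+ 2 <= 1 by rewrite expr_le1// ltW.
  have bc : bmf (fun w => cos (u * X w + 0)).
    by apply: bmf_cos; apply: measurable_funD => //; exact: measurable_funM.
  have b1c : bmf (fun w => 4 * (1 - cos (u * X w + 0))).
    by apply: bmfZ; apply: bmfB => //; exact: bmf_cst.
  have h1 : u ^+ 2 * A ^+ 2 * fine (P (B n)) <= 4 * (1 - \int[P]_w cos (u * X w + 0)).
    rewrite -[X in 1 - X]/(\int[P]_w cos (u * X w + 0)).
    have -> : 4 * (1 - \int[P]_w cos (u * X w + 0)) = \int[P]_w (4 * (1 - cos (u * X w + 0))).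
      rewrite ExZ; last by apply: bmfB => //; exact: bmf_cst.
      by rewrite ExB ?Ex_cst//; exact: bmf_cst.
    rewrite -Ex_indic// -ExZ; last exact: bmf_indic.
    apply: Ex_le => //; first by apply: bmfZ; exact: bmf_indic.
    move=> w; rewrite indicE; have [wB|_] := boolP (w \in B n); last first.
      by rewrite mulr0 mulr_ge0// subr_ge0 cos_le1.
    move: wB; rewrite inE => -[/= Aw wn]; rewrite mulr1 addr0.
    apply: le_trans (sqr_le_cos _); last first.
      by rewrite normrM (gtr0_norm u0) mulrC ler_pdivrMr ?mulr_gt0//; lra.
    rewrite exprMn ler_pM2l// -[leRHS]real_normK ?num_real// lerXn2r ?nnegrE// ltW//.
  have := H u; rewrite cos0 mul1r => h2.
  have h3 : 1 - u ^+ 2 / 2 * v <= expR (- (u ^+ 2 / 2 * v)) by have := expR_ge1Dx (- (u ^+ 2 / 2 * v)).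
  have h4 : k * u ^+ 2 * expR (k * u ^+ 2) * eta <= u ^+ 2 * (k * expR k).
    have ek : expR (k * u ^+ 2) <= expR k by rewrite ler_expR ler_piMr.
    have ku : 0 <= k * u ^+ 2 by rewrite mulr_ge0// ltW.
    apply: (@le_trans _ _ (k * u ^+ 2 * expR (k * u ^+ 2))).
      by rewrite ler_piMr// mulr_ge0// expR_ge0.
    by have := ler_wpM2l ku ek; lra.
  have h5 : u ^+ 2 / 2 * v <= u ^+ 2 * (vmax / 2).
    have -> : u ^+ 2 / 2 * v = u ^+ 2 * (v / 2) by ring.
    by rewrite ler_pM2l// ler_pM2r.
  have h6 : u ^+ 2 * (A ^+ 2 * fine (P (B n))) <= u ^+ 2 * C.
    move: h2; rewrite ler_norml => /andP[h2 _]; rewrite /C mulrA; lra.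
  rewrite -(prob_fineK P (mB n)) lee_fin ler_pdivlMr// mulrC.
  by rewrite ler_pM2l in h6.
have UB : \bigcup_n B n = [set w | A <= `|X w|].
  apply/seteqP; split => [w [n _ []]//|w Aw].
  exists (Num.truncn `|X w|) => //; split => //=; exact: ltW (truncnS_gt _).
have cB : P \o B @ \oo --> P (\bigcup_n B n).
  apply: nondecreasing_cvg_mu => //; first by rewrite UB.
  move=> m n mn; apply/subsetPset => w [h1 h2]; split => //=.
  by apply: le_trans h2 _; rewrite ler_nat ltnS.
apply: (mostly_set mAX) => [|w /negP]; last by rewrite -ltNge.
rewrite -UB -(cvg_lim _ cB)//; apply: lime_le; first by apply/cvg_ex; eexists; exact: cB.
by apply: nearW => n; exact: PB.
Qed.

End tightness.
Section levy.
Context {R : realType}.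

Lemma Ex_dist {d : measure_display} {T : measurableType d} (P : probability T R) (X Y : T -> R) (M c e : R) :
  bmf X -> bmf Y -> (forall w, `|X w| <= M) -> (forall w, `|Y w| <= M) -> 0 <= c ->
  mostly P e (fun w => `|X w - Y w| <= c) ->
  `|\int[P]_w X w - \int[P]_w Y w| <= c + 2 * M * e.
Proof.
move=> bX bY XM YM c0 H; rewrite -ExB//; apply: le_trans (Ex_abs P (bmfB bX bY)) _.
apply: mostly_Ex => //; first exact: bmfB.
by move=> w; apply: le_trans (ler_normB _ _) _; have := XM w; have := YM w; lra.
Qed.

(** Levy's continuity theorem joined to Slutsky's, with [eta] chosen before the probability space
    and the variance: [g] is replaced by a polynomial in a sine, for which closeness of
    characteristic functions suffices. *)
Lemma levy_slutsky (g : R -> R) (vmax k eps : R) : continuous g -> bounded_fun g ->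
  0 < vmax -> 0 <= k -> 0 < eps ->
  exists2 eta : R, 0 < eta & forall (d : measure_display) (T : measurableType d)
    (P : probability T R) (X Z : T -> R) (v : R),
  measurable_fun setT X -> measurable_fun setT Z -> 0 < v <= vmax ->
  (forall u b, `|\int[P]_w cos (u * X w + b) - cos b * expR (- (u ^+ 2 / 2 * v))|
    <= k * u ^+ 2 * expR (k * u ^+ 2) * eta) ->
  mostly P eta (fun w => `|Z w - X w| <= eta) ->
  `|\int[P]_w g (Z w) - \int[normal_prob 0 (Num.sqrt v)]_x g x| <= eps.
Proof.
move=> cg bg vmax0 k0 eps0.
have [M M0 gM] : exists2 M : R, 0 < M & forall x, `|g x| <= M.
  have [M0 [_ hM]] := bg; exists (`|M0| + 1); first by rewrite ltr_wpDl.
  by move=> x; apply: hM => //; rewrite (le_lt_trans (ler_norm _))// ltrDl.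
(* 5 for passing from [Z] to [X], 3 for the approximation of [g] under each of the two laws, and 1
   for comparing the polynomials. *)
pose e := eps / 12.
have e0 : 0 < e by rewrite divr_gt0.
pose C := 4 * (vmax / 2 + k * expR k).
have C0 : 0 < C by rewrite mulr_gt0// ltr_wpDr ?divr_gt0// mulr_ge0// expR_ge0.
pose A := 1 + C * M / e.
have CMe : 0 < C * M / e by rewrite divr_gt0// mulr_gt0.
have A1 : 1 <= A by rewrite lerDl ltW.
have A0 : 0 < A by apply: lt_le_trans A1.
have CA : C / A ^+ 2 <= e / M.
  rewrite ler_pdivrMr ?exprn_gt0// mulrAC ler_pdivlMr// mulrC.
  have : C * M / e <= A by rewrite lerDr.
  rewrite ler_pdivrMr// mulrC => h; apply: le_trans h _.
  by rewrite [leRHS]mulrC ler_pM2r// expr2 ler_peMl// ltW.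
have [r r0 gr] := heine_cantor (continuous_subspaceT cg : {within `[- (A + 1), A + 1], continuous g}) e0.
have [q [qA qM]] := trig_approx cg gM A0 e0.
pose u := (2 * A)^-1.
have u0 : 0 <= u by rewrite invr_ge0 mulr_ge0// ltW.
pose U := (size q)%:R * u.
have U0 : 0 <= U by rewrite mulr_ge0.
pose S := \sum_(i < size q) `|q`_i|.
have S0 : 0 <= S by apply: sumr_ge0.
pose KU := k * U ^+ 2 * expR (k * U ^+ 2).
have KU0 : 0 <= KU by rewrite mulr_ge0 ?expR_ge0// mulr_ge0// sqr_ge0.
have SK : 0 < (1 + S) * (1 + KU) by rewrite mulr_gt0// ltr_wpDr.
(* In order: values stay in [- (A + 1), A + 1], uniform continuity applies, the exceptional set
   costs little, and the characteristic error survives multiplication by the coefficients of [q]. *)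
pose eta := Num.min (Num.min 1 (r / 2)) (Num.min (e / M) (e / ((1 + S) * (1 + KU)))).
have eta0 : 0 < eta by rewrite !lt_min ltr01 !divr_gt0.
have eta1 : eta <= 1 by rewrite !ge_min lexx.
have etar : eta < r.
  by apply: (@le_lt_trans _ _ (r / 2)); [rewrite !ge_min lexx orbT|rewrite gtr_pMr// invf_lt1// ltr1n].
have etae : eta <= e / M by rewrite !ge_min lexx !orbT.
have etaS : S * (KU * eta) <= e.
  have : eta <= e / ((1 + S) * (1 + KU)) by rewrite !ge_min lexx !orbT.
  rewrite ler_pdivlMr// => h; apply: le_trans h.
  rewrite mulrA mulrC ler_pM2l//; have := mulr_ge0 S0 KU0; lra.
exists eta => // d T P X Z v mX mZ /andP[v0 vv] hchar hZ.
have mg : measurable_fun setT g by exact: continuous_measurable_fun.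
pose nu : probability (measurableTypeR R) R := normal_prob 0 (Num.sqrt v).
pose Y : measurableTypeR R -> R := id.
have mY : measurable_fun setT Y by exact: measurable_id.
have sv0 : Num.sqrt v != 0 by rewrite gt_eqF// sqrtr_gt0.
have charY s b : \int[nu]_w cos (s * Y w + b) = cos b * expR (- (s ^+ 2 / 2 * v)).
  rewrite (normal_char sv0) sqr_sqrtr ?(ltW v0)//; congr (_ * expR _); ring.
have bnd d0 (T0 : measurableType d0) (P0 : probability T0 R) (X0 : T0 -> R) :
    measurable_fun setT X0 -> mostly P0 (C / A ^+ 2) (fun w => `|X0 w| < A) ->
    `|\int[P0]_w g (X0 w) - \int[P0]_w q.[sin (u * X0 w)]| <= 3 * e.
  move=> mX0 H.
  have -> : 3 * e = e + 2 * M * (e / M) by field; rewrite gt_eqF.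
  apply: (@Ex_dist _ _ P0 (fun w => g (X0 w)) (fun w => q.[sin (u * X0 w)])).
  - by split; [exact: measurableT_comp|exists M].
  - split; last by exists M => w; exact: qM.
    suff [] : bmf (fun w => q.[sin (u * X0 w)]) by [].
    under eq_fun do rewrite horner_coef.
    apply: (bmf_sum (X := fun i w => q`_i * sin (u * X0 w) ^+ i)) => i _.
    by apply: bmfZ; apply: bmfX; apply: bmf_sin; exact: measurable_funM.
  - by move=> w; exact: gM.
  - by move=> w; exact: qM.
  - exact: ltW.
  - by apply: mostly_mono H => // w /ltW /qA; rewrite distrC.
have v0max : 0 <= v <= vmax by rewrite ltW.
have tX : mostly P (C / A ^+ 2) (fun w => `|X w| < A).
  apply: (characteristic_tight mX v0max k0 _ _ A0); last by move=> s; exact: hchar.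
  by rewrite ltW.
have tY : mostly nu (C / A ^+ 2) (fun w => `|Y w| < A).
  apply: (@characteristic_tight _ _ _ nu Y mY v vmax k 0) => //; first by rewrite lexx ler01.
  by move=> s; rewrite charY subrr normr0 mulr0.
have h1 : `|\int[P]_w g (Z w) - \int[P]_w g (X w)| <= 5 * e.
  have -> : 5 * e = e + 2 * M * (e / M + e / M) by field; rewrite gt_eqF.
  apply: (@Ex_dist _ _ P (fun w => g (Z w)) (fun w => g (X w))).
  - by split; [exact: measurableT_comp|exists M].
  - by split; [exact: measurableT_comp|exists M].
  - by move=> w; exact: gM.
  - by move=> w; exact: gM.
  - exact: ltW.
  apply: mostly_mono (mostlyI hZ tX); first exact: lerD.
  move=> w [zx xA]; apply: gr.
  - rewrite in_itv/= -ler_norml; have -> : Z w = X w + (Z w - X w) by ring.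
    by apply: le_trans (ler_normD _ _) _; apply: lerD; [exact: ltW|exact: le_trans zx eta1].
  - by rewrite in_itv/= -ler_norml; move: xA; lra.
  - exact: le_lt_trans zx etar.
have h2 := bnd _ _ P X mX tX; have h3 := bnd _ _ nu Y mY tY.
have h4 : `|\int[P]_w q.[sin (u * X w)] - \int[nu]_w q.[sin (u * Y w)]| <= e.
  apply: le_trans etaS.
  apply: (@expectation_poly_sin _ _ _ _ _ P nu X Y mX mY U) => // s b sU.
  rewrite charY; apply: le_trans (hchar s b) _.
  have s2 : s ^+ 2 <= U ^+ 2 by rewrite -real_normK ?num_real// lerXn2r// nnegrE.
  have ks : k * s ^+ 2 <= k * U ^+ 2 by rewrite ler_wpM2l.
  rewrite ler_pM2r// /KU; apply: ler_pM => //; last by rewrite ler_expR.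
    by apply: mulr_ge0 => //; exact: sqr_ge0.
have -> : eps = 5 * e + (3 * e + (e + 3 * e)) by rewrite /e; field.
move: h1 h2 h3 h4; rewrite -[\int[normal_prob _ _]_x _]/(\int[nu]_w g (Y w)).
set i1 := \int[P]_w g (Z w); set i2 := \int[P]_w g (X w); set i3 := \int[P]_w _.
set i4 := \int[nu]_w g _; set i5 := \int[nu]_w _ => h1 h2 h3 h4.
have -> : i1 - i4 = (i1 - i2) + ((i2 - i3) + ((i3 - i5) + (i5 - i4))) by ring.
apply: le_trans (ler_normD _ _) _; apply: lerD => //.
apply: le_trans (ler_normD _ _) _; apply: lerD => //.
apply: le_trans (ler_normD _ _) _; apply: lerD => //.
by rewrite distrC.
Qed.

End levy.

(** * Asymptotic normality *)

Section normalized_estimators.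
Context {R : realType}.

Lemma measurable_angle : measurable_fun setT (@angle R).
Proof.
apply: measurable_funB => //; apply: measurable_funM => //.
apply: nondecreasing_measurable => // x y xy; rewrite ler_int le_ceil//.
by rewrite ler_pM2r ?invr_gt0 ?mulr_gt0 ?pi_gt0// lerD2r.
Qed.

(** (1 - be) / 2 = (I_0 - I_2) / (2 I_0) is at least 1 / (2 I_0), and I_0 is bounded for
    [lam <= l1]; hence a common lower bound for both limiting informations. *)
Lemma bessel_ratio (l1 sg : R) : 0 < l1 -> 0 < sg ->
  exists2 v0, 0 < v0 & forall lam, 0 < lam -> lam <= l1 ->
    let be := besselI 2 (2 * lam / sg ^+ 2) / besselI 0 (2 * lam / sg ^+ 2) in
    [/\ 0 <= be <= 1, v0 <= (1 - be) / 2 & v0 <= (1 + be) / 2].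
Proof.
move=> l10 sg0.
have sg2 : 0 < sg ^+ 2 by rewrite exprn_gt0.
pose B := expR (l1 / sg ^+ 2) * expR ((l1 / sg ^+ 2) ^+ 2).
have B0 : 0 < B by rewrite mulr_gt0 ?expR_gt0.
exists (2 * B)^-1; first by rewrite invr_gt0 mulr_gt0.
move=> lam lam0 laml be.
pose kap := 2 * lam / sg ^+ 2.
have kap0 : 0 < kap by rewrite divr_gt0// mulr_gt0.
have I01 := besselI0_ge1 kap0; have I2 := besselI_ge0 kap0 2; have I02 := besselI2_lt kap0.
have I00 : 0 < besselI 0 kap by apply: lt_le_trans I01.
have I0B : besselI 0 kap <= B.
  apply: le_trans (besselI_le kap0 0) _.
  have y0 : 0 <= kap / 2 by rewrite divr_ge0// ltW.
  have yl : kap / 2 <= l1 / sg ^+ 2.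
    have -> : kap / 2 = lam / sg ^+ 2 by rewrite /kap; field; rewrite gt_eqF.
    by rewrite ler_pM2r ?invr_gt0.
  have l1s : 0 <= l1 / sg ^+ 2 by apply: le_trans yl.
  by apply: ler_pM; rewrite ?expR_ge0 ?ler_expR// lerXn2r.
have be0 : 0 <= be by rewrite divr_ge0// ltW.
have bev : (2 * B)^-1 <= (1 - be) / 2.
  have -> : (1 - be) / 2 = (besselI 0 kap - besselI 2 kap) / (2 * besselI 0 kap).
    by rewrite /be -/kap; field; rewrite gt_eqF.
  apply: (@le_trans _ _ (2 * besselI 0 kap)^-1).
    have k2 : 0 < 2 * besselI 0 kap by exact: mulr_gt0.
    have B2 : 0 < 2 * B by exact: mulr_gt0.
    by rewrite lef_pV2 ?posrE// ler_pM2l.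
  by rewrite ler_peMl// invr_ge0 mulr_ge0// ltW.
have B20 : 0 <= (2 * B)^-1 by rewrite invr_ge0 mulr_ge0// ltW.
by split; [apply/andP; split|exact: bev|]; lra.
Qed.

Lemma half_sum_bounds (be : R) : 0 <= be <= 1 ->
  [/\ - 1 <= be <= 1, (1 - be) / 2 <= 1 & (1 + be) / 2 <= 1].
Proof. by move=> /andP[? ?]; split; [apply/andP; split|..]; lra. Qed.

Lemma mle_asymptotics (sg l0 l1 v0 e : R) : 0 < sg -> 0 < l0 -> 0 < l1 -> 0 < v0 -> 0 < e ->
  (forall lam, 0 < lam -> lam <= l1 ->
    let be := besselI 2 (2 * lam / sg ^+ 2) / besselI 0 (2 * lam / sg ^+ 2) in
    [/\ 0 <= be <= 1, v0 <= (1 - be) / 2 & v0 <= (1 + be) / 2]) ->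
  exists2 T0 : R, 0 < T0 & forall (d : measure_display) (Omega : measurableType d)
    (P : probability Omega R) (p : R * R) (W theta : R -> Omega -> R) (Tm : R)
    (L : R * R -> Omega -> R) (est : Omega -> R * R),
  param_space p -> l0 <= p.1 <= l1 -> T0 <= Tm -> von_mises_process P sg p W theta ->
  log_likelihood P sg theta Tm L -> mle P L est ->
  let be := besselI 2 (2 * p.1 / sg ^+ 2) / besselI 0 (2 * p.1 / sg ^+ 2) in
  exists X1 X2 : Omega -> R, [/\ measurable_fun setT X1 /\ measurable_fun setT X2,
    forall u b, `|\int[P]_w cos (u * X1 w + b) - cos b * expR (- (u ^+ 2 / 2 * ((1 - be) / 2)))|
      <= u ^+ 2 / 4 * expR (u ^+ 2 / 2) * e,
    forall u b, `|\int[P]_w cos (u * X2 w + b) - cos b * expR (- (u ^+ 2 / 2 * ((1 + be) / 2)))|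
      <= u ^+ 2 / 4 * expR (u ^+ 2 / 2) * e,
    mostly P e (fun w => `|Num.sqrt Tm * ((est w).1 - p.1) - sg / ((1 - be) / 2) * X1 w| <= e) &
    mostly P e (fun w => `|Num.sqrt Tm * angle ((est w).2 - p.2)
      - sg / (p.1 * ((1 + be) / 2)) * X2 w| <= e)].
Proof.
move=> sg0 l00 l10 v00 e0 hbe.
pose C : R := 4 * (1 / 2 + 1 * expR 1).
have C0 : 0 < C by rewrite mulr_gt0// addr_gt0// mul1r expR_gt0.
pose A := 1 + 4 * C / e.
have CA0 : 0 < 4 * C / e by rewrite divr_gt0// mulr_gt0.
have A0 : 0 < A by rewrite addr_gt0.
have CA : C / A ^+ 2 <= e / 4.
  rewrite ler_pdivrMr ?exprn_gt0//; have : 4 * C / e <= A ^+ 2.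
    apply: (@le_trans _ _ A); first by rewrite lerDr.
    by rewrite expr2 ler_peMl ?(ltW A0)// lerDl ltW.
  by rewrite ler_pdivrMr// => h; lra.
have [eta2 eta20 [T1 T11 HM]] := mle_expansion l00 v00 sg0 A0 e0.
pose eta := Num.min (Num.min 1 (e / 4)) eta2.
have eta0 : 0 < eta by rewrite !lt_min ltr01 divr_gt0.
have eta1 : eta <= 1 by rewrite !ge_min lexx.
have etae : eta <= e / 4 by rewrite !ge_min lexx !orbT.
have etaE : eta <= e by lra.
(* The probability budget: the approximation, the tails of the two scores beyond [A], and two null
   sets. *)
have tot : eta + (e / 4 + e / 4 + (0 + 0)) <= e by lra.
have eta2E : eta <= eta2 by rewrite !ge_min lexx !orbT.
have eta'0 : 0 < Num.min eta (eta / 2 * (eta / 8)) by rewrite lt_min eta0 mulr_gt0// divr_gt0.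
have [T2 T21 HL] := second_harmonic_L1 sg0 l00 l10 eta'0.
exists (Num.max T1 T2); first by rewrite lt_max (lt_le_trans ltr01 T11).
move=> d Omega P p W theta Tm L est pp /andP[l0p pl1]; rewrite ge_max => /andP[T1m T2m] vM LL ME be.
have p10 : 0 < p.1 := pp.1.
have [/half_sum_bounds[be11 h1 h2] v01 v02] := hbe p.1 p10 pl1; rewrite -/be in be11 h1 h2 v01 v02.
have Tm1 : 1 <= Tm by apply: le_trans T1m.
have Tm0 : 0 < Tm by apply: lt_le_trans Tm1.
have [J1 [J2 [hJ1 hJ2 LE]]] := likelihood_field sg0 Tm0 pp vM LL.
pose x t w := theta t w - p.2.
have bmW : brownian_motion P W by case: vM.
have LLN n b : Tm / n.+1%:R <= 1 -> Tm * (Tm / n.+1%:R) <= 1 ->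
    \int[P]_w `|euler_mean p.1 sg W (x 0) (Tm / n.+1%:R) 2 b n.+1 w - cos b * be|
      <= Num.min eta (eta / 2 * (eta / 8)).
  have nT : n.+1%:R * (Tm / n.+1%:R) = Tm by rewrite mulrCA divff ?mulr1// pnatr_eq0.
  move=> g1 g2; apply: (HL _ _ P W (x 0)) => //; rewrite ?nT//.
  - exact: (shifted_measurable vM).
  - exact: (shifted_indep vM).
  - by rewrite l0p.
  - by rewrite divr_gt0.
have [X1 [X2 [mX1 mX2 c1 c2 HX]]] := euler_approximation p10 sg0 Tm0 bmW
  (shifted_measurable vM) (shifted_indep vM) (shifted_continuous vM) (shifted_equation vM)
  be11 eta0 LLN hJ1 hJ2.
have weaken u : u ^+ 2 / 4 * expR (u ^+ 2 / 2) * eta <= u ^+ 2 / 4 * expR (u ^+ 2 / 2) * e.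
  by rewrite ler_wpM2l// mulr_ge0 ?expR_ge0// divr_ge0// sqr_ge0.
have tight (X : Omega -> R) v : measurable_fun setT X -> v0 <= v -> v <= 1 ->
    (forall u b, `|\int[P]_w cos (u * X w + b) - cos b * expR (- (u ^+ 2 / 2 * v))|
      <= u ^+ 2 / 4 * expR (u ^+ 2 / 2) * eta) -> mostly P (e / 4) (fun w => `|X w| < A).
  move=> mX v0v v1 hc.
  apply: (mostly_mono CA (fun w h => h)).
  apply: (@characteristic_tight _ _ _ P X mX v 1 1 eta) => //.
  - by rewrite v1 andbT (le_trans _ v0v)// ltW.
  - by rewrite (ltW eta0).
  move=> u; apply: le_trans (hc u 0) _; rewrite ler_pM2r//.
  have u2 := sqr_ge0 u; rewrite mul1r; apply: ler_pM; rewrite ?expR_ge0 ?divr_ge0//.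
    by rewrite ler_pdivrMr// ler_peMr// ler1n.
  by rewrite ler_expR ler_pdivrMr// ler_peMr// ler1n.
have t1 := tight _ _ mX1 v01 _ c1; have t2 := tight _ _ mX2 v02 _ c2.
have {}t1 := t1 _; have {}t2 := t2 _.
have e40 : 0 <= e / 4 by rewrite divr_ge0// ltW.
have [mest aest] := ME.
have H := mostlyI HX (mostlyI (mostlyI (t1 h1) (t2 h2))
  (mostlyI (mostly_ae (lexx 0) LE) (mostly_ae (lexx 0) aest))).
have {}H : mostly P e (fun w =>
    `|Num.sqrt Tm * ((est w).1 - p.1) - sg / ((1 - be) / 2) * X1 w| <= e /\
    `|Num.sqrt Tm * angle ((est w).2 - p.2) - sg / (p.1 * ((1 + be) / 2)) * X2 w| <= e).
  apply: mostly_mono tot _ H => w [+ [[/ltW X1A /ltW X2A] [Lw ew]]].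
  move=> /(_ _ _ erefl erefl)[k1 k2 k3 k4].
  have [exm qm] := HM p.2 p.1 be Tm (X1 w) (X2 w) _ _ _ _ (L ^~ w) l0p v01 v02 T1m X1A X2A
    (le_trans k1 eta2E) (le_trans k2 eta2E) (le_trans k3 eta2E) (le_trans k4 eta2E) Lw.
  have [r1 r2] := qm _ (ew exm).
  by split; rewrite mulrAC.
exists X1, X2; split => //.
- by move=> u b; apply: le_trans (weaken u); exact: c1.
- by move=> u b; apply: le_trans (weaken u); exact: c2.
- by apply: mostly_mono H => // w [].
- by apply: mostly_mono H => // w [].
Qed.

Lemma scaled_levy (g : R -> R) (cmax eps : R) : continuous g -> bounded_fun g ->
  0 < cmax -> 0 < eps ->
  exists2 eta : R, 0 < eta & forall (d : measure_display) (T : measurableType d)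
    (P : probability T R) (X Z : T -> R) (c v : R),
  measurable_fun setT X -> measurable_fun setT Z -> 0 < c <= cmax -> 0 < v <= 1 ->
  (forall u b, `|\int[P]_w cos (u * X w + b) - cos b * expR (- (u ^+ 2 / 2 * v))|
    <= u ^+ 2 / 4 * expR (u ^+ 2 / 2) * eta) ->
  mostly P eta (fun w => `|Z w - c * X w| <= eta) ->
  `|\int[P]_w g (Z w) - \int[normal_prob 0 (Num.sqrt (c ^+ 2 * v))]_x g x| <= eps.
Proof.
move=> cg bg cmax0 eps0.
have cm2 : 0 < cmax ^+ 2 by rewrite exprn_gt0.
have [eta eta0 H] := levy_slutsky cg bg cm2 (ltW cm2) eps0.
exists eta => // d T P X Z c v mX mZ /andP[c0 cm] /andP[v0 v1] hc hZ.
have c2 : 0 < c ^+ 2 by rewrite exprn_gt0.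
have c2m : c ^+ 2 <= cmax ^+ 2 by rewrite lerXn2r// nnegrE ltW.
apply: (H _ _ P (fun w => c * X w)) => //.
- exact: measurable_funM.
- apply/andP; split; first exact: mulr_gt0.
  by apply: le_trans c2m; rewrite ler_piMr// ltW.
move=> u b; have := hc (u * c) b.
under eq_Rintegral do rewrite -mulrA.
have -> : (u * c) ^+ 2 / 2 * v = u ^+ 2 / 2 * (c ^+ 2 * v) by ring.
move=> h; apply: le_trans h _; rewrite ler_pM2r//.
have u2 := sqr_ge0 u.
have uc : (u * c) ^+ 2 <= cmax ^+ 2 * u ^+ 2 by rewrite exprMn mulrC ler_wpM2r.
have uc0 := sqr_ge0 (u * c).
by apply: ler_pM; rewrite ?expR_ge0 ?divr_ge0 ?ler_expR//; lra.
Qed.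

(** The projection of the compact subset of the cylinder to lengths is compact, hence bounded and
    closed; it avoids 0, so it avoids a ball around 0. *)
Lemma param_compact_bounds (K : set (R * R)) : param_compact K ->
  exists l0 l1 : R, [/\ 0 < l0, 0 < l1 & forall p, K p -> l0 <= p.1 <= l1].
Proof.
move=> [KP Kc].
pose S := [set p.1 | p in K].
have cS : compact S.
  have -> : S = (fun y : R * R * R => y.1.1) @` [set ((p.1, cos p.2), sin p.2) | p in K].
    apply/seteqP; split => [_ [p Kp <-]|_ [_ [p Kp <-] <-]]; last by exists p.
    by exists ((p.1, cos p.2), sin p.2) => //; exists p.
  apply: continuous_compact Kc; apply: continuous_subspaceT => y.
  by apply: (@continuous_comp _ _ _ fst fst); exact: cvg_fst.
have [M [_ hM]] := compact_bounded cS.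
have clS : closed S by apply: compact_closed => //; exact: Rhausdorff.
have oS : open (~` S) by exact: closed_openC.
have nS0 : (~` S) 0.
  by move=> [p /KP[p10 _] p0]; move: p10; rewrite p0 ltxx.
have := open_nbhs_nbhs (conj oS nS0).
rewrite -nbhs_ballE => -[l0 /= l00 hl0].
exists l0, (`|M| + 1); split; [by []|by rewrite ltr_wpDl|].
move=> p Kp; have p10 := (KP _ Kp).1; apply/andP; split.
  rewrite leNgt; apply/negP => pl; apply: (hl0 p.1); last by exists p.
  by rewrite /ball/= sub0r normrN gtr0_norm.
have := hM (`|M| + 1) _ p.1 (ex_intro2 _ _ p Kp erefl).
move=> h; apply: le_trans (ler_norm _) (h _).
by rewrite (le_lt_trans (ler_norm _))// ltrDl.
Qed.

Lemma unif_cvg_normal_crit {d : measure_display} {Omega : measurableType d}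
    (P : R * R -> probability Omega R) (K : set (R * R)) (Z : R -> R * R -> Omega -> R) (v : R * R -> R) :
  (forall g : R -> R, continuous g -> bounded_fun g -> forall eps : R, 0 < eps ->
    exists2 T0 : R, 0 < T0 & forall Tm p, T0 <= Tm -> K p ->
      `|\int[P p]_w g (Z Tm p w) - \int[normal_prob 0 (Num.sqrt (v p))]_x g x| <= eps) ->
  unif_cvg_normal P K Z v.
Proof.
move=> H g cg bg; apply/cvgrPdist_le => eps eps0.
have [T0 T00 HT] := H g cg bg eps eps0.
exists T0; split; first exact: num_real.
move=> Tm /ltW T0m; rewrite sub0r normrN.
set S := [set _ | _ in K].
have S_le y : S y -> 0 <= y <= eps.
  move=> [p Kp <-]; rewrite normr_ge0/=; have := HT Tm p T0m Kp.
  by rewrite unlock.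
(* For empty [K] the supremum is 0 by convention; otherwise a member of [S] shows that the supremum
   is nonnegative. *)
have [->|/set0P[y Sy]] := eqVneq S set0; first by rewrite sup0 normr0 ltW.
have ubS : ubound S eps by move=> z /S_le/andP[].
have /andP[y0 _] := S_le y Sy.
rewrite ger0_norm; first by apply: sup_le_ub ubS; exists y.
by apply: le_trans y0 _; apply: ub_le_sup Sy; exists eps.
Qed.

End normalized_estimators.

Theorem theorem3p2 (R : realType) (d : measure_display)
  (Omega : measurableType d) (sigma : R) (sigma_gt0 : 0 < sigma)
  (P : R * R -> probability Omega R)
  (W theta : R * R -> R -> Omega -> R)
  (model : forall p, param_space p ->
     von_mises_process (P p) sigma p (W p) (theta p))
  (L : R * R -> R -> R * R -> Omega -> R)
  (likelihood : forall p T, param_space p -> 0 < T ->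
     log_likelihood (P p) sigma (theta p) T (L p T))
  (est : R * R -> R -> Omega -> R * R)
  (est_mle : forall p T, param_space p -> 0 < T ->
     mle (P p) (L p T) (est p T))
  (K : set (R * R)) (K_compact : param_compact K) :
  let kappa (p : R * R) := 2 * p.1 / sigma ^+ 2 in
  unif_cvg_normal P K
    (fun T p w => Num.sqrt T * ((est p T w).1 - p.1))
    (fun p => 2 * sigma ^+ 2 * besselI 0 (kappa p) /
              (besselI 0 (kappa p) - besselI 2 (kappa p))) /\
  unif_cvg_normal P K
    (fun T p w => Num.sqrt T * angle ((est p T w).2 - p.2))
    (fun p => 2 * sigma ^+ 2 * besselI 0 (kappa p) /
              (p.1 ^+ 2 * (besselI 0 (kappa p) + besselI 2 (kappa p)))).
Proof.
move=> kappa.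
have [l0 [l1 [l00 l10 Kl]]] := param_compact_bounds K_compact.
have KP : K `<=` param_space by case: K_compact.
have [v0 v00 hbe] := bessel_ratio l10 sigma_gt0.
have I00 p : 0 < p.1 -> 0 < besselI 0 (kappa p).
  move=> p10; apply: lt_le_trans ltr01 (besselI0_ge1 _).
  by rewrite divr_gt0 ?exprn_gt0// mulr_gt0.
have I20 p : 0 < p.1 -> 0 <= besselI 2 (kappa p).
  by move=> p10; apply: besselI_ge0; rewrite divr_gt0 ?exprn_gt0// mulr_gt0.
have I02 p : 0 < p.1 -> 0 < besselI 0 (kappa p) - besselI 2 (kappa p).
  move=> p10; apply: lt_le_trans ltr01 (besselI2_lt _).
  by rewrite divr_gt0 ?exprn_gt0// mulr_gt0.
have mest p T : param_space p -> 0 < T -> measurable_fun setT (est p T).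
  by move=> pp T0; case: (est_mle p T pp T0).
split; apply: unif_cvg_normal_crit => g cg bg eps eps0.
- have cmax0 : 0 < sigma / v0 by rewrite divr_gt0.
  have [eta eta0 H] := scaled_levy cg bg cmax0 eps0.
  have [T0 T00 HT] := mle_asymptotics sigma_gt0 l00 l10 v00 eta0 hbe.
  exists T0 => // Tm p T0m Kp.
  have pp := KP _ Kp; have p10 := pp.1; have /andP[_ pl1] := Kl _ Kp.
  have Tm0 : 0 < Tm by apply: lt_le_trans T0m.
  have [X1 [X2 [[mX1 mX2] c1 c2 k1 k2]]] := HT _ _ _ _ _ _ _ _ _ pp (Kl _ Kp) T0m
    (model _ pp) (likelihood _ _ pp Tm0) (est_mle _ _ pp Tm0).
  have [/half_sum_bounds[_ b1 b2] v01 v02] := hbe _ p10 pl1.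
  have v1 : 0 < (1 - besselI 2 (kappa p) / besselI 0 (kappa p)) / 2 by apply: lt_le_trans v01.
  (* With v = (1 - I_2 / I_0) / 2, the score has limiting variance v and the estimator is sigma / v
     times the score, so the variance is sigma^2 / v. *)
  have -> : 2 * sigma ^+ 2 * besselI 0 (kappa p) / (besselI 0 (kappa p) - besselI 2 (kappa p)) =
      (sigma / ((1 - besselI 2 (kappa p) / besselI 0 (kappa p)) / 2)) ^+ 2 *
      ((1 - besselI 2 (kappa p) / besselI 0 (kappa p)) / 2).
    by field; rewrite !gt_eqF// ?I00// ?I02.
  apply: (H _ _ _ X1) => //.
  + apply: measurable_funM => //; apply: measurable_funB => //.
    by apply: (measurableT_comp measurable_fst); exact: mest.
  + apply/andP; split; first by rewrite divr_gt0.
    by rewrite ler_pM2l// lef_pV2 ?posrE.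
  + by apply/andP; split.
- have cmax0 : 0 < sigma / (l0 * v0) by rewrite divr_gt0// mulr_gt0.
  have [eta eta0 H] := scaled_levy cg bg cmax0 eps0.
  have [T0 T00 HT] := mle_asymptotics sigma_gt0 l00 l10 v00 eta0 hbe.
  exists T0 => // Tm p T0m Kp.
  have pp := KP _ Kp; have p10 := pp.1; have /andP[l0p pl1] := Kl _ Kp.
  have Tm0 : 0 < Tm by apply: lt_le_trans T0m.
  have [X1 [X2 [[mX1 mX2] c1 c2 k1 k2]]] := HT _ _ _ _ _ _ _ _ _ pp (Kl _ Kp) T0m
    (model _ pp) (likelihood _ _ pp Tm0) (est_mle _ _ pp Tm0).
  have [/half_sum_bounds[_ b1 b2] v01 v02] := hbe _ p10 pl1.
  have v2 : 0 < (1 + besselI 2 (kappa p) / besselI 0 (kappa p)) / 2 by apply: lt_le_trans v02.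
  have I0p2 : 0 < besselI 0 (kappa p) + besselI 2 (kappa p) by rewrite ltr_wpDr ?I20 ?I00.
  (* The same computation with v = (1 + I_2 / I_0) / 2 and the factor sigma / (lambda v): an angle
     is a transverse deviation divided by the length. *)
  have -> : 2 * sigma ^+ 2 * besselI 0 (kappa p) /
      (p.1 ^+ 2 * (besselI 0 (kappa p) + besselI 2 (kappa p))) =
      (sigma / (p.1 * ((1 + besselI 2 (kappa p) / besselI 0 (kappa p)) / 2))) ^+ 2 *
      ((1 + besselI 2 (kappa p) / besselI 0 (kappa p)) / 2).
    by field; rewrite !gt_eqF// ?I00.
  apply: (H _ _ _ X2) => //.
  + apply: measurable_funM => //; apply: (measurableT_comp measurable_angle).
    apply: measurable_funB => //.
    by apply: (measurableT_comp measurable_snd); exact: mest.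
  + have pv : 0 < p.1 * ((1 + besselI 2 (kappa p) / besselI 0 (kappa p)) / 2) by apply: mulr_gt0.
    apply/andP; split; first by rewrite divr_gt0.
    rewrite ler_pM2l// lef_pV2 ?posrE//; last by rewrite mulr_gt0.
    by apply: ler_pM => //; exact: ltW.
  + by apply/andP; split.
Qed.
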